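(* $\mathcal C^*$ is a countable $\mathbb Q$-subspace of $\mathcal S'$. Moreover, for every $\Phi\in\mathcal S^*$ there exists a sequence $(\Phi_n)$ in $\mathcal C^*$ converging pointwise to $\Phi$ with respect to the discrete topology on $\mathbb Q$, i.e., for every $\alpha\in\mathcal S$ one has $\Phi_n(\alpha)=\Phi(\alpha)$ for all sufficiently large $n$.
   Context: Let $\overline{\mathbb Q}$ be an algebraic closure of $\mathbb Q$, $A$ the ring of algebraic integers, $\mathcal S=\overline{\mathbb Q}^\times/A^\times$ (a $\mathbb Q$-vector space, written multiplicatively with scalar action $\alpha\mapsto\alpha^r$). $\mathcal S^*$ is the set of $\mathbb Q$-linear maps $\mathcal S\to\mathbb Q$. For a number field $K$ and non-Archimedean place $v$ of $K$, $p_v$ is the prime below $v$, $K_v$ the completion, $\|\cdot\|_v$ the extension to $K_v$ of the $p_v$-adic absolute value, and $|x|_v=\|x\|_v^{[K_v:\mathbb Q_{p_v}]/[K:\mathbb Q]}$. The norm on $\mathcal S$ is $\|\gamma\|_{\mathcal S}=\sum_v|\log|\gamma|_v|$ over non-Archimedean places of any number field $K\ni\gamma$; $\mathcal S'$ is the set of elements of $\mathcal S^*$ continuous for this norm and the usual absolute value on $\mathbb Q$. Let $\mathcal H_K$ be the image of $K^\times$ in $\mathcal S$, $\mathcal S_K=\{\alpha:\alpha^n\in\mathcal H_K\text{ for some }n\in\mathbb N\}$, $\|\alpha\|_v=\|\alpha^n\|_v^{1/n}$ when $\alpha^n\in\mathcal H_K$. Let $\mathcal J$ be the set of pairs $(K,v)$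 with $K$ a number field and $v$ a non-Archimedean place of $K$. A map $c:\mathcal J\to\mathbb Q$ is consistent if $c(K,v)=\sum_{w\mid v}c(L,w)$ for all number fields $K$, finite extensions $L/K$, non-Archimedean $v$ of $K$. For consistent $c$, $\Phi_c(\alpha)=\sum_v\frac{c(K,v)}{\log p_v}\log\|\alpha\|_v$ over non-Archimedean places of any $K$ with $\alpha\in\mathcal S_K$; every element of $\mathcal S^*$ is $\Phi_c$ for a unique consistent $c$. $G=\mathrm{Gal}(\overline{\mathbb Q}/\mathbb Q)$ acts on $\mathcal S$, and $\mathrm{Stab}_G(\Phi)=\{\sigma\in G:\Phi\circ\sigma=\Phi\}$; $\mathcal S^*_{\mathrm{fin}}=\{\Phi\in\mathcal S^*:[G:\mathrm{Stab}_G(\Phi)]<\infty\}$. A consistent map $c$ is supported on a set $\mathfrak P$ of primes if $c(K,v)=0$ whenever $v$ does not divide a prime in $\mathfrak P$; it (and $\Phi_c$) is compactly supported if it is supported on some finite $\mathfrak P$. $\mathcal S^*_{\mathrm{com}}$ is the set of compactly supported elements of $\mathcal S^*$, and $\mathcal C^*=\mathcal S^*_{\mathrm{fin}}\cap\mathcal S^*_{\mathrm{com}}$. *)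

(* Defs.v *)
From HB Require Import structures.
From mathcomp Require Import all_boot all_order all_algebra all_field.
From mathcomp Require Import classical_sets cardinality Rstruct.
From Stdlib Require Rpower ClassicalEpsilon.

Set Implicit Arguments.
Unset Strict Implicit.
Unset Printing Implicit Defensive.

Import Order.TTheory GRing.Theory Num.Theory.
Local Open Scope ring_scope.

Notation RR := Rdefinitions.R.
Definition rlog (x : RR) : RR := Rpower.ln x.

Definition choose_nat (P : nat -> Prop) : nat :=
  ClassicalEpsilon.epsilon (inhabits 0%N) P.

Definition is_subfield (K : pred algC) : Prop :=
  [/\ K 1,
      forall x y, K x -> K y -> K (x - y),
      forall x y, K x -> K y -> K (x * y) &
      forall x, K x -> K x^-1].

Definition rat_comb (q : seq rat) (s : seq algC) : algC :=
  \sum_(i < size s) ratr (nth 0 q i) * nth 0 s i.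

Definition is_Qbasis (K : pred algC) (s : seq algC) : Prop :=
  [/\ all K s,
      (forall x, K x -> exists q : seq rat, x = rat_comb q s) &
      (forall q : seq rat, size q = size s -> rat_comb q s = 0 ->
          forall i, (i < size s)%N -> nth 0 q i = 0)].

Definition number_field (K : pred algC) : Prop :=
  is_subfield K /\ exists s, is_Qbasis K s.

Definition degQ (K : pred algC) : nat :=
  choose_nat (fun n => exists s, is_Qbasis K s /\ size s = n).

(* Non-Archimedean places.  A non-Archimedean place v of K lying over *)
(* the prime p is represented by the absolute value ||.||_v on K that *)
(* extends the p-adic absolute value of Q (so ||p||_v = 1/p); it is   *)
(* set to 0 outside K so that the representation is canonical.        *)

Definition is_nonarch_abs (K : pred algC) (v : algC -> RR) (p : nat) : Prop :=
  [/\ forall x y, K x -> K y -> v (x * y) = v x * v y,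
      forall x y, K x -> K y -> v (x + y) <= Num.max (v x) (v y) &
      v p%:R = p%:R^-1].

Definition is_place_over (K : pred algC) (p : nat) (v : algC -> RR) : Prop :=
  [/\ prime p,
      forall x, ~~ K x -> v x = 0,
      forall x, 0 <= v x,
      forall x, K x -> (v x = 0 <-> x = 0) &
      is_nonarch_abs K v p].

Definition is_place (K : pred algC) (v : algC -> RR) : Prop :=
  exists p, is_place_over K p v.

Definition prime_below (K : pred algC) (v : algC -> RR) : nat :=
  choose_nat (fun p => is_place_over K p v).

Definition place_above (K : pred algC) (v : algC -> RR) (w : algC -> RR) : Prop :=
  forall x, K x -> w x = v x.

(* Local degree [K_v : Q_p] = e_v * f_v, with e_v the ramification index
   (index of the value group of v over that of Q) and f_v the residue
   degree (|O_v / m_v| = p ^ f_v). *)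
Definition is_ram_index (K : pred algC) (v : algC -> RR) (e : nat) : Prop :=
  (0 < e)%N /\
  exists pi, [/\ K pi, pi != 0, v pi ^+ e = (prime_below K v)%:R^-1 &
    forall x, K x -> x != 0 -> exists k : int, v x = v pi ^ k].

Definition is_res_degree (K : pred algC) (v : algC -> RR) (f : nat) : Prop :=
  exists s : seq algC,
  [/\ size s = (prime_below K v ^ f)%N,
      all K s,
      all (fun x => v x <= 1) s,
      (forall i j, (i < size s)%N -> (j < size s)%N -> i != j ->
          v (nth 0 s i - nth 0 s j) = 1) &
      (forall x, K x -> v x <= 1 -> exists2 i, (i < size s)%N &
          v (x - nth 0 s i) < 1)].

Definition local_degree (K : pred algC) (v : algC -> RR) : nat :=
  (choose_nat (is_ram_index K v) * choose_nat (is_res_degree K v))%N.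

(* The space S = Qbar^x / A^x.  An element of S is represented by a    *)
(* nonzero x : algC; x and x*u (u a unit of A) represent the same      *)
(* element.  alpha \in S_K iff alpha^n \in H_K for some n >= 1, i.e.   *)
(* x^n = y * u with y \in K^x and u \in A^x; then                      *)
(* ||alpha||_v = ||y||_v^(1/n).                                        *)

Definition Aunit (u : algC) : Prop := u \in Aint /\ u^-1 \in Aint /\ u != 0.

Definition in_SK (K : pred algC) (x : algC) (n : nat) (y : algC) : Prop :=
  [/\ (0 < n)%N, K y, y != 0 & exists u, Aunit u /\ x ^+ n = y * u].

Definition covers_support (K : pred algC) (y : algC) (vs : seq (algC -> RR)) : Prop :=
  [/\ List.NoDup vs,
      (forall v, List.In v vs -> is_place K v) &
      (forall v, is_place K v -> v y != 1 -> List.In v vs)].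

(* log ||alpha||_v, for alpha represented by x with x^n = y u, y in K *)
Definition log_vnorm (v : algC -> RR) (n : nat) (y : algC) : RR :=
  rlog (v y) / n%:R.

(* ||alpha||_S = sum_v | log |alpha|_v |,  log|alpha|_v = [K_v:Q_p]/[K:Q] log||alpha||_v.
   normS x r : r is the S-norm of the class of x (computed in any
   number field K with alpha in S_K). *)
Definition normS (x : algC) (r : RR) : Prop :=
  forall K n y vs, number_field K -> in_SK K x n y -> covers_support K y vs ->
    r = \sum_(v <- vs)
          `| (local_degree K v)%:R / (degQ K)%:R * log_vnorm v n y |.

(* S^* : Q-linear maps S -> Q.  As S is written multiplicatively, such a
   map is a function Phi on algC^x with Phi(xy) = Phi x + Phi y that
   vanishes on A^x (Q-homogeneity is automatic for additive maps into Q);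
   we normalize Phi 0 = 0 (0 does not represent an element of S). *)
Definition Sdual (Phi : algC -> rat) : Prop :=
  [/\ Phi 0 = 0,
      forall x y, x != 0 -> y != 0 -> Phi (x * y) = Phi x + Phi y &
      forall u, Aunit u -> Phi u = 0].

Definition Sprime (Phi : algC -> rat) : Prop :=
  Sdual Phi /\
  forall x0, x0 != 0 -> forall eps : RR, 0 < eps -> exists2 delta : RR, 0 < delta &
    forall x r, x != 0 -> normS (x / x0) r -> r < delta ->
      `| ratr (Phi x) - ratr (Phi x0) : RR | < eps.

(* consistent maps c : J -> Q (values of c outside J are irrelevant) *)
Definition consistent (c : pred algC -> (algC -> RR) -> rat) : Prop :=
  forall K L v, number_field K -> number_field L -> {subset K <= L} ->
    is_place K v ->
    exists ws : seq (algC -> RR),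
      [/\ List.NoDup ws,
          (forall w, List.In w ws <-> is_place L w /\ place_above K v w) &
          c K v = \sum_(w <- ws) c L w].

Definition is_Phi_c (c : pred algC -> (algC -> RR) -> rat) (Phi : algC -> rat) : Prop :=
  forall x K n y vs, x != 0 -> number_field K -> in_SK K x n y ->
    covers_support K y vs ->
    (ratr (Phi x) : RR) =
      \sum_(v <- vs) ratr (c K v) / rlog (prime_below K v)%:R * log_vnorm v n y.

Definition supported_on (c : pred algC -> (algC -> RR) -> rat) (P : seq nat) : Prop :=
  forall K v, number_field K -> is_place K v -> prime_below K v \notin P ->
    c K v = 0.

Definition compactly_supported (Phi : algC -> rat) : Prop :=
  exists c, [/\ consistent c, is_Phi_c c Phi & exists P, supported_on c P].

(* G = Gal(Qbar/Q): the ring endomorphisms of algC (all of which are   *)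
(* automorphisms fixing Q).                                            *)
Definition Gal := {rmorphism algC -> algC}.

Definition in_Stab (Phi : algC -> rat) (s : Gal) : Prop :=
  forall x, Phi (s x) = Phi x.

Definition finite_index_stab (Phi : algC -> rat) : Prop :=
  exists taus : seq Gal, forall s : Gal, exists tau,
    List.In tau taus /\ exists h : Gal, in_Stab Phi h /\ forall x, s x = h (tau x).

Definition Sdual_fin (Phi : algC -> rat) : Prop := Sdual Phi /\ finite_index_stab Phi.
Definition Sdual_com (Phi : algC -> rat) : Prop := Sdual Phi /\ compactly_supported Phi.

Definition Cstar : set (algC -> rat) := fun Phi => Sdual_fin Phi /\ Sdual_com Phi.

(* Main.v *)
(** The absolute Galois group acts transitively on the extensions [W] of the
    [p]-adic valuation to [algC], so every place of a number field [K] over [p]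
    is the restriction to [K] of [W \o s] for some automorphism [s].  Hence each
    function [x |-> E_t ([t|X = w] * ord_p (t x))], where [E_t] is the Haar mean
    over automorphisms [t] and [w] a prescribed restriction of [t] to a finite
    set [X], is given by the consistent map [c (K, v) = - E_t [t|X = w, W \o t|K = v]],
    and is fixed by the open subgroup fixing [X].  Conversely, if [Phi] is
    invariant under the subgroup fixing [X] and supported on finitely many
    primes, taking the norm down to level [X] shows that [Phi] vanishes where
    the finitely many functions attached to [X] and these primes do; so [Phi] is
    a rational combination of them.  Therefore C^* consists of the rational
    combinations of these countably many functions.  Continuity follows from
    [E_t [W \o t|K = v] <= [K_v : Q_p] / [K : Q]], that is [n <= e f g] for
    normal [K], proved by counting integers modulo powers of [p].  For the
    approximation, a given [Phi] restricted to finitely many numbers is matched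
    in the same way, since a number of valuation zero everywhere is a unit. *)

Require Import Defs.
From HB Require Import structures.
From mathcomp Require Import all_boot all_order all_algebra all_field.
From mathcomp Require Import boolp classical_sets cardinality Rstruct.
From mathcomp Require Import ring.
From Stdlib Require Reals.
Import Defs.
Set Implicit Arguments.
Unset Strict Implicit.
Unset Printing Implicit Defensive.
Import Order.TTheory GRing.Theory Num.Theory.
Local Open Scope ring_scope.

(** * Automorphisms of [algC] *)

(** A consistent map is defined on all number fields at once, and these need be neither normal nor
    large enough to contain [X]. Averaging over all automorphisms of [algC] treats them uniformly: a
    place becomes an event, and consistency is additivity of the mean over the events that refine
    it. Every function averaged factors through the restriction to a finite set, so its mean is a
    finite average over coset representatives. The valuation is additive with values in Q because
    the functionals are Q-valued; real absolute values come from it through [pexp]. It is obtained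
    from a maximal subring of [algC], so that all number fields share one valuation. Ramification
    index and residue degree are selected by choice from a specification, so both must be shown to
    exist before the local degree can be estimated. *)

Definition gcomp (s t : Gal) : Gal := GRing.RMorphism.clone _ _ (s \o t) _.
Definition ginv (s : Gal) : Gal := GRing.RMorphism.clone _ _ (algC_invaut s) _.
Definition gid : Gal := GRing.RMorphism.clone _ _ idfun _.

Lemma gcompE s t x : gcomp s t x = s (t x). Proof. by []. Qed.
Lemma gidE x : gid x = x. Proof. by []. Qed.
Lemma ginvK (s : Gal) : cancel s (ginv s).
Proof. exact: algC_autK. Qed.
Lemma ginvKV (s : Gal) : cancel (ginv s) s.
Proof. exact: algC_invautK. Qed.

Definition conjs (x : algC) : seq algC :=
  sval (closed_field_poly_normal (minCpoly x)).

Lemma minCpoly_conjs x : minCpoly x = \prod_(z <- conjs x) ('X - z%:P).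
Proof.
rewrite /conjs; case: closed_field_poly_normal => r /= {1}->.
by rewrite (monicP (minCpoly_monic x)) scale1r.
Qed.

Lemma root_conjs x z : (z \in conjs x) = root (minCpoly x) z.
Proof. by rewrite minCpoly_conjs root_prod_XsubC. Qed.

Lemma conjs_refl x : x \in conjs x.
Proof. by rewrite root_conjs root_minCpoly. Qed.

Lemma conjs_gal x (s : Gal) : s x \in conjs x.
Proof. by rewrite root_conjs -(minCpoly_aut s) root_minCpoly. Qed.

(** The isomorphism Q(x) -> Q(y) extends to the splitting field of the minimal polynomial by
    normality, and from there to [algC]. *)
Lemma gal_conjs x y : y \in conjs x -> exists s : Gal, s x = y.
Proof.
move=> Ry.
have [Qr [QrC [rr Drr genQr]]] := num_field_exists (conjs x).
have [p [Dp mon_p] pP] := minCpolyP x.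
have in_rr z : z \in conjs x -> exists2 z1, z1 \in rr & z = QrC z1.
  by rewrite -{1}Drr => /mapP.
have [x1 rx1 Dx] := in_rr _ (conjs_refl x).
have [y1 ry1 Dy] := in_rr _ Ry.
have mapQ (q : {poly rat}) : map_poly QrC (map_poly (in_alg Qr) q) = map_poly ratr q.
  rewrite -map_poly_comp; apply: eq_map_poly => a.
  by rewrite /= rmorphZ_num rmorph1 mulr1.
pose pr := map_poly (in_alg Qr) p.
have Qpr : pr \is a polyOver 1%VS.
  by apply/polyOverP=> i; rewrite coef_map memvZ ?memv_line.
have splitpr : splittingFieldFor 1 pr fullv.
  exists rr => //; suff -> : pr = \prod_(z <- rr) ('X - z%:P) by apply: eqpxx.
  apply: (map_poly_inj QrC).
  rewrite mapQ -Dp minCpoly_conjs -Drr big_map rmorph_prod.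
  by apply: eq_bigr => z _; rewrite rmorphB /= map_polyX map_polyC.
have hom1 : kHom 1 1 (\1%VF : 'End(Qr)) by rewrite kHom1.
have rxy : root (map_poly \1%VF (minPoly 1 x1)) y1.
  rewrite (@eq_map_poly _ _ _ idfun) => [|a]; last by rewrite /= id_lfunE.
  rewrite map_poly_id //.
  have [q Dq] : exists q, minPoly 1 x1 = map_poly (in_alg Qr) q.
    have aP i: (minPoly 1 x1)`_i \in 1%VS.
      by apply/polyOverP; apply: minPolyOver.
    have{aP} a_ i := sig_eqW (vlineP _ _ (aP i)).
    exists (\poly_(i < size (minPoly 1 x1)) sval (a_ i)).
    apply/polyP=> i; rewrite coef_map coef_poly /=.
    case: ltnP => [_|le]; first by case: (a_ i).
    by rewrite scale0r nth_default.
  rewrite -(fmorph_root QrC) Dq mapQ -Dy.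
  have : root (map_poly ratr q) x.
    by rewrite Dx -mapQ -Dq fmorph_root root_minPoly.
  rewrite pP => /dvdpP[q2 ->]; rewrite rmorphM rootM /= -Dp -root_conjs Ry.
  by rewrite orbT.
pose f := kHomExtend 1 \1 x1 y1.
have homf : kHom 1 <<1; x1>> f by apply: kHomExtendP.
have [g homg Dg] := kHom_extends (sub1v _) homf Qpr
  (splittingFieldForS (sub1v _) (subvf _) splitpr).
have gm : monoid_morphism g by apply/kHom_monoid_morphism.
pose gmM := GRing.isMonoidMorphism.Build _ _ g gm.
pose gRM : {rmorphism _ -> _} := HB.pack (fun_of_lfun g) gmM.
have [nu Dnu] := extend_algC_subfield_aut QrC gRM.
exists nu; rewrite Dx -Dnu Dy /= -Dg ?memv_adjoin //.
by rewrite /f (kHomExtend_val hom1).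
Qed.

(** All conjugates equal x, so their sum, a coefficient of the minimal polynomial up to sign, is a
    positive multiple of x. *)
Lemma gal_fixed_Crat x : (forall s : Gal, s x = x) -> x \in Crat.
Proof.
move=> fx; have allx z : z \in conjs x -> z = x.
  by case/gal_conjs=> s <-.
have sz : size (conjs x) != 0%N.
  by have := conjs_refl x; case: (conjs x).
have [p [Dp _] _] := minCpolyP x.
have := coefPn_prod_XsubC sz; rewrite -minCpoly_conjs Dp coef_map /=.
have -> : \sum_(z <- conjs x) z = x *+ size (conjs x).
  rewrite (eq_big_seq (fun=> x)); last by move=> z /allx.
  by rewrite big_const_seq count_predT iter_addr_0.
move/(congr1 -%R); rewrite opprK => E.
have -> : x = (x *+ size (conjs x)) / (size (conjs x))%:R.
  by rewrite -mulr_natr mulfK // pnatr_eq0.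
by rewrite -E rpred_div ?rpredN ?rpred_nat ?Crat_rat.
Qed.

(** * Restriction to finite sets and coset representatives *)

Definition agree (X : seq algC) (s t : Gal) : bool := map s X == map t X.

Lemma agreeP X (s t : Gal) : reflect {in X, s =1 t} (agree X s t).
Proof. by apply: (iffP eqP) => /eq_in_map. Qed.

Lemma agree_sym X s t : agree X s t = agree X t s.
Proof. by rewrite /agree eq_sym. Qed.
Lemma agreeS X Y s t : {subset X <= Y} -> agree Y s t -> agree X s t.
Proof. by move=> XY /agreeP E; apply/agreeP => x /XY /E. Qed.

Definition gstable (X : seq algC) := forall (s : Gal) x, x \in X -> s x \in X.

Definition nclos (X : seq algC) : seq algC := flatten [seq conjs x | x <- X].

Lemma nclos_sub X : {subset X <= nclos X}.
Proof. by move=> x Xx; apply/flatten_mapP; exists x => //; apply: conjs_refl. Qed.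

Lemma nclos_stable X : gstable (nclos X).
Proof.
move=> s y /flatten_mapP[x Xx /gal_conjs[t <-]].
by apply/flatten_mapP; exists x => //; rewrite -gcompE conjs_gal.
Qed.

(** A transversal of the cosets of the pointwise stabilizer of [X]. *)
Definition reps (X : seq algC) (T : seq Gal) :=
  forall s : Gal, count (agree X s) T = 1%N.

(** Each element has finitely many conjugates, so only finitely many lists can occur as [map s X];
    one automorphism is chosen for each that does. *)
Lemma reps_exist X : exists T, reps X T.
Proof.
have [L LP] : exists L : seq (seq algC), forall s : Gal, map s X \in L.
  elim: X => [|x X [L LP]]; first by exists [:: [::]].
  exists [seq z :: l | z <- conjs x, l <- L] => s.
  by apply/allpairsP; exists (s x, map s X); rewrite conjs_gal LP.
pose f w : option Gal :=
  if pselect (exists s : Gal, map s X = w) is left e then Some (projT1 (cid e))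
  else None.
have fP w s : f w = Some s -> map s X = w.
  by rewrite /f; case: pselect => // e [<-]; case: (cid e).
have fS (s : Gal) : f (map s X) <> None.
  by rewrite /f; case: pselect => // H; case: H; exists s.
exists (pmap f (undup L)) => s.
have -> : count (agree X s) (pmap f (undup L)) =
          count (pred1 (map s X)) (undup L).
  elim: (undup L) => //= w l IH; case E: (f w) => [t|] /=.
    by rewrite /agree (fP _ _ E) IH eq_sym.
  rewrite IH; case: eqP => // e; case: (fS s).
  by rewrite -e E.
by rewrite count_uniq_mem ?undup_uniq // mem_undup LP.
Qed.

(** * Haar means at finite level *)

Definition level (V : Type) (X : seq algC) (F : Gal -> V) :=
  forall s t, agree X s t -> F s = F t.

(** These are the locally constant functions for the Krull topology. *)
Definition flevel (V : Type) (F : Gal -> V) := exists X, level X F.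

Lemma levelS (V : Type) X Y (F : Gal -> V) :
  {subset X <= Y} -> level X F -> level Y F.
Proof. by move=> XY lF s t /(agreeS XY) /lF. Qed.

Lemma flevel_stable (V : Type) (F : Gal -> V) :
  flevel F -> exists2 X, gstable X & level X F.
Proof.
case=> X lF; exists (nclos X); first exact: nclos_stable.
exact: levelS (@nclos_sub X) lF.
Qed.

Lemma flevel2_stable (V W : Type) (F : Gal -> V) (G : Gal -> W) :
  flevel F -> flevel G -> exists X, [/\ gstable X, level X F & level X G].
Proof.
move=> [X lF] [Y lG]; exists (nclos (X ++ Y)); split; first exact: nclos_stable.
  by apply: levelS lF => x Xx; apply: nclos_sub; rewrite mem_cat Xx.
by apply: levelS lG => x Xx; apply: nclos_sub; rewrite mem_cat Xx orbT.
Qed.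

Lemma flevel_cst (V : Type) (v : V) : flevel (fun=> v).
Proof. by exists [::]. Qed.

Lemma flevel_app2 (U V W : Type) (f : U -> V -> W) (F : Gal -> U) (G : Gal -> V) :
  flevel F -> flevel G -> flevel (fun s => f (F s) (G s)).
Proof.
move=> lF lG; have [X [_ lF' lG']] := flevel2_stable lF lG.
by exists X => s t st; rewrite (lF' _ _ st) (lG' _ _ st).
Qed.

Lemma flevel_app (V W : Type) (f : V -> W) (F : Gal -> V) :
  flevel F -> flevel (fun s => f (F s)).
Proof. by case=> X lF; exists X => s t /lF ->. Qed.

Lemma flevel_sum (V : nmodType) (I : Type) (r : seq I) (F : I -> Gal -> V) :
  (forall i, flevel (F i)) -> flevel (fun s => \sum_(i <- r) F i s).
Proof.
move=> lF; elim: r => [|i r [X IH]].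
  by exists [::] => s t _; rewrite !big_nil.
have [Y [_ l1 l2]] := flevel2_stable (lF i) (ex_intro _ X IH).
by exists Y => s t st; rewrite !big_cons (l1 _ _ st) (l2 _ _ st).
Qed.

Lemma flevel_eval (x : algC) : flevel (fun s : Gal => s x).
Proof. by exists [:: x] => s t /agreeP; apply; rewrite inE. Qed.

Lemma flevel_map (X : seq algC) : flevel (fun s : Gal => map s X).
Proof. by exists X => s t /eqP. Qed.

Section RepsSums.
Variables (V : zmodType) (X : seq algC) (T : seq Gal).
Hypothesis rT : reps X T.

Lemma reps_sum_agree (v : V) s : \sum_(t <- T | agree X s t) v = v.
Proof. by rewrite big_const_seq rT /= addr0. Qed.

(** The hypothesis says that [f] and [g] induce inverse maps on classes modulo agreement on [X].
    Replacing [f t] by the representative of its class and exchanging the sums gives the result. *)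
Lemma reps_sum_bij (F : Gal -> V) (f g : Gal -> Gal) : level X F ->
  (forall t t', agree X (f t) t' = agree X (g t') t) ->
  \sum_(t <- T) F (f t) = \sum_(t <- T) F t.
Proof.
move=> lF fg.
transitivity (\sum_(t <- T) \sum_(t' <- T | agree X (f t) t') F t').
  apply: eq_bigr => t _; rewrite -[LHS](reps_sum_agree _ (f t)).
  by apply: eq_bigr => t' /lF.
rewrite (exchange_big_dep predT) //=; apply: eq_bigr => t' _.
by under eq_bigl => t do rewrite fg; rewrite reps_sum_agree.
Qed.

Lemma reps_sum_left (F : Gal -> V) s : level X F ->
  \sum_(t <- T) F (gcomp s t) = \sum_(t <- T) F t.
Proof.
move=> lF; apply: (reps_sum_bij lF (g := gcomp (ginv s))) => t t'.
by apply/agreeP/agreeP => H x Xx; [rewrite /= -H //= ginvK | rewrite /= -H //= ginvKV].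
Qed.

(** Translation on the right evaluates [t] on the image of [X] under [s]; this is where stability of
    [X] enters. *)
Lemma reps_sum_right (F : Gal -> V) s : gstable X -> level X F ->
  \sum_(t <- T) F (gcomp t s) = \sum_(t <- T) F t.
Proof.
move=> sX lF; apply: (reps_sum_bij lF (f := fun t => gcomp t s)
  (g := fun t => gcomp t (ginv s))) => t t'.
apply/agreeP/agreeP => H x Xx /=; first by rewrite -H ?sX //= ginvKV.
by rewrite -H ?sX //= ginvK.
Qed.

Lemma reps_size_gt0 : (0 < size T)%N.
Proof. by have := rT gid; case: T. Qed.
End RepsSums.

Definition avg (T : seq Gal) (F : Gal -> rat) : rat :=
  (\sum_(t <- T) F t) / (size T)%:R.

(** The double sum of [F (gcomp t t')] is computed in two ways: by right invariance for fixed [t'],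
    by left invariance for fixed [t]. *)
Lemma avg_unique X T Y T' F : gstable X -> reps X T -> level X F ->
  reps Y T' -> level Y F -> avg T F = avg T' F.
Proof.
move=> sX rT lF rT' lF'.
have H : (\sum_(t <- T) F t) *+ size T' = (\sum_(t <- T') F t) *+ size T.
  transitivity (\sum_(t' <- T') \sum_(t <- T) F (gcomp t t')).
    rewrite [RHS](eq_bigr (fun=> \sum_(t <- T) F t)); last first.
      by move=> t' _; apply: (reps_sum_right rT (F := F) _ sX lF).
    by rewrite big_const_seq count_predT iter_addr_0.
  rewrite exchange_big /=.
  rewrite (eq_bigr (fun=> \sum_(t <- T') F t)); last first.
    by move=> t _; apply: (reps_sum_left rT' (F := F) _ lF').
  by rewrite big_const_seq count_predT iter_addr_0.
have n0 U Z : reps Z U -> (size U)%:R != 0 :> rat.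
  by move/reps_size_gt0; rewrite pnatr_eq0 lt0n.
rewrite /avg; apply: (mulIf (n0 _ _ rT)); rewrite mulfVK ?(n0 _ _ rT) //.
apply: (mulIf (n0 _ _ rT')); rewrite -mulrA mulrACA -mulrA.
rewrite [(size T)%:R * _]mulrC !mulrA mulfVK ?(n0 _ _ rT') //.
by rewrite !mulr_natr H.
Qed.

(* The Haar mean of a function on Gal that factors through the restriction to
   a finite set; its value on other functions is irrelevant. *)
Definition mean (F : Gal -> rat) : rat :=
  xget 0 [set q | exists X T, [/\ gstable X, reps X T, level X F & q = avg T F]].

(** [avg_unique] asks for stability on one side; the definition of [mean] supplies it, so an
    arbitrary [X] may be used here. *)
Lemma meanE X T F : reps X T -> level X F -> mean F = avg T F.
Proof.
move=> rT lF; rewrite /mean; case: xgetP => [q -> [Y [T' [sY rT' lF' ->]]]|].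
  exact: avg_unique lF' rT lF.
have [Y sY lY] := flevel_stable (ex_intro _ X lF).
have [T' rT'] := reps_exist Y.
by move/(_ (avg T' F)); case; exists Y, T'.
Qed.

Lemma eq_mean F G : F =1 G -> mean F = mean G.
Proof. by move=> E; congr mean; apply/funext. Qed.

Lemma mean_cst q : mean (fun=> q) = q.
Proof.
have [T rT] := reps_exist [::].
rewrite (meanE rT) // /avg big_const_seq count_predT iter_addr_0 -[q *+ _]mulr_natr.
by rewrite mulfK // pnatr_eq0 -lt0n (reps_size_gt0 rT).
Qed.

Lemma meanD F G : flevel F -> flevel G ->
  mean (fun s => F s + G s) = mean F + mean G.
Proof.
move=> lF lG; have [X [_ l1 l2]] := flevel2_stable lF lG.
have [T rT] := reps_exist X.
rewrite !(meanE rT) //; first by rewrite /avg big_split mulrDl.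
by move=> s t st; rewrite (l1 _ _ st) (l2 _ _ st).
Qed.

Lemma meanZ q F : flevel F -> mean (fun s => q * F s) = q * mean F.
Proof.
move=> [X l1]; have [T rT] := reps_exist X.
rewrite !(meanE rT) //; first by rewrite /avg -mulr_sumr mulrA.
by move=> s t st; rewrite (l1 _ _ st).
Qed.

Lemma mean_sum (I : Type) (r : seq I) (F : I -> Gal -> rat) :
  (forall i, flevel (F i)) ->
  mean (fun s => \sum_(i <- r) F i s) = \sum_(i <- r) mean (F i).
Proof.
move=> lF; elim: r => [|i r IH].
  rewrite big_nil -[RHS](mean_cst 0); apply: eq_mean => s.
  by rewrite big_nil.
rewrite big_cons -IH -meanD //; last exact: flevel_sum.
by apply: eq_mean => s; rewrite big_cons.
Qed.

Lemma le_mean F G : flevel F -> flevel G -> (forall s, F s <= G s) ->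
  mean F <= mean G.
Proof.
move=> lF lG FG; have [X [_ l1 l2]] := flevel2_stable lF lG.
have [T rT] := reps_exist X.
rewrite !(meanE rT) // /avg ler_wpM2r ?invr_ge0 ?ler0n //.
exact: ler_sum.
Qed.

Lemma mean_right F u : flevel F -> mean (fun s => F (gcomp s u)) = mean F.
Proof.
move=> lF; have [X sX lX] := flevel_stable lF; have [T rT] := reps_exist X.
have lX' : level X (fun s => F (gcomp s u)).
  move=> s t /agreeP st; apply: lX; apply/agreeP => x Xx /=.
  by rewrite st ?sX.
by rewrite !(meanE rT) // /avg (reps_sum_right rT (F := F)).
Qed.

Lemma mean_norm F : flevel F -> `|mean F| <= mean (fun s => `|F s|).
Proof.
move=> lF; have lN := flevel_app Num.norm lF.
rewrite ler_norml -[- _]mulN1r -meanZ //; apply/andP; split.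
  apply: le_mean => // [|s]; first exact: (flevel_app _ lN).
  by rewrite mulN1r lerNl -normrN ler_norm.
by apply: le_mean => // s; apply: ler_norm.
Qed.

(** * Extending the [p]-adic valuation to [algC] *)

Section MaximalSubring.
Variables (p : nat) (R : set algC).
Hypothesis p_pr : prime p.
Hypotheses (R1 : R 1) (RB : forall x y, R x -> R y -> R (x - y))
  (RM : forall x y, R x -> R y -> R (x * y)) (RpV : ~ R p%:R^-1).
Hypothesis Rmax : forall B : set algC, (R `<=` B)%classic -> B 1 ->
  (forall x y, B x -> B y -> B (x - y)) ->
  (forall x y, B x -> B y -> B (x * y)) -> ~ B p%:R^-1 -> (B `<=` R)%classic.

Let pC : algC := p%:R.
Let p0 : pC != 0. Proof. by rewrite pnatr_eq0 -lt0n prime_gt0. Qed.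

Let R0 : R 0. Proof. by rewrite -(subrr 1); apply: RB. Qed.
Let RN x : R x -> R (- x). Proof. by move=> Rx; rewrite -sub0r; apply: RB. Qed.
Let RD x y : R x -> R y -> R (x + y).
Proof. by move=> Rx Ry; rewrite -[y]opprK; apply: RB => //; apply: RN. Qed.
Let RX x n : R x -> R (x ^+ n).
Proof. by move=> Rx; elim: n => // n IH; rewrite exprS; apply: RM. Qed.
Let Rsum (I : Type) (r : seq I) (P : pred I) (F : I -> algC) :
  (forall i, P i -> R (F i)) -> R (\sum_(i <- r | P i) F i).
Proof. by move=> H; elim/big_rec: _ => // i x /H Fi Rx; apply: RD. Qed.
Let Rnat n : R n%:R.
Proof. by elim: n => // n IH; rewrite -addn1 natrD; apply: RD. Qed.
Let Rhorner (q : {poly algC}) x : (forall i, R q`_i) -> R x -> R q.[x].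
Proof. by move=> Rq Rx; rewrite horner_coef; apply: Rsum => i _; apply: RM; [|apply: RX]. Qed.

(** By maximality the strictly larger ring R[x] contains 1/p. *)
Lemma adjoin_pV x : ~ R x ->
  exists2 q : {poly algC}, (forall i, R q`_i) & q.[x] = pC^-1.
Proof.
move=> nRx; apply: contrapT => nq; apply: nRx.
pose B : set algC := fun y =>
  exists2 q : {poly algC}, (forall i, R q`_i) & q.[x] = y.
have RBs : (R `<=` B)%classic.
  by move=> y Ry; exists y%:P => [i|]; rewrite ?hornerC // coefC; case: ifP.
apply: (Rmax RBs).
- exact: RBs.
- move=> _ _ [q Rq <-] [r Rr <-]; exists (q - r) => [i|]; rewrite ?hornerD ?hornerN //.
  by rewrite coefB; apply: RB.
- move=> _ _ [q Rq <-] [r Rr <-]; exists (q * r) => [i|]; rewrite ?hornerM //.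
  by rewrite coefM; apply: Rsum => j _; apply: RM.
- by [].
by exists 'X => [i|]; rewrite ?hornerX // coefX; apply: Rnat.
Qed.

(** That is, p lies in the Jacobson radical of [R]. If 1/p were a polynomial in 1/u, clearing
    denominators would put u^k / p in [R]; as u^k is 1 modulo p, 1/p would be in [R]. *)
Lemma oneDp_unit r : R r -> 1 + pC * r != 0 /\ R (1 + pC * r)^-1.
Proof.
move=> Rr; set u := 1 + pC * r.
have u0 : u != 0.
  apply/eqP => u0; apply: RpV; have : pC * (- r) = 1.
    by rewrite mulrN; apply/eqP; rewrite eq_sym -addr_eq0; apply/eqP.
  by move/(canRL (mulKf p0)); rewrite mulr1 => <-; apply: RN.
split=> //; apply: contrapT => /adjoin_pV[q Rq Dq]; apply: RpV.
have [k Rk] : exists k, R (u ^+ k / pC).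
  exists (size q); rewrite -Dq horner_coef mulr_sumr; apply: Rsum => i _.
  rewrite mulrCA; apply: RM => //; rewrite exprVn -expfB ?ltn_ord //.
  by apply: RX; apply: RD => //; apply: RM => //; apply: Rnat.
have [s Rs Ds] : exists2 s, R s & u ^+ k = 1 + pC * s.
  elim: (k) => [|n [s Rs Ds]]; first by exists 0; rewrite // mulr0 addr0.
  exists (s + r + pC * r * s); last by rewrite exprS Ds /u; ring.
  by do ?[apply: RD|apply: RM] => //; apply: Rnat.
have -> : p%:R^-1 = u ^+ k / pC - s.
  by rewrite Ds mulrDl mul1r mulrAC mulfV // mul1r addrK.
exact: RB.
Qed.

(** The classical proof that a maximal such ring is a valuation ring: 1/p is a polynomial in x and
    also one in 1/x, and the shorter expression serves to lower the degree of the longer. The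
    induction is on the sum of the sizes, and x is exchanged with 1/x when the other expression is
    longer. *)
Lemma maxring_val x : x != 0 -> R x \/ R x^-1.
Proof.
move=> x0; apply: contrapT => /not_orP[nRx nRxV].
have [f Rf Df] := adjoin_pV nRx; have [g Rg Dg] := adjoin_pV nRxV.
suff: forall N (x : algC) (f g : {poly algC}), x != 0 -> ~ R x -> (size f + size g <= N)%N ->
    (forall i, R f`_i) -> (forall i, R g`_i) ->
    f.[x] = pC^-1 -> g.[x^-1] = pC^-1 -> (size g <= size f)%N -> False.
  move=> H; case: (leqP (size g) (size f)) => [le|/ltnW le].
    by apply: (H _ _ _ _ x0 nRx (leqnn _) Rf Rg).
  by apply: (H _ _ _ _ _ nRxV (leqnn _) Rg Rf); rewrite ?invrK ?invr_eq0.
move=> {x x0 nRx nRxV f g Rf Rg Df Dg}; elim=> [|N IH] x f g x0 nRx.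
  rewrite leqn0 addn_eq0 => /andP[/eqP sf _] _ _.
  have f0 : f = 0 by apply/eqP; rewrite -size_poly_eq0 sf.
  rewrite f0 horner0 => /esym/eqP; rewrite invr_eq0 => /eqP pz.
  by move: p0; rewrite pz eqxx.
move=> leN Rf Rg Df Dg leS.
case: (leqP (size f) 1) => [/size1_polyC fC|n1].
  by apply: RpV; rewrite -/pC -Df fC hornerC.
pose n := (size f).-1; have Dn : size f = n.+1 by rewrite /n prednK // (ltn_trans _ n1).
have n0 : (0 < n)%N by rewrite -ltnS -Dn.
have [u0 RuV] := oneDp_unit (RN (Rg 0%N)).
set u := 1 + _ in u0 RuV.
(* The relation p g(1/x) = 1 reads u = sum of p g_j x^(-j) over j >= 1, with u = 1 - p g_0 a unit;
   multiplied by x^n / u it expresses x^n by lower powers of x. *)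
pose h := \poly_(i < n) (pC * (g`_(n - i) / u)).
have Rh i : R h`_i.
  by rewrite coef_poly; case: ifP => // _; do ?apply: RM => //; apply: Rnat.
have Dh : h.[x] = x ^+ n.
  have E : \sum_(j < n) pC * g`_j.+1 * x^-1 ^+ j.+1 = u.
    have : pC * g.[x^-1] = 1 by rewrite Dg mulfV.
    rewrite (@horner_coef_wide _ n.+1); last by rewrite -Dn.
    rewrite big_ord_recl expr0 mulr1 mulrDr => E.
    rewrite /u mulrN -E addrAC subrr add0r mulr_sumr.
    by apply: eq_bigr => i _; rewrite mulrA.
  rewrite /h horner_poly (reindex_inj rev_ord_inj) /=.
  transitivity (\sum_(j < n) (x ^+ n / u) * (pC * g`_j.+1 * x^-1 ^+ j.+1)).
    apply: eq_bigr => j _; rewrite subKn // exprVn expfB_cond ?ltn_ord //.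
      by ring.
    by rewrite (negbTE x0) add0n ltn_ord.
  by rewrite -mulr_sumr E mulfVK.
pose f' := take_poly n f + f`_n *: h.
have szf' : (size f' <= n)%N.
  rewrite (leq_trans (size_polyD _ _)) // geq_max size_take_poly.
  by rewrite (leq_trans (size_scale_leq _ _)) // size_poly.
have Rf' i : R f'`_i.
  rewrite coefD coefZ coef_take_poly; apply: RD; last exact: RM.
  by case: ifP.
have Df' : f'.[x] = pC^-1.
  rewrite hornerD hornerZ Dh -Df -[in RHS](poly_take_drop n f) hornerD; congr (_ + _).
  have -> : drop_poly n f = (f`_n)%:P.
    apply/polyP=> i; rewrite coef_drop_poly coefC; case: i => //= i.
    by rewrite nth_default // Dn addSn ltnS leq_addl.
  by rewrite hornerM hornerC hornerXn.
have leN' : (size f' + size g <= N)%N.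
  by rewrite -ltnS (leq_trans _ leN) // Dn ltn_add2r ltnS.
case: (leqP (size g) (size f')) => [le|/ltnW le].
  exact: (IH x f' g).
apply: (IH x^-1 g f'); rewrite ?invr_eq0 ?invrK //; last by rewrite addnC.
move=> RxV; apply: RpV; rewrite -/pC -Dg; exact: Rhorner.
Qed.

(** As [R] contains x or 1/x, this is its maximal ideal. *)
Definition nonunit (x : algC) := x = 0 \/ ~ R x^-1.

Lemma nonunitD x y : nonunit x -> nonunit y -> nonunit (x + y).
Proof.
move=> [->|nx]; first by rewrite add0r.
move=> [->|ny]; first by rewrite addr0; right.
have aux a b : ~ R b^-1 -> R (a / b) -> nonunit (a + b).
  move=> nb Rab; have [->|ab0] := eqVneq (a + b) 0; [by left|right => Rc].
  have b0 : b != 0 by apply/eqP => b0; apply: nb; rewrite b0 invr0.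
  apply: nb; have -> : b^-1 = (1 + a / b) * (a + b)^-1.
    by rewrite -[X in X + a / b](mulfV b0) -mulrDl [b + a]addrC mulrAC mulfV ?mul1r.
  by apply: RM => //; apply: RD.
have x0 : x != 0 by apply/eqP => b0; apply: nx; rewrite b0 invr0.
have y0 : y != 0 by apply/eqP => b0; apply: ny; rewrite b0 invr0.
have [] := @maxring_val (x / y); first by rewrite mulf_neq0 ?invr_eq0.
  exact: aux.
by rewrite invf_div => ?; rewrite addrC; apply: aux.
Qed.

(** For nonzero x and y: equality up to a unit of [R], that is, equality of valuations before the
    valuation exists. *)
Definition assoc (x y : algC) := R (x / y) /\ R (y / x).

Lemma assocM x y z t : assoc x y -> assoc z t -> assoc (x * z) (y * t).
Proof. by move=> [a b] [c d]; split; rewrite invfM mulrACA; apply: RM. Qed.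

Lemma assocX x y n : assoc x y -> assoc (x ^+ n) (y ^+ n).
Proof. by move=> [a b]; split; rewrite -exprVn -exprMn; apply: RX. Qed.

Lemma assocV x y : assoc x y -> assoc x^-1 y^-1.
Proof. by move=> [a b]; split; rewrite invrK mulrC. Qed.

Lemma assoc_sym x y : assoc x y -> assoc y x.
Proof. by case. Qed.

Lemma assoc_trans y x z : y != 0 -> assoc x y -> assoc y z -> assoc x z.
Proof.
move=> y0 [a b] [c d]; split.
  by rewrite -(mulfVK y0 x) -[_ * y / z]mulrA; apply: RM.
by rewrite -(mulfVK y0 z) -[_ * y / x]mulrA; apply: RM.
Qed.

Lemma assoc_refl x : x != 0 -> assoc x x.
Proof. by move=> x0; split; rewrite mulfV. Qed.

Lemma R_pexp (m : int) : R (pC ^ m) -> 0 <= m.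
Proof.
case: m => // k; rewrite NegzE -exprnN => H; case: RpV.
have -> : p%:R^-1 = pC ^+ k * pC ^- k.+1.
  by rewrite exprSr invfM mulrA mulfV ?mul1r // expf_neq0.
by apply: RM => //; apply: RX; apply: Rnat.
Qed.

Lemma assoc_pexp (m n : int) : assoc (pC ^ m) (pC ^ n) -> m = n.
Proof.
rewrite /assoc !invr_expz -!expfzDr // => -[/R_pexp H1 /R_pexp H2].
by apply/eqP; rewrite eq_le -subr_ge0 H2 -subr_ge0 H1.
Qed.

Lemma assoc_nat n : (0 < n)%N -> exists m : int, assoc n%:R (pC ^ m).
Proof.
move=> n0; have [n' cop Dn] := pfactor_coprime p_pr n0.
have n'0 : (0 < n')%N by move: n0; rewrite Dn muln_gt0 => /andP[].
exists (logn p n : int); rewrite [in n%:R]Dn natrM natrX /assoc.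
have pk0 : pC ^+ logn p n != 0 by rewrite expf_neq0.
rewrite -exprnP -/pC mulfK // invfM mulrCA mulfV // mulr1; split; first exact: Rnat.
have [a _ /dvdnP[b E]] := Bezoutl p n'0.
rewrite gcdnC (eqP cop) in E.
(* The part n' prime to p is invertible in [R], since its multiple b n' = 1 + p a is. *)
have [u0 Ru] := oneDp_unit (Rnat a).
have E' : 1 + pC * a%:R = b%:R * n'%:R by rewrite -natrM -E natrD natrM mulrC.
have -> : n'%:R^-1 = b%:R / (1 + pC * a%:R) :> algC.
  move: u0; rewrite E' mulf_eq0 negb_or => /andP[b0 _].
  by rewrite invfM mulrA mulfV ?mul1r.
by apply: RM => //; apply: Rnat.
Qed.

Lemma assocN x y : assoc x y -> assoc (- x) y.
Proof. by move=> [a b]; split; rewrite ?invrN ?mulNr ?mulrN; apply: RN. Qed.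

Lemma assoc_rat (r : rat) : r != 0 -> exists m : int, assoc (ratr r) (pC ^ m).
Proof.
move=> r0; have aux (z : int) : z != 0 -> exists m : int, assoc z%:~R (pC ^ m).
  case: z => n; first by rewrite -lt0n => /assoc_nat.
  by rewrite NegzE mulrNz => _; have [m H] := assoc_nat (ltn0Sn n); exists m; apply: assocN.
have nr0 : numq r != 0 by rewrite numq_eq0.
have [m Hm] := aux _ nr0.
have [n Hn] := aux _ (denq_neq0 r); exists (m - n).
rewrite /ratr expfzDr // -invr_expz; apply: assocM => //; exact: assocV.
Qed.

(** In the vanishing sum of the terms q_i x^i, a term of least valuation cannot be alone: otherwise
    the others, divided by it, would sum to -1 inside the maximal ideal. Two terms of equal
    valuation make a power of x associate to a rational number, hence to a power of p. *)
Lemma assoc_pow x (q : {poly rat}) : x != 0 -> q != 0 -> root (map_poly ratr q) x ->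
  exists k (m : int), (0 < k < size q)%N /\ assoc (x ^+ k) (pC ^ m).
Proof.
move=> x0 q0 rq; pose t i := ratr q`_i * x ^+ i.
have sum0 : \sum_(i < size q) t i = 0.
  move: rq => /rootP; rewrite horner_coef size_map_poly => E; rewrite -[RHS]E.
  by apply: eq_bigr => i _; rewrite coef_map.
have maxt s : has (fun i => t i != 0) s ->
    exists2 i, i \in s & t i != 0 /\ forall j, j \in s -> R (t j / t i).
  elim: s => //= a s IH; have [ta|ta] := eqVneq (t a) 0.
    move=> /IH[i si [ti Hi]]; exists i; first by rewrite inE si orbT.
    by split=> // j; rewrite inE => /orP[/eqP->|/Hi//]; rewrite ta mul0r.
  move=> _; case: (boolP (has (fun i => t i != 0) s)) => [/IH[i si [ti Hi]]|/hasPn H0].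
    have [] := @maxring_val (t a / t i); first by rewrite mulf_neq0 ?invr_eq0.
      move=> Rai; exists i; first by rewrite inE si orbT.
      by split=> // j; rewrite inE => /orP[/eqP->|/Hi].
    rewrite invf_div => Ria; exists a; first by rewrite inE eqxx.
    split=> // j; rewrite inE => /orP[/eqP->|/Hi Rj]; first by rewrite mulfV.
    by rewrite -(mulfVK ti (t j)) -[_ * t i / t a]mulrA; apply: RM.
  exists a; rewrite ?inE ?eqxx //; split=> // j.
  rewrite inE => /orP[/eqP->|/H0]; first by rewrite mulfV.
  by rewrite negbK => /eqP->; rewrite mul0r.
have /maxt[i] : has (fun i => t i != 0) (iota 0 (size q)).
  apply/hasP; exists (size q).-1; first by rewrite mem_iota /= add0n prednK // lt0n size_poly_eq0.
  by rewrite mulf_neq0 ?expf_neq0 // fmorph_eq0 -lead_coefE lead_coef_eq0.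
rewrite mem_iota add0n => /andP[_ ltin] [ti Hi].
have [j [ltj ji]] : exists j, [/\ (j < size q)%N, j != i & ~ nonunit (t j / t i)].
  apply: contrapT => nj.
  have : nonunit (\sum_(j < size q | j != Ordinal ltin) t j / t i).
    apply: (big_rec nonunit); first by left.
    move=> j y ji; apply: nonunitD; apply: contrapT => Hj; apply: nj.
    by exists j; split.
  have := sum0; rewrite (bigD1 (Ordinal ltin)) //= => /(congr1 (fun z => z / t i)).
  rewrite mulrDl mulfV // mul0r mulr_suml => /eqP; rewrite addrC addr_eq0 => /eqP->.
  by case=> [/eqP|]; [rewrite oppr_eq0 oner_eq0|rewrite invrN invr1; apply; apply: RN].
move=> /not_orP[/eqP tji /contrapT]; rewrite invf_div => Rij.
have Rji : R (t j / t i) by apply: Hi; rewrite mem_iota.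
have tj : t j != 0 by apply: contraNneq tji => ->; rewrite mul0r.
have aux a b : (a < b)%N -> t a != 0 -> t b != 0 -> assoc (t b) (t a) ->
    exists m : int, assoc (x ^+ (b - a)) (pC ^ m).
  move=> ab ta tb H.
  have qa : q`_a != 0 by apply: contraNneq ta => qa; rewrite /t qa rmorph0 mul0r.
  have qb : q`_b != 0 by apply: contraNneq tb => qb; rewrite /t qb rmorph0 mul0r.
  have [m Hm] := @assoc_rat (q`_a / q`_b) (mulf_neq0 qa (invr_neq0 qb)).
  exists m; have -> : x ^+ (b - a) = t b / t a * ratr (q`_a / q`_b).
    have ra : ratr q`_a != 0 :> algC by rewrite fmorph_eq0.
    have rb : ratr q`_b != 0 :> algC by rewrite fmorph_eq0.
    rewrite expfB // /t fmorph_div /=; field.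
    by rewrite ra rb expf_neq0.
  rewrite -[pC ^ m]mul1r; apply: assocM => //; rewrite -(mulfV ta).
  by apply: assocM => //; apply: assoc_refl; rewrite invr_eq0.
case: (ltngtP i j) ji => // [lt|lt] _.
  have [m Hm] := aux _ _ lt ti tj (conj Rji Rij); exists (j - i)%N, m; split=> //.
  by rewrite subn_gt0 lt (leq_ltn_trans _ ltj) ?leq_subr.
have [m Hm] := aux _ _ lt tj ti (conj Rij Rji); exists (i - j)%N, m; split=> //.
by rewrite subn_gt0 lt (leq_ltn_trans _ ltin) ?leq_subr.
Qed.

(** By [assoc_pow] a power of x is a power of p up to a unit, so the valuation normalized by ord p =
    1 is rational. *)
Definition ordR_spec (x : algC) (r : rat) :=
  exists k (m : int), [/\ (0 < k)%N, assoc (x ^+ k) (pC ^ m) & r = m%:~R / k%:R].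

Definition ordR (x : algC) : rat := if x == 0 then 0 else xget 0 (ordR_spec x).

Lemma ordRP x : x != 0 -> ordR_spec x (ordR x).
Proof.
move=> x0; rewrite /ordR (negbTE x0); apply: xgetPex.
have [q [_ mq] qP] := minCpolyP x.
have [|k [m [/andP[k0 _] H]]] := assoc_pow x0 (monic_neq0 mq); first by rewrite qP.
by exists (m%:~R / k%:R), k, m.
Qed.

Lemma ordR_unique x k (m : int) : x != 0 -> (0 < k)%N -> assoc (x ^+ k) (pC ^ m) ->
  ordR x = m%:~R / k%:R.
Proof.
move=> x0 k0 H; have [k' [m' [k'0 H' ->]]] := ordRP x0.
apply/eqP; rewrite eqr_div ?pnatr_eq0 -?lt0n //.
rewrite -[k%:R]/((k : int)%:~R) -[k'%:R]/((k' : int)%:~R) -!intrM eqr_int; apply/eqP.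
apply: assoc_pexp; rewrite -!exprz_exp -!exprnP.
apply: (@assoc_trans (x ^+ (k * k'))); first exact: expf_neq0.
  by rewrite mulnC exprM; apply: assoc_sym; apply: assocX.
by rewrite exprM; apply: assocX.
Qed.

(** The denominator of the valuation is bounded by the degree of x; discreteness of the valuation on
    a number field rests on this. *)
Lemma ordR_bounded x (q : {poly rat}) : x != 0 -> q != 0 -> root (map_poly ratr q) x ->
  exists k (m : int), (0 < k < size q)%N /\ k%:R * ordR x = m%:~R.
Proof.
move=> x0 q0 /(assoc_pow x0 q0)[k [m [/andP[k0 kq] H]]]; exists k, m.
rewrite k0 kq (ordR_unique x0 k0 H) mulrCA mulfV ?mulr1 //.
by rewrite pnatr_eq0 -lt0n.
Qed.

Lemma ordRM x y : x != 0 -> y != 0 -> ordR (x * y) = ordR x + ordR y.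
Proof.
move=> x0 y0; have [k [m [k0 H ->]]] := ordRP x0; have [k' [m' [k'0 H' ->]]] := ordRP y0.
rewrite (@ordR_unique _ (k * k') (m * k' + m' * k)).
- have nz n : (0 < n)%N -> n%:R != 0 :> rat by rewrite pnatr_eq0 -lt0n.
  by rewrite natrM intrD !intrM; field; rewrite !nz.
- by rewrite mulf_neq0.
- by rewrite muln_gt0 k0.
rewrite exprMn expfzDr // -!exprz_exp -!exprnP; apply: assocM.
  by rewrite exprM; apply: assocX.
by rewrite mulnC exprM; apply: assocX.
Qed.

Lemma ordRp : ordR pC = 1.
Proof.
rewrite (@ordR_unique _ 1 1) ?divr1 // expr1; apply: assoc_refl.
exact: p0.
Qed.

Lemma ordR_ge0 x : x != 0 -> (0 <= ordR x) <-> R x.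
Proof.
move=> x0; have [k [m [k0 [H1 H2] ->]]] := ordRP x0.
have -> : (0 <= m%:~R / k%:R :> rat) = (0 <= m).
  by rewrite pmulr_lge0 ?invr_gt0 ?ltr0n // ler0z.
split=> [m0|Rx]; last first.
  apply: R_pexp; rewrite -(mulfVK (expf_neq0 k x0) (pC ^ m)).
  by apply: RM => //; apply: RX.
have [//|RxV] := maxring_val x0.
(* With 1/x in [R], it remains to see that x^k is in [R]: [R] is integrally closed. *)
have -> : x = x ^+ k * x^-1 ^+ k.-1.
  by rewrite -(prednK k0) exprVn exprS -mulrA mulfV ?mulr1 // expf_neq0.
apply: RM; last exact: RX.
have pm0 : pC ^ m != 0 by apply: expfz_neq0.
rewrite -(mulfVK pm0 (x ^+ k)); apply: RM => //.
by case: (m) m0 => // n _; apply: RX; apply: Rnat.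
Qed.

Lemma ordRD x y : x != 0 -> y != 0 -> x + y != 0 ->
  Num.min (ordR x) (ordR y) <= ordR (x + y).
Proof.
have aux a b : a != 0 -> b != 0 -> a + b != 0 -> ordR a <= ordR b ->
    ordR a <= ordR (a + b).
  move=> a0 b0 ab0 le; have c0 : 1 + b / a != 0.
    apply: contraNneq ab0 => e; have -> : a + b = a * (1 + b / a) by field.
    by rewrite e mulr0.
  have -> : a + b = a * (1 + b / a) by field.
  rewrite ordRM // lerDl; apply/ordR_ge0 => //; apply: RD => //.
  have d0 : b / a != 0 by rewrite mulf_neq0 ?invr_eq0.
  apply/ordR_ge0 => //; rewrite -(lerD2l (ordR a)) addr0 -ordRM //.
  by rewrite mulrC mulfVK.
move=> x0 y0 xy0; case: (leP (ordR x) (ordR y)) => [|/ltW] le; first exact: aux.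
by rewrite addrC; apply: aux; rewrite // addrC.
Qed.
End MaximalSubring.

Lemma ord_exists p : prime p -> exists ord : algC -> rat,
  [/\ ord 0 = 0,
      forall x y, x != 0 -> y != 0 -> ord (x * y) = ord x + ord y,
      forall x y, x != 0 -> y != 0 -> x + y != 0 ->
        Num.min (ord x) (ord y) <= ord (x + y),
      ord p%:R = 1 &
      forall x (q : {poly rat}), x != 0 -> q != 0 -> root (map_poly ratr q) x ->
        exists k (m : int), (0 < k < size q)%N /\ k%:R * ord x = m%:~R].
Proof.
move=> p_pr.
(* Only nonempty sets are asked to contain 1, because the union of the empty chain is empty. *)
pose P (A : set algC) := [/\ forall x, A x -> A 1,
  forall x y, A x -> A y -> A (x - y), forall x y, A x -> A y -> A (x * y)
  & ~ A p%:R^-1].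
have [|R [[R1' RB RM RpV] Rmax]] := @Zorn_bigcup algC P.
  move=> F FP tF; split.
  - by move=> x [X FX Xx]; exists X => //; have [H _ _ _] := FP _ FX; apply: H Xx.
  - move=> x y [X FX Xx] [Y FY Yy]; have [XY|YX] := tF _ _ FX FY.
      by exists Y => //; have [_ H _ _] := FP _ FY; apply: H => //; apply: XY.
    by exists X => //; have [_ H _ _] := FP _ FX; apply: H => //; apply: YX.
  - move=> x y [X FX Xx] [Y FY Yy]; have [XY|YX] := tF _ _ FX FY.
      by exists Y => //; have [_ _ H _] := FP _ FY; apply: H => //; apply: XY.
    by exists X => //; have [_ _ H _] := FP _ FX; apply: H => //; apply: YX.
  - by move=> [X FX XpV]; have [_ _ _] := FP _ FX; apply.
(* Without 1 the maximal set would be empty, hence strictly contained in the ring of integers, which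
   satisfies [P]. *)
have R1 : R 1.
  apply: contrapT => nR1; pose Z : set algC := fun x => x \in Num.int.
  have nR x : ~ R x by move=> /R1'.
  apply: (Rmax Z).
    by split=> [x /nR//|H]; apply: (nR 1); apply: H; rewrite /Z rpred1.
  split; rewrite /Z.
  - by move=> *; rewrite rpred1.
  - by move=> *; rewrite rpredB.
  - by move=> *; rewrite rpredM.
  move=> Zp; have p0 : (0 < p%:R :> algC) by rewrite ltr0n prime_gt0.
  have := norm_intr_ge1 Zp; rewrite invr_eq0 gt_eqF // => /(_ isT).
  rewrite ger0_norm; last by rewrite invr_ge0 ltW.
  rewrite invf_ge1 // lern1 => H.
  by have := leq_ltn_trans H (prime_gt1 p_pr); rewrite ltnn.
have RmaxB (B : set algC) : (R `<=` B)%classic -> B 1 ->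
    (forall x y, B x -> B y -> B (x - y)) ->
    (forall x y, B x -> B y -> B (x * y)) -> ~ B p%:R^-1 -> (B `<=` R)%classic.
  move=> RBs B1 BB BM BpV; apply: contrapT => nB.
  by apply: (Rmax B); split.
exists (ordR p R); split.
- by rewrite /ordR eqxx.
- by move=> x y; apply: ordRM.
- by move=> x y; apply: ordRD.
- exact: ordRp.
- by move=> x q; apply: ordR_bounded.
Qed.

(** * The chosen valuations, and integrality read off from them *)

Definition ordp (p : nat) : algC -> rat :=
  if pselect (prime p) is left pr then projT1 (cid (ord_exists pr)) else fun=> 0.

Lemma ordpP p : prime p -> [/\ ordp p 0 = 0,
      forall x y, x != 0 -> y != 0 -> ordp p (x * y) = ordp p x + ordp p y,
      forall x y, x != 0 -> y != 0 -> x + y != 0 ->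
        Num.min (ordp p x) (ordp p y) <= ordp p (x + y),
      ordp p p%:R = 1 &
      forall x (q : {poly rat}), x != 0 -> q != 0 -> root (map_poly ratr q) x ->
        exists k (m : int), (0 < k < size q)%N /\ k%:R * ordp p x = m%:~R].
Proof. by rewrite /ordp; case: pselect => // pr _; case: cid. Qed.

Lemma ordp_nprime p : ~~ prime p -> ordp p = fun=> 0.
Proof. by rewrite /ordp; case: pselect => // pr; rewrite pr. Qed.

Lemma ordp0 p : ordp p 0 = 0.
Proof. by case: (boolP (prime p)) => [/ordpP[]//|/ordp_nprime ->]. Qed.

Lemma ordpM p x y : x != 0 -> y != 0 -> ordp p (x * y) = ordp p x + ordp p y.
Proof.
case: (boolP (prime p)) => [/ordpP[_ H _ _ _]|np _ _]; first exact: H.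
by rewrite ordp_nprime // addr0.
Qed.

Lemma ordp1 p : ordp p 1 = 0.
Proof.
by apply: (addrI (ordp p 1)); rewrite addr0 -ordpM ?oner_eq0 // mulr1.
Qed.

Lemma ordpV p x : ordp p x^-1 = - ordp p x.
Proof.
have [->|x0] := eqVneq x 0; first by rewrite invr0 ordp0 oppr0.
by apply: (addrI (ordp p x)); rewrite -ordpM ?invr_eq0 // mulfV // ordp1 subrr.
Qed.

Lemma ordpX p x n : ordp p (x ^+ n) = n%:R * ordp p x.
Proof.
have [->|x0] := eqVneq x 0.
  by rewrite ordp0 mulr0 expr0n; case: (n) => [|?]; rewrite ?ordp1 ?ordp0.
elim: n => [|n IH]; first by rewrite mul0r ordp1.
by rewrite exprS ordpM ?expf_neq0 // IH -[n.+1]add1n natrD mulrDl mul1r.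
Qed.

Lemma ordpN p x : ordp p (- x) = ordp p x.
Proof.
have [->|x0] := eqVneq x 0; first by rewrite oppr0.
rewrite -mulN1r ordpM ?oppr_eq0 ?oner_eq0 //; suff -> : ordp p (- 1) = 0 by rewrite add0r.
have := ordpX p (-1) 2; rewrite sqrrN expr1n ordp1 => /esym/eqP.
by rewrite mulf_eq0 pnatr_eq0 => /eqP.
Qed.

Lemma ordp_prod p (I : Type) (r : seq I) (P : pred I) (F : I -> algC) :
  (forall i, P i -> F i != 0) ->
  ordp p (\prod_(i <- r | P i) F i) = \sum_(i <- r | P i) ordp p (F i).
Proof.
move=> F0; suff: \prod_(i <- r | P i) F i != 0 /\
    ordp p (\prod_(i <- r | P i) F i) = \sum_(i <- r | P i) ordp p (F i) by case.
apply: (big_rec2 (fun x s => x != 0 /\ ordp p x = s)); first by rewrite oner_eq0 ordp1.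
by move=> i x s /F0 Fi [x0 <-]; rewrite mulf_neq0 // ordpM.
Qed.

(* [x] has valuation at least [r], the valuation of [0] being infinite. *)
Definition ord_ge (p : nat) (r : rat) (x : algC) := (x == 0) || (r <= ordp p x).

Lemma ord_ge0 p r : ord_ge p r 0. Proof. by rewrite /ord_ge eqxx. Qed.
#[local] Hint Resolve ord_ge0 : core.

Lemma ord_ge1 p : ord_ge p 0 1. Proof. by rewrite /ord_ge ordp1 lexx orbT. Qed.

Lemma ord_ge_ord p x : ord_ge p (ordp p x) x.
Proof. by rewrite /ord_ge lexx orbT. Qed.

Lemma ord_geE p r x : x != 0 -> ord_ge p r x = (r <= ordp p x).
Proof. by move=> x0; rewrite /ord_ge (negbTE x0). Qed.

Lemma ord_geW p r s x : s <= r -> ord_ge p r x -> ord_ge p s x.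
Proof. by move=> sr /orP[/eqP->//|/(le_trans sr) H]; rewrite /ord_ge H orbT. Qed.

Lemma ord_geN p r x : ord_ge p r (- x) = ord_ge p r x.
Proof. by rewrite /ord_ge oppr_eq0 ordpN. Qed.

Lemma ord_geM p r s x y : ord_ge p r x -> ord_ge p s y -> ord_ge p (r + s) (x * y).
Proof.
rewrite /ord_ge; have [->|x0 /= rx] := eqVneq x 0; first by rewrite mul0r eqxx.
have [->|y0 /= ry] := eqVneq y 0; first by rewrite mulr0 eqxx.
by rewrite ordpM // lerD // orbT.
Qed.

Section Valuation.
Variable p : nat.
Hypothesis p_pr : prime p.

Lemma ordp_p : ordp p p%:R = 1. Proof. by case: (ordpP p_pr). Qed.

Lemma ord_geD r x y : ord_ge p r x -> ord_ge p r y -> ord_ge p r (x + y).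
Proof.
have [->|x0] := eqVneq x 0; first by rewrite add0r.
have [->|y0] := eqVneq y 0; first by rewrite addr0.
have [->//|xy0] := eqVneq (x + y) 0.
rewrite !ord_geE // => rx ry; have [_ _ H _ _] := ordpP p_pr.
by rewrite (le_trans _ (H _ _ x0 y0 xy0)) // le_min rx.
Qed.

Lemma ord_geB r x y : ord_ge p r x -> ord_ge p r y -> ord_ge p r (x - y).
Proof. by move=> rx ry; apply: ord_geD; rewrite ?ord_geN. Qed.

Lemma ord_ge_sum r (I : Type) (s : seq I) (P : pred I) (F : I -> algC) :
  (forall i, P i -> ord_ge p r (F i)) -> ord_ge p r (\sum_(i <- s | P i) F i).
Proof. by move=> H; elim/big_rec: _ => // i x /H Fi Rx; apply: ord_geD. Qed.

Lemma ord_ge_nat n : ord_ge p 0 n%:R.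
Proof. by elim: n => // n IH; rewrite -addn1 natrD; apply: ord_geD => //; apply: ord_ge1. Qed.

Lemma ordp_coprime n : coprime p n -> ordp p n%:R = 0.
Proof.
move=> cop; have n0 : (0 < n)%N.
  by case: n cop => // /eqP; rewrite gcdn0 => p1; move: p_pr; rewrite p1.
have nC0 : n%:R != 0 :> algC by rewrite pnatr_eq0 -lt0n.
have := ord_ge_nat n; rewrite ord_geE // le_eqVlt => /orP[/eqP//|lt].
have [a _ /dvdnP[b E]] := Bezoutl p n0; rewrite gcdnC (eqP cop) in E.
have E' : 1 = b%:R * n%:R - a%:R * p%:R :> algC.
  by rewrite -!natrM -E natrD addrK.
pose e := Num.min 1 (ordp p n%:R).
have e0 : 0 < e by rewrite lt_min ltr01.
have : ord_ge p (0 + e) 1.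
  rewrite E'; apply: ord_geB.
    by apply: ord_geM (ord_ge_nat b) _; rewrite ord_geE // ge_min lexx orbT.
  apply: ord_geM (ord_ge_nat a) _.
  by rewrite ord_geE ?ordp_p ?ge_min ?lexx // pnatr_eq0 -lt0n prime_gt0.
by rewrite ord_geE ?oner_eq0 // ordp1 add0r leNgt e0.
Qed.

Lemma ordp_nat n : (0 < n)%N -> ordp p n%:R = (logn p n)%:R.
Proof.
move=> n0; have [n' cop Dn] := pfactor_coprime p_pr n0.
have p0 : p%:R != 0 :> algC by rewrite pnatr_eq0 -lt0n prime_gt0.
have n'0 : n'%:R != 0 :> algC.
  by rewrite pnatr_eq0 -lt0n; move: n0; rewrite Dn muln_gt0 => /andP[].
rewrite {1}Dn natrM natrX ordpM ?expf_neq0 // ordpX ordp_p mulr1.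
by rewrite ordp_coprime // add0r.
Qed.

Lemma ordp_int (z : int) : z != 0 -> ordp p z%:~R = (logn p `|z|)%:R.
Proof.
case: z => n; first by rewrite -lt0n => /ordp_nat.
by move=> _; rewrite NegzE mulrNz ordpN -ordp_nat.
Qed.

Lemma ordp_rat (r : rat) : r != 0 ->
  ordp p (ratr r) = (logn p `|numq r|)%:R - (logn p `|denq r|)%:R.
Proof.
move=> r0; have nr0 : numq r != 0 by rewrite numq_eq0.
rewrite /ratr ordpM ?invr_eq0 ?intr_eq0 ?denq_neq0 // ordpV.
by rewrite !ordp_int ?denq_neq0.
Qed.

Lemma ord_ge_rat (r : rat) : coprime p `|denq r| -> ord_ge p 0 (ratr r).
Proof.
have [->|r0] := eqVneq r 0; first by rewrite rmorph0.
rewrite ord_geE ?fmorph_eq0 // ordp_rat // => cop.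
rewrite [logn p `|denq r|]logn_coprime // subr0 ler0n //.
Qed.

Lemma coprime_denq_ord_ge (r : rat) : ord_ge p 0 (ratr r) -> coprime p `|denq r|.
Proof.
have [->|r0] := eqVneq r 0; first by rewrite coprimen1.
rewrite ord_geE ?fmorph_eq0 // ordp_rat // subr_ge0 ler_nat => le.
rewrite prime_coprime //; apply/negP => dv.
have dn0 : (0 < `|denq r|)%N by rewrite absz_gt0 denq_neq0.
have nn0 : (0 < `|numq r|)%N by rewrite absz_gt0 numq_eq0.
have : (0 < logn p `|denq r|)%N by rewrite logn_gt0 mem_primes p_pr dn0.
move/leq_trans/(_ le); rewrite logn_gt0 mem_primes p_pr nn0 /= => dv2.
have := coprime_num_den r; rewrite /coprime => /eqP g1.
have : (p %| gcdn `|numq r| `|denq r|)%N by rewrite dvdn_gcd dv2 dv.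
by rewrite g1 dvdn1 => /eqP p1; move: p_pr; rewrite p1.
Qed.

Lemma ord_gt0_numq (r : rat) : r != 0 -> 0 < ordp p (ratr r) ->
  (p %| `|numq r|)%N /\ coprime p `|denq r|.
Proof.
move=> r0 lt; have cop : coprime p `|denq r|.
  by apply: coprime_denq_ord_ge; rewrite ord_geE ?fmorph_eq0 // ltW.
split=> //; move: lt; rewrite ordp_rat // [logn p `|denq r|]logn_coprime //.
by rewrite subr0 ltr0n logn_gt0 mem_primes => /and3P[].
Qed.

Lemma ord_ge_coef_prod e (s : seq algC) : 0 <= e -> (forall z, z \in s -> ord_ge p e z) ->
  forall i, (i < size s)%N -> ord_ge p e (\prod_(z <- s) ('X - z%:P))`_i.
Proof.
move=> e0; elim: s => // z s IH H i; rewrite big_cons mulrBl coefB coefXM coefCM => lti.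
have Hs : forall y, y \in s -> ord_ge p e y by move=> y ys; apply: H; rewrite inE ys orbT.
have Hz : ord_ge p e z by apply: H; rewrite inE eqxx.
set Q := \prod_(j <- s) _; apply: ord_geB.
  by case: i lti => // i; rewrite ltnS => lti; apply: IH.
have [lt|ge] := ltnP i (size s).
  by apply: (@ord_geW _ (e + e)); rewrite ?lerDl //; apply: ord_geM => //; apply: IH.
have -> : i = size s by apply/eqP; rewrite eqn_leq ge andbT -ltnS.
have -> : Q`_(size s) = 1.
  have /monicP := monic_prod_XsubC s predT idfun; rewrite lead_coefE.
  by rewrite size_prod_XsubC.
by rewrite mulr1.
Qed.

(** If x had negative valuation, the leading power would have strictly smaller valuation than every
    other term of the equation. *)
Lemma monic_root_ord_ge (P : {poly algC}) x : P \is monic ->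
  (forall i, ord_ge p 0 P`_i) -> root P x -> ord_ge p 0 x.
Proof.
move=> mP HP /rootP rP; apply: contraT => nx.
have x0 : x != 0 by apply: contraNneq nx => ->.
have lt : ordp p x < 0 by move: nx; rewrite ord_geE // -ltNge.
pose d := (size P).-1; have Dd : size P = d.+1.
  by rewrite /d prednK // lt0n size_poly_eq0 monic_neq0.
move: rP; rewrite horner_coef Dd big_ord_recr /=.
have -> : P`_d = 1 by rewrite -(monicP mP) lead_coefE Dd.
rewrite mul1r => /eqP; rewrite addrC addr_eq0 => /eqP E.
have : ord_ge p (d%:R * ordp p x - ordp p x) (x ^+ d).
  rewrite E ord_geN; apply: ord_ge_sum => i _.
  apply: (@ord_geW _ (0 + i%:R * ordp p x)); last first.
    by apply: ord_geM => //; rewrite -ordpX ord_ge_ord.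
  rewrite add0r -[X in _ - X]mul1r -mulrBl ler_wnM2r ?(ltW lt) //.
  have d0 : (0 < d)%N by apply: leq_trans (ltn_ord i).
  rewrite -(natrB _ d0) ler_nat subn1 -ltnS prednK //.
by rewrite ord_geE ?expf_neq0 // ordpX gerDl oppr_le0 leNgt lt.
Qed.

Lemma Aint_ord_ge x : x \in Aint -> ord_ge p 0 x.
Proof.
move=> Ax; apply: (monic_root_ord_ge (minCpoly_monic x) _ (root_minCpoly x)) => i.
have /polyOverP/(_ i)/intrP[z ->] : minCpoly x \is a polyOver Num.int by [].
have [->|z0] := eqVneq z 0; first by [].
by rewrite ord_geE ?intr_eq0 // ordp_int // ler0n.
Qed.
End Valuation.

Lemma ordp_Aunit p u (s : Gal) : Aunit u -> ordp p (s u) = 0.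
Proof.
move=> [Au [AuV u0]]; case: (boolP (prime p)) => [p_pr|np]; last first.
  by rewrite ordp_nprime.
apply/eqP; rewrite eq_le -oppr_ge0 -ordpV -fmorphV -!(@ord_geE p 0) ?fmorph_eq0 ?invr_eq0 //.
by rewrite !Aint_ord_ge // Aint_aut.
Qed.

(** The coefficients of the minimal polynomial are rational and, as polynomials in the conjugates,
    integral at every prime. *)
Lemma Aint_of_ord x : (forall p (s : Gal), prime p -> ord_ge p 0 (s x)) -> x \in Aint.
Proof.
move=> H; have [q [Dq mq] _] := minCpolyP x.
rewrite unfold_in; apply/polyOverP => i.
have Hi p : prime p -> ord_ge p 0 (minCpoly x)`_i.
  move=> p_pr; have [lt|ge] := ltnP i (size (conjs x)).
    rewrite minCpoly_conjs; apply: ord_ge_coef_prod => // z /gal_conjs[s <-].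
    exact: H.
  have [<-|ne] := eqVneq (size (conjs x)) i.
    have : lead_coef (minCpoly x) = 1 by apply/monicP/minCpoly_monic.
    by rewrite lead_coefE minCpoly_conjs size_prod_XsubC /= => ->; apply: ord_ge1.
  rewrite nth_default // minCpoly_conjs size_prod_XsubC ltn_neqAle ne //.
move: Hi; rewrite Dq coef_map /= => Hi.
suff d1 : denq q`_i = 1.
  by rewrite /ratr d1 invr1 mulr1 rpred_int.
have : (`|denq q`_i| = 1)%N.
  apply/eqP; rewrite -[_ == _]negbK; apply/negP => ne.
  have dn0 : (0 < `|denq q`_i|)%N by rewrite absz_gt0 denq_neq0.
  have p_pr : prime (pdiv `|denq q`_i|).
    by rewrite pdiv_prime // ltn_neqAle eq_sym ne.
  have := coprime_denq_ord_ge p_pr (Hi _ p_pr).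
  by rewrite prime_coprime // pdiv_dvd.
by move=> E; rewrite -(gez0_abs (denq_ge0 _)) E.
Qed.

Lemma Aunit_of_ord x : x != 0 ->
  (forall p (s : Gal), prime p -> ordp p (s x) = 0) -> Aunit x.
Proof.
move=> x0 H; split; last split=> //; apply: Aint_of_ord => p s p_pr.
  by rewrite ord_geE ?fmorph_eq0 // H.
by rewrite ord_geE ?fmorph_eq0 ?invr_eq0 // fmorphV ordpV H // oppr0.
Qed.

(** A prime exceeding all denominators in the minimal polynomials of x and of 1/x divides none of
    them, so both are integral at every conjugate. *)
Lemma ord_support x : exists N, forall p (s : Gal), prime p -> (N < p)%N ->
  ordp p (s x) = 0.
Proof.
have aux y : exists N, forall p (s : Gal), prime p -> (N < p)%N -> ord_ge p 0 (s y).
  have [q [Dq mq] _] := minCpolyP y.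
  exists (\max_(i < size q) `|denq q`_i|%N) => p s p_pr ltp.
  apply: (monic_root_ord_ge p_pr (minCpoly_monic (s y)) _ (root_minCpoly _)) => i.
  rewrite minCpoly_aut Dq coef_map /=; have [lti|ge] := ltnP i (size q); last first.
    by rewrite (nth_default _ ge) rmorph0.
  apply: ord_ge_rat => //; rewrite prime_coprime //; apply/negP => dv.
  have := dvdn_leq _ dv; rewrite absz_gt0 denq_neq0 => /(_ isT) le.
  have := leq_trans ltp le; rewrite ltnNge => /negP; apply.
  exact: (leq_bigmax (Ordinal lti)).
have [->|x0] := eqVneq x 0; first by exists 0%N => p s _ _; rewrite rmorph0 ordp0.
have [N HN] := aux x; have [M HM] := aux x^-1.
exists (maxn N M) => p s p_pr; rewrite gtn_max => /andP[lN lM].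
have := HM p s p_pr lM; have := HN p s p_pr lN.
rewrite fmorphV !ord_geE ?invr_eq0 ?fmorph_eq0 // ordpV oppr_ge0 => a b.
by apply/eqP; rewrite eq_le a b.
Qed.

Lemma flevel_ordp p x : flevel (fun s : Gal => ordp p (s x)).
Proof. exact: flevel_app (flevel_eval x). Qed.

(** * Places of number fields *)

(** The real number p^(-r). *)
Definition pexp (p : nat) (r : rat) : RR :=
  Rtrigo_def.exp (- (ratr r * rlog p%:R)).

Lemma pexpD p r s : pexp p (r + s) = pexp p r * pexp p s.
Proof. by rewrite /pexp expRD rmorphD mulrDl opprD. Qed.

Lemma pexp0 p : pexp p 0 = 1.
Proof. by rewrite /pexp rmorph0 mul0r oppr0 expR0. Qed.

Lemma pexp_gt0 p r : 0 < pexp p r.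
Proof. by apply/RltP; exact: Exp_prop.exp_pos. Qed.

Lemma pexpN p r : pexp p (- r) = (pexp p r)^-1.
Proof.
have e0 : pexp p r != 0 by rewrite gt_eqF ?pexp_gt0.
by apply: (mulfI e0); rewrite -pexpD subrr pexp0 mulfV.
Qed.

Lemma pexp_nat p r n : pexp p (n%:R * r) = pexp p r ^+ n.
Proof.
elim: n => [|n IH]; first by rewrite mul0r pexp0.
by rewrite -[n.+1]add1n natrD mulrDl mul1r pexpD IH -exprS.
Qed.

Lemma log_pexp p r : rlog (pexp p r) = - (ratr r * rlog p%:R).
Proof. by rewrite /rlog /pexp Rpower.ln_exp. Qed.

Lemma rlog1 : rlog 1 = 0. Proof. exact: Rpower.ln_1. Qed.

Lemma rlog_lt (x y : RR) : 0 < x -> x < y -> rlog x < rlog y.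
Proof. by move=> /RltP x0 /RltP xy; apply/RltP; apply: Rpower.ln_increasing. Qed.

Lemma rlog_prime_ge p : prime p -> rlog 2 <= rlog p%:R.
Proof.
move=> /prime_gt1; rewrite leq_eqVlt => /orP[/eqP<-//|lt].
by apply/ltW/rlog_lt; rewrite ?ltr0n // ltr_nat.
Qed.

Lemma rlog2_gt0 : 0 < rlog 2.
Proof. by rewrite -rlog1; apply: rlog_lt => //; rewrite ltr1n. Qed.

Lemma rlog_prime_gt0 p : prime p -> 0 < rlog p%:R.
Proof. by move/rlog_prime_ge; apply: lt_le_trans rlog2_gt0. Qed.

Lemma pexp1 p : prime p -> pexp p 1 = p%:R^-1.
Proof.
move=> p_pr; rewrite /pexp rmorph1 mul1r; apply: (mulrI (x := p%:R)).
  by rewrite unitfE pnatr_eq0 -lt0n prime_gt0.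
rewrite mulfV ?pnatr_eq0 -?lt0n ?prime_gt0 //.
have E : p%:R = Rtrigo_def.exp (rlog p%:R) :> RR.
  by rewrite /rlog Rpower.exp_ln //; apply/RltP; rewrite ltr0n prime_gt0.
by rewrite {1}E expRD RplusE subrr expR0.
Qed.

Lemma pexp_lt p r s : prime p -> (pexp p r < pexp p s) = (s < r).
Proof.
move=> p_pr; have aux a b : a < b -> pexp p b < pexp p a.
  move=> ab; apply/RltP; apply: Rpower.exp_increasing; apply/RltP.
  by rewrite ltrN2 ltr_pM2r ?rlog_prime_gt0 // ltr_rat.
case: (ltgtP s r) => [/aux//|/aux/ltW|->]; last by rewrite ltxx.
by move=> le; apply/negbTE; rewrite -leNgt.
Qed.

Lemma pexp_le p r s : prime p -> (pexp p r <= pexp p s) = (s <= r).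
Proof. by move=> p_pr; rewrite leNgt pexp_lt // -leNgt. Qed.

Lemma pexp_inj p : prime p -> injective (pexp p).
Proof.
by move=> p_pr r s E; apply/eqP; rewrite eq_le -!(pexp_le _ _ p_pr) E lexx.
Qed.

Definition wabs (p : nat) (x : algC) : RR := if x == 0 then 0 else pexp p (ordp p x).

Lemma wabsE p x : x != 0 -> wabs p x = pexp p (ordp p x).
Proof. by rewrite /wabs => /negbTE->. Qed.

Lemma wabs0 p : wabs p 0 = 0. Proof. by rewrite /wabs eqxx. Qed.

Lemma wabs_le p r x : prime p -> (wabs p x <= pexp p r) = ord_ge p r x.
Proof.
move=> p_pr; rewrite /wabs /ord_ge; case: eqP => //=; first by rewrite ltW ?pexp_gt0.
by rewrite pexp_le.
Qed.

Definition place (p : nat) (s : Gal) (K : pred algC) : algC -> RR :=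
  fun x => if K x then wabs p (s x) else 0.

Lemma placeE p s (K : pred algC) x : K x -> place p s K x = wabs p (s x).
Proof. by rewrite /place => ->. Qed.

Section Subfield.
Variable K : pred algC.
Hypothesis sfK : is_subfield K.

Lemma sub1K : K 1. Proof. by case: sfK. Qed.
Lemma subBK x y : K x -> K y -> K (x - y). Proof. by case: sfK => _ H _ _; apply: H. Qed.
Lemma subMK x y : K x -> K y -> K (x * y). Proof. by case: sfK => _ _ H _; apply: H. Qed.
Lemma subVK x : K x -> K x^-1. Proof. by case: sfK => _ _ _; apply. Qed.
Lemma sub0K : K 0. Proof. by rewrite -(subrr 1); apply: subBK; apply: sub1K. Qed.
Lemma subNK x : K x -> K (- x).
Proof. by move=> Kx; rewrite -sub0r; apply: subBK => //; apply: sub0K. Qed.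
Lemma subDK x y : K x -> K y -> K (x + y).
Proof. by move=> Kx Ky; rewrite -[y]opprK; apply: subBK => //; apply: subNK. Qed.
Lemma subXK x n : K x -> K (x ^+ n).
Proof. by move=> Kx; elim: n => [|n IH]; rewrite ?sub1K // exprS; apply: subMK. Qed.
Lemma subnatK n : K n%:R.
Proof. by elim: n => [|n IH]; rewrite ?sub0K // -addn1 natrD; apply: subDK => //; apply: sub1K. Qed.
Lemma subintK (z : int) : K z%:~R.
Proof. by case: z => n; [apply: subnatK|rewrite NegzE mulrNz; apply: subNK; apply: subnatK]. Qed.
Lemma subratK (r : rat) : K (ratr r).
Proof. by rewrite /ratr; apply: subMK; [|apply: subVK]; apply: subintK. Qed.
Lemma subsumK (I : Type) (r : seq I) (P : pred I) (F : I -> algC) :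
  (forall i, P i -> K (F i)) -> K (\sum_(i <- r | P i) F i).
Proof. by move=> H; elim/big_rec: _ => [|i x /H Fi Rx]; rewrite ?sub0K //; apply: subDK. Qed.

Lemma place_is_place p s : prime p -> is_place_over K p (place p s K).
Proof.
move=> p_pr; split=> //.
- by move=> x; rewrite /place => /negbTE->.
- by move=> x; rewrite /place /wabs; case: ifP => // _; case: eqP => // _; rewrite ltW ?pexp_gt0.
- move=> x Kx; rewrite placeE //; split=> [|->]; last by rewrite rmorph0 wabs0.
  rewrite /wabs; case: eqP => [/eqP|_ e]; first by rewrite fmorph_eq0 => /eqP.
  by have := pexp_gt0 p (ordp p (s x)); rewrite e ltxx.
split.
- move=> x y Kx Ky; rewrite !placeE ?subMK // rmorphM.
  have [->|x0] := eqVneq x 0; first by rewrite rmorph0 mul0r wabs0 mul0r.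
  have [->|y0] := eqVneq y 0; first by rewrite rmorph0 mulr0 wabs0 mulr0.
  by rewrite !wabsE ?mulf_neq0 ?fmorph_eq0 // ordpM ?fmorph_eq0 // pexpD.
- move=> x y Kx Ky; rewrite !placeE ?subDK // rmorphD.
  have [->|x0] := eqVneq x 0; first by rewrite rmorph0 add0r le_max lexx orbT.
  have [->|y0] := eqVneq y 0; first by rewrite rmorph0 addr0 le_max lexx.
  have H r : (wabs p (s x) <= pexp p r -> wabs p (s y) <= pexp p r ->
      wabs p (s x + s y) <= pexp p r).
    by rewrite !wabs_le // => a b; apply: ord_geD.
  have sx0 : s x != 0 by rewrite fmorph_eq0.
  have sy0 : s y != 0 by rewrite fmorph_eq0.
  rewrite (wabsE _ sx0) (wabsE _ sy0) in H *.
  by case: (leP (pexp p (ordp p (s x)))) => [|/ltW] le; apply: H.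
- by rewrite placeE ?subnatK // rmorph_nat wabsE ?ordp_p ?pexp1 // pnatr_eq0 -lt0n prime_gt0.
Qed.

(** * An arbitrary place compared with the conjugates of the chosen valuation *)

Section AbstractPlace.
Variables (p : nat) (v : algC -> RR).
Hypothesis pv : is_place_over K p v.

Let p_pr : prime p. Proof. by case: pv. Qed.
Let v_ge0 x : 0 <= v x. Proof. by case: pv. Qed.
Let v_out x : ~~ K x -> v x = 0. Proof. by case: pv => _ H _ _ _; apply: H. Qed.
Let vM x y : K x -> K y -> v (x * y) = v x * v y.
Proof. by case: pv => _ _ _ _ [H _ _]; apply: H. Qed.
Let vD x y : K x -> K y -> v (x + y) <= Num.max (v x) (v y).
Proof. by case: pv => _ _ _ _ [_ H _]; apply: H. Qed.
Let vp : v p%:R = p%:R^-1. Proof. by case: pv => _ _ _ _ []. Qed.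
Let v0 : v 0 = 0.
Proof. by case: pv => _ _ _ H _; apply/(H 0 sub0K). Qed.
Let v_eq0 x : K x -> (v x == 0) = (x == 0).
Proof. by move=> Kx; case: pv => _ _ _ H _; apply/eqP/eqP; case: (H x Kx). Qed.
Let v_gt0 x : K x -> x != 0 -> 0 < v x.
Proof. by move=> Kx x0; rewrite lt_neqAle eq_sym v_eq0 // x0 v_ge0. Qed.

Let p0 : 0 < p%:R :> RR. Proof. by rewrite ltr0n prime_gt0. Qed.
Let p1 : p%:R^-1 < 1 :> RR. Proof. by rewrite invf_lt1 ?ltr0n ?ltr1n ?prime_gt1 ?prime_gt0. Qed.

Lemma absv1 : v 1 = 1.
Proof.
have v10 : v 1 != 0 by rewrite v_eq0 ?sub1K // oner_eq0.
by apply: (mulfI v10); rewrite -vM ?sub1K // !mulr1.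
Qed.

Lemma absvN x : v (- x) = v x.
Proof.
case: (boolP (K x)) => [Kx|nKx]; last first.
  by rewrite !v_out //; apply: contraNN nKx => /subNK; rewrite opprK.
rewrite -mulN1r vM ?subNK ?sub1K //; suff -> : v (- 1) = 1 by rewrite mul1r.
apply/eqP; rewrite -(@eqrXn2 _ 2) // expr1n expr2 -vM ?subNK ?sub1K //.
by rewrite mulrNN mulr1 absv1.
Qed.

Lemma absvX x n : K x -> v (x ^+ n) = v x ^+ n.
Proof.
by move=> Kx; elim: n => [|n IH]; rewrite ?absv1 // !exprS vM ?subXK ?IH.
Qed.

Lemma absvV x : K x -> v x^-1 = (v x)^-1.
Proof.
move=> Kx; have [->|x0] := eqVneq x 0; first by rewrite invr0 v0 invr0.
have vx0 : v x != 0 by rewrite v_eq0.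
by apply: (mulfI vx0); rewrite -vM ?subVK // !mulfV // absv1.
Qed.

Lemma absv_sum_lt (I : Type) (r : seq I) (P : pred I) (F : I -> algC) B : 0 < B ->
  (forall i, P i -> K (F i) /\ v (F i) < B) -> v (\sum_(i <- r | P i) F i) < B.
Proof.
move=> B0 H; suff: K (\sum_(i <- r | P i) F i) /\ v (\sum_(i <- r | P i) F i) < B by case.
apply: (big_rec (fun x => K x /\ v x < B)); first by rewrite sub0K v0.
move=> i x /H[Ki vi] [Kx vx]; rewrite subDK //; split=> //.
by rewrite (le_lt_trans (vD Ki Kx)) // gt_max vi.
Qed.

Lemma absv_nat n : v n%:R <= 1.
Proof.
elim: n => [|n IH]; first by rewrite v0.
rewrite -addn1 natrD (le_trans (vD (subnatK n) sub1K)) //.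
by rewrite ge_max IH absv1 lexx.
Qed.

Lemma absv_coprime n : coprime p n -> v n%:R = 1.
Proof.
move=> cop; have n0 : (0 < n)%N.
  by case: n cop => // /eqP; rewrite gcdn0 => e; move: p_pr; rewrite e.
apply/eqP; rewrite eq_le absv_nat /= leNgt; apply/negP => lt.
have [a _ /dvdnP[b E]] := Bezoutl p n0; rewrite gcdnC (eqP cop) in E.
have E' : 1 = b%:R * n%:R - a%:R * p%:R :> algC.
  by rewrite -!natrM -E natrD addrK.
have : v 1 < 1.
  rewrite E' (le_lt_trans (vD _ _)) ?subNK ?subMK ?subnatK //.
  rewrite absvN gt_max !vM ?subnatK // vp; apply/andP; split.
    by rewrite (le_lt_trans _ lt) // ler_piMl ?absv_nat.
  by rewrite (le_lt_trans _ p1) // ler_piMl ?absv_nat // invr_ge0 ltW.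
by rewrite absv1 ltxx.
Qed.

Lemma absv_rat_lt1 (r : rat) : ord_ge p 0 (ratr r) -> ordp p (ratr r) != 0 -> v (ratr r) < 1.
Proof.
have [->|r0] := eqVneq r 0; first by rewrite rmorph0 v0.
have r0' : ratr r != 0 :> algC by rewrite fmorph_eq0.
rewrite (ord_geE _ _ r0') => le ne.
have gt0 : 0 < ordp p (ratr r) by rewrite lt_neqAle eq_sym ne.
have [dv cop] := ord_gt0_numq p_pr r0 gt0.
have vint (z : int) : v z%:~R = v (`|z|%N)%:R.
  by case: z => n //; rewrite NegzE mulrNz absvN abszN.
rewrite /ratr vM ?subVK ?subintK // absvV ?subintK // !vint.
rewrite (absv_coprime cop) invr1 mulr1; case/dvdnP: dv => k ->.
rewrite natrM vM ?subnatK // vp (le_lt_trans _ p1) // ler_piMl ?absv_nat //.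
by rewrite invr_ge0 ltW.
Qed.

Lemma prime_below_unique p' : is_place_over K p' v -> p' = p.
Proof.
move=> [p'_pr _ _ _ [_ _ vp']]; apply/eqP/negPn/negP => ne.
have : coprime p p' by rewrite prime_coprime // dvdn_prime2 // eq_sym.
move/absv_coprime; rewrite vp' => /eqP; rewrite invr_eq1 pnatr_eq1 => /eqP p'1.
by move: p'_pr; rewrite p'1.
Qed.

Lemma prime_belowE : prime_below K v = p.
Proof.
apply: prime_below_unique; rewrite /prime_below /choose_nat.
exact: (ClassicalEpsilon.epsilon_spec (inhabits 0%N)
  (fun q => is_place_over K q v) (ex_intro _ p pv)).
Qed.

(* If all conjugates of [y] were of negative valuation, the minimal polynomial
   of [y^-1] would be congruent to a power of ['X]. *)
Lemma no_small_conj y : K y -> v y <= 1 -> (forall s : Gal, ordp p (s y) < 0) -> False.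
Proof.
move=> Ky vy H; have y0 : y != 0.
  by apply/eqP => y0; have := H gid; rewrite y0 rmorph0 ordp0 ltxx.
pose z := y^-1; have Kz : K z by apply: subVK.
have z0 : z != 0 by rewrite invr_eq0.
have vz : 1 <= v z by rewrite absvV // invf_ge1 // v_gt0.
have [q [Dq mq] _] := minCpolyP z.
have Hz x : x \in conjs z -> x != 0 /\ 0 < ordp p x.
  by case/gal_conjs=> s <-; rewrite fmorph_eq0 fmorphV ordpV oppr_gt0.
have [e e0 He] : exists2 e : rat, 0 < e & forall x, x \in conjs z -> ord_ge p e x.
  elim: (conjs z) Hz => [|x l IH] Hl; first by exists 1.
  have [|e e0 He] := IH; first by move=> u ul; apply: Hl; rewrite inE ul orbT.
  have [x0 ox] := Hl x (mem_head _ _).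
  exists (Num.min e (ordp p x)) => [|u]; first by rewrite lt_min e0.
  rewrite inE => /orP[/eqP->|/He]; first by rewrite ord_geE // ge_min lexx orbT.
  by apply: ord_geW; rewrite ge_min lexx.
pose d := size (conjs z).
have Dd : size (minCpoly z) = d.+1 by rewrite minCpoly_conjs size_prod_XsubC.
have := rootP (root_minCpoly z); rewrite horner_coef Dd big_ord_recr /=.
have -> : (minCpoly z)`_d = 1.
  by rewrite -(monicP (minCpoly_monic z)) lead_coefE Dd.
rewrite mul1r => /eqP; rewrite addrC addr_eq0 => /eqP E.
have vzd : 0 < v z ^+ d by rewrite exprn_gt0 // v_gt0.
(* The coefficients below the top are rationals of positive valuation, hence of [v] less than 1, and
   [v z] is at least 1: each lower term is smaller than the power that their sum equals up to
   sign. *)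
have : v (z ^+ d) < v z ^+ d.
  rewrite E absvN; apply: absv_sum_lt => // i _.
  have Hi : ord_ge p e (minCpoly z)`_i.
    by rewrite minCpoly_conjs; apply: ord_ge_coef_prod => //; apply: ltW.
  rewrite Dq coef_map /= in Hi *; rewrite subMK ?subratK ?subXK //; split=> //.
  rewrite vM ?subratK ?subXK // absvX //.
  have vi : v (ratr q`_i) < 1.
    have [->|qi0] := eqVneq q`_i 0; first by rewrite rmorph0 v0.
    have lt : 0 < ordp p (ratr q`_i).
      by rewrite (lt_le_trans e0) // -ord_geE // fmorph_eq0.
    by apply: absv_rat_lt1; [apply: ord_geW Hi; apply: ltW|rewrite gt_eqF].
  rewrite (@lt_le_trans _ _ (v z ^+ i)) ?ler_weXn2l ?(ltW (ltn_ord i)) //.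
    by rewrite gtr_pMl // exprn_gt0 // v_gt0.
  exact: ltnW.
by rewrite absvX // ltxx.
Qed.

Lemma pow_small (c : RR) : 0 <= c -> c < 1 -> exists N, c ^+ N * p%:R <= 1.
Proof.
move=> c0 c1; have [||N HN] := Rfunctions.pow_lt_1_zero c _ (p%:R^-1).
- by apply/RltP; rewrite RabsE ger0_norm.
- by apply/RltP; rewrite invr_gt0.
exists N; have /RltP := HN N (le_n N).
rewrite RabsE RpowE ger0_norm ?exprn_ge0 // => /ltW.
by rewrite -ler_pdivlMr // mul1r.
Qed.

(** The two absolute values differ at some x; replace it by 1/x if necessary so that [v] is the
    smaller. A power of x times a power of p then has valuation 0 under [t] while [v] is below 1,
    and a high power of this number stays in the unit ball of [v] after division by p. *)
Lemma separate (t : Gal) : v <> place p t K ->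
  exists y, [/\ K y, v y <= 1 & ordp p (t y) < 0].
Proof.
move=> ne; have [x [Kx x0 nx]] : exists x, [/\ K x, x != 0 & v x != wabs p (t x)].
  apply: contrapT => nx; apply: ne; apply/funext => x.
  case: (boolP (K x)) => [Kx|nKx]; last by rewrite /place (negbTE nKx) v_out.
  rewrite placeE //; have [->|x0] := eqVneq x 0; first by rewrite rmorph0 wabs0.
  by apply/eqP/negPn/negP => H; apply: nx; exists x.
wlog lt : x Kx x0 nx / v x < wabs p (t x).
  move=> H; move: (nx); rewrite neq_lt => /orP[lt|lt]; first exact: (H x).
  apply: (H x^-1); rewrite ?subVK ?invr_eq0 // fmorphV absvV //.
    by rewrite !wabsE ?invr_eq0 ?fmorph_eq0 // ordpV pexpN (inj_eq invr_inj) -wabsE ?fmorph_eq0.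
  rewrite !wabsE ?invr_eq0 ?fmorph_eq0 // ordpV pexpN ltf_pV2 ?posrE ?pexp_gt0 ?v_gt0 //.
  by rewrite -wabsE ?fmorph_eq0.
have tx0 : t x != 0 by rewrite fmorph_eq0.
rewrite wabsE // in lt; set r := ordp p (t x) in lt.
pose k := `|denq r|%N; have k0 : (0 < k)%N by rewrite absz_gt0 denq_neq0.
have kr : k%:R * r = (numq r)%:~R.
  by rewrite mulrC /k -[LHS]/(r * (`|denq r|%N : int)%:~R) gez0_abs ?denq_ge0 // -numqE.
pose pm : algC := p%:R ^ (- numq r).
have pC0 : p%:R != 0 :> algC by rewrite pnatr_eq0 -lt0n prime_gt0.
have pm0 : pm != 0 by apply: expfz_neq0.
have Kpm : K pm.
  rewrite /pm; case: (- numq r) => n; first exact/subXK/subnatK.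
  by rewrite NegzE -exprnN; apply/subVK/subXK/subnatK.
have vpm : v pm = pexp p (- (numq r)%:~R).
  rewrite /pm -mulrNz; case: (- numq r) => n.
    by rewrite -exprnP absvX ?subnatK // vp -pexp1 // -pexp_nat mulr1.
  rewrite NegzE -exprnN absvV ?subXK ?subnatK // absvX ?subnatK // vp.
  by rewrite -pexp1 // -pexp_nat mulr1 -pexpN mulrNz.
have ordpm : ordp p pm = - (numq r)%:~R.
  rewrite /pm -mulrNz; case: (- numq r) => n.
    by rewrite -exprnP ordpX ordp_p // mulr1.
  by rewrite NegzE -exprnN ordpV ordpX ordp_p // mulr1 mulrNz.
pose y0 := x ^+ k * pm; have Ky0 : K y0 by rewrite subMK ?subXK.
have vy0 : v y0 < 1.
  rewrite vM ?subXK // vpm absvX // -kr pexpN pexp_nat ltr_pdivrMr ?exprn_gt0 ?pexp_gt0 //.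
  by rewrite mul1r ltrXn2r // -?lt0n // ltW ?pexp_gt0.
have oy0 : ordp p (t y0) = 0.
  have tpm : t pm = pm by rewrite /pm rmorphXz /= ?rmorph_nat // unitfE.
  by rewrite rmorphM rmorphXn /= tpm ordpM ?expf_neq0 // ordpX ordpm -/r kr subrr.
have [N HN] := pow_small (v_ge0 y0) vy0.
have y00 : y0 != 0 by rewrite mulf_neq0 ?expf_neq0.
exists (y0 ^+ N / p%:R); split.
- by rewrite subMK ?subXK ?subVK ?subnatK.
- by rewrite vM ?subXK ?subVK ?subnatK // absvX // absvV ?subnatK // vp invrK.
rewrite rmorphM rmorphXn fmorphV rmorph_nat ordpM ?expf_neq0 ?fmorph_eq0 ?invr_eq0 //.
by rewrite ordpX oy0 mulr0 ordpV ordp_p // add0r oppr_lt0.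
Qed.

Lemma ordpD_lt x y r : x != 0 -> ord_ge p r y -> ordp p x < r -> ordp p (x + y) <= ordp p x.
Proof.
move=> x0 ry lt; rewrite leNgt; apply/negP => lt2.
have [xy0|xy0] := eqVneq (x + y) 0.
  move: ry lt; rewrite -[y](addKr x) xy0 addr0 ord_geN ord_geE // => le.
  by rewrite ltNge le.
have : ord_ge p (Num.min r (ordp p (x + y))) (x + y - y).
  apply: ord_geB => //; last by apply: ord_geW ry; rewrite ge_min lexx.
  by rewrite ord_geE // ge_min lexx orbT.
by rewrite addrK ord_geE // leNgt lt_min lt lt2.
Qed.

(** To f, with poles along [l], add a power of y so high that its pole dominates that of f wherever
    y has one. Where y is integral, the pole of f survives. *)
Lemma simultaneous (l : list Gal) :
  (forall t, List.In t l -> exists y, [/\ K y, v y <= 1 & ordp p (t y) < 0]) ->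
  exists f, [/\ K f, v f <= 1 & forall t, List.In t l -> ordp p (t f) < 0].
Proof.
elim: l => [|a l IH] H; first by exists 0; rewrite sub0K v0.
have [|f [Kf vf Hf]] := IH; first by move=> t tl; apply: H; right.
have [y [Ky vy Hy]] := H a (or_introl erefl).
have [N HN] : exists N, forall t, List.In t (a :: l) -> ordp p (t y) < 0 ->
    N%:R * ordp p (t y) < ordp p (t f).
  elim: (a :: l) => [|b m [N HN]]; first by exists 0%N.
  have [M HM] : exists M, ordp p (b y) < 0 -> M%:R * ordp p (b y) < ordp p (b f).
    have [lt|] := boolP (ordp p (b y) < 0); last by exists 0%N.
    exists (Num.bound `|ordp p (b f) / ordp p (b y)|) => _.
    have := archi_boundP (normr_ge0 (ordp p (b f) / ordp p (b y))).
    move=> H2; have := le_lt_trans (ler_norm _) H2.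
    by rewrite ltr_ndivrMr.
  exists (maxn N M) => t /= [<-|tm] lt.
    apply: le_lt_trans (HM lt); rewrite ler_wnM2r ?(ltW lt) //.
    by rewrite ler_nat leq_maxr.
  apply: le_lt_trans (HN t tm lt); rewrite ler_wnM2r ?(ltW lt) //.
  by rewrite ler_nat leq_maxl.
exists (y ^+ N.+1 + f); split.
- by rewrite subDK ?subXK.
- by rewrite (le_trans (vD _ _)) ?subXK // ge_max vf absvX // exprn_ile1.
move=> t tal; rewrite rmorphD rmorphXn /=.
have [lt|ge] := ltP (ordp p (t y)) 0.
  have ty0 : t y != 0 by apply/eqP => e; move: lt; rewrite e ordp0 ltxx.
  apply: (@le_lt_trans _ _ (ordp p (t y ^+ N.+1))).
    apply: (@ordpD_lt _ _ (ordp p (t f))); rewrite ?expf_neq0 ?ord_ge_ord //.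
    rewrite ordpX (lt_trans _ (HN t tal lt)) // ltr_nM2r // ltr_nat //.
  by rewrite ordpX pmulr_rlt0 // ltr0n.
have tl : List.In t l by case: tal => // at_; move: ge; rewrite -at_ leNgt Hy.
have tf := Hf t tl; rewrite addrC; apply: le_lt_trans (tf).
apply: (@ordpD_lt _ _ 0) => //; first by apply/eqP => e; move: tf; rewrite e ordp0 ltxx.
by rewrite /ord_ge ordpX mulr_ge0 ?ler0n ?orbT.
Qed.
End AbstractPlace.
End Subfield.

(** * Transitivity on the places over p, and finiteness *)

Lemma gal_rat_comb (s : Gal) q b : s (rat_comb q b) = rat_comb q (map s b).
Proof.
rewrite /rat_comb rmorph_sum size_map; apply: eq_bigr => i _.
by rewrite rmorphM /= fmorph_rat (nth_map 0).
Qed.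

Lemma number_field_level K : number_field K -> exists2 B : seq algC, all K B &
  forall s t : Gal, agree B s t -> forall x, K x -> s x = t x.
Proof.
move=> [_ [B [KB spanB _]]]; exists B => // s t /eqP st x /spanB[q ->].
by rewrite !gal_rat_comb st.
Qed.

Lemma reps_agree X T (s : Gal) : reps X T -> exists2 t, List.In t T & agree X s t.
Proof.
move=> /(_ s) c1; have : has (agree X s) T by rewrite has_count c1.
elim: T {c1} => //= a T IH /orP[sa|/IH[t tT st]]; first by exists a => //; left.
by exists t => //; right.
Qed.

(** Otherwise [separate] and [simultaneous], applied to finitely many representatives, give an
    element of K that is integral at v and has a pole at every conjugate, against
    [no_small_conj]. *)
Lemma place_transitive K p v : number_field K -> is_place_over K p v ->
  exists s, v = place p s K.
Proof.
move=> nfK pv; have [sfK _] := nfK; apply: contrapT => nex.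
have [B KB lB] := number_field_level nfK; have [T rT] := reps_exist B.
have [|f [Kf vf Hf]] := @simultaneous _ sfK _ _ pv T.
  by move=> t _; apply: separate => // e; apply: nex; exists t.
apply: (no_small_conj sfK pv Kf vf) => s.
by have [t tT st] := reps_agree s rT; rewrite (lB _ _ st) // Hf.
Qed.

Lemma nodup_list (A : Type) (l : list A) :
  exists l', List.NoDup l' /\ forall x, List.In x l' <-> List.In x l.
Proof.
pose dec (x y : A) : {x = y} + {x <> y} := pselect (x = y).
exists (List.nodup dec l); split; first exact: List.NoDup_nodup.
by move=> x; apply: List.nodup_In.
Qed.

Lemma nodup_comprehension (A : Type) (P : A -> Prop) (l : list A) :
  (forall x, P x -> List.In x l) ->
  exists l', List.NoDup l' /\ forall x, List.In x l' <-> P x.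
Proof.
move=> H; have [l' [nd Hl']] := nodup_list (List.filter (fun x => `[< P x >]) l).
exists l'; split=> // x; rewrite Hl' List.filter_In; split; first by case=> _ /asboolP.
by move=> Px; split; [apply: H|apply/asboolP].
Qed.

Lemma places_over_list K p : number_field K ->
  exists vs : list (algC -> RR), forall v, is_place_over K p v -> List.In v vs.
Proof.
move=> nfK; have [B KB lB] := number_field_level nfK; have [T rT] := reps_exist B.
exists (List.map (fun t => place p t K) T) => v /(place_transitive nfK)[s ->].
have [t tT st] := reps_agree s rT; apply/List.in_map_iff; exists t; split=> //.
by apply/funext => x; rewrite /place; case: ifP => // Kx; rewrite (lB _ _ st).
Qed.

Lemma places_bounded_list K N : number_field K ->
  exists vs : list (algC -> RR), forall p v, (p <= N)%N -> is_place_over K p v -> List.In v vs.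
Proof.
move=> nfK; elim: N => [|N [vs Hvs]].
  by exists [::] => p v; rewrite leqn0 => /eqP-> [].
have [vs' Hvs'] := places_over_list N.+1 nfK; exists (vs ++ vs')%list => p v.
rewrite leq_eqVlt ltnS => /orP[/eqP->|le] pv; apply/List.in_app_iff.
  by right; apply: Hvs'.
by left; apply: Hvs pv.
Qed.

Lemma covers_exist K y : number_field K -> K y -> y != 0 ->
  exists vs, covers_support K y vs.
Proof.
move=> nfK Ky y0; have [N HN] := ord_support y.
have [vs Hvs] := places_bounded_list N nfK.
have [|vs' [nd Hvs']] := @nodup_comprehension _ (fun v => is_place K v /\ v y != 1) vs.
  move=> v [[p pv] ne]; apply: (Hvs p) => //; rewrite leqNgt; apply/negP => ltN.
  have p_pr : prime p by case: pv.
  have [s Ds] := place_transitive nfK pv; move: ne.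
  by rewrite Ds placeE // wabsE ?fmorph_eq0 // HN // pexp0 eqxx.
exists vs'; split=> //; first by move=> v /Hvs'[].
by move=> v pv ne; apply/Hvs'.
Qed.

Lemma eq_place_agree (K : pred algC) p B (s t : Gal) :
  (forall s t : Gal, agree B s t -> forall x, K x -> s x = t x) ->
  agree B s t -> place p s K = place p t K.
Proof.
move=> lB st; apply/funext => x; rewrite /place; case: ifP => // Kx.
by rewrite (lB _ _ st).
Qed.

Lemma flevel_place K p : number_field K -> flevel (fun s => place p s K).
Proof.
move=> nfK; have [B KB lB] := number_field_level nfK.
by exists B => s t; apply: eq_place_agree.
Qed.

Lemma place_above_over (K L : pred algC) p v w : is_subfield K -> {subset K <= L} ->
  is_place_over K p v -> is_place L w -> place_above K v w -> is_place_over L p w.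
Proof.
move=> sfK KL pv [p' [p'_pr w1 w2 w3 [w4 w5 w6]]] vw.
have [p_pr _ _ _ [_ _ vp]] := pv; split=> //; split=> //.
by rewrite vw // subnatK.
Qed.

(** * Fixed fields *)

(** By Galois theory this is Q(X). *)
Definition fixK (X : seq algC) : pred algC :=
  fun z => `[< forall s : Gal, agree X s gid -> s z = z >].

Lemma fixKP X z : reflect (forall s : Gal, agree X s gid -> s z = z) (fixK X z).
Proof. exact: asboolP. Qed.

Lemma fixK_agree X s t z : agree X s t -> fixK X z -> s z = t z.
Proof.
move=> /agreeP st /fixKP H; have : gcomp (ginv t) s z = z.
  by apply: H; apply/agreeP => x Xx /=; rewrite st // ginvK.
by move/(congr1 t); rewrite gcompE ginvKV.
Qed.

Lemma fixK_mem X x : x \in X -> fixK X x.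
Proof. by move=> Xx; apply/fixKP => s /agreeP->. Qed.

Lemma fixK_stable X (s : Gal) z : gstable X -> fixK X z -> fixK X (s z).
Proof.
move=> sX Kz; apply/fixKP => t /agreeP tX; rewrite -gcompE; apply: fixK_agree Kz.
by apply/agreeP => x Xx /=; rewrite tX ?sX.
Qed.

Lemma fixK_subfield X : is_subfield (fixK X).
Proof.
split.
- by apply/fixKP => s _; rewrite rmorph1.
- move=> x y /fixKP Hx /fixKP Hy; apply/fixKP => s sX.
  by rewrite rmorphB Hx ?Hy.
- move=> x y /fixKP Hx /fixKP Hy; apply/fixKP => s sX.
  by rewrite rmorphM Hx ?Hy.
- by move=> x /fixKP Hx; apply/fixKP => s sX; rewrite fmorphV Hx.
Qed.

Definition qfree (s : seq algC) := forall q : seq rat,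
  size q = size s -> rat_comb q s = 0 -> forall i, (i < size s)%N -> nth 0 q i = 0.

Lemma rat_comb_cons a q x s : rat_comb (a :: q) (x :: s) = ratr a * x + rat_comb q s.
Proof. by rewrite /rat_comb big_ord_recl. Qed.

Lemma rat_combZ c q s : size q = size s ->
  rat_comb [seq c * a | a <- q] s = ratr c * rat_comb q s.
Proof.
move=> sz; rewrite /rat_comb mulr_sumr; apply: eq_bigr => i _.
by rewrite (nth_map 0) ?sz // rmorphM /= mulrA.
Qed.

Lemma qfree_span s x : qfree s -> ~ qfree (x :: s) -> exists q, x = rat_comb q s.
Proof.
move=> frs nfr; apply: contrapT => nq; apply: nfr => -[|a q] //= [sz].
rewrite rat_comb_cons => E; have a0 : a = 0.
  apply: contrapT => /eqP a0; apply: nq; exists [seq - a^-1 * b | b <- q].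
  rewrite rat_combZ // rmorphN fmorphV mulNr -mulrN.
  have -> : - rat_comb q s = ratr a * x by apply/eqP; rewrite eq_sym -addr_eq0 E.
  by rewrite mulKf // fmorph_eq0.
move=> [|i] //= lti; apply: frs => //.
by move: E; rewrite a0 rmorph0 mul0r add0r.
Qed.

(* Artin: averaging a dependence over [algC] makes it rational. *)
Lemma fixK_dependent X T (z : seq algC) : reps X T -> all (fixK X) z ->
  qfree z -> (size z <= size T)%N.
Proof.
move=> rT /allP Kz frz; rewrite leqNgt; apply/negP => ltT.
set m := size z in ltT; set n := size T in ltT.
pose A : 'M[algC]_(m, n) := \matrix_(i, j) (nth gid T j) (nth 0 z i).
(* There are more elements than embeddings, so the conjugates satisfy a linear relation over
   [algC]. *)
have kA : kermx A != 0.
  rewrite -mxrank_eq0 mxrank_ker subn_eq0 -ltnNge.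
  by rewrite (leq_ltn_trans (rank_leq_col A)).
have [u uA u0] : exists2 u : 'rV[algC]_m, u *m A = 0 & u != 0.
  move/rowV0Pn: kA => [u /sub_kermxP uA u0]; by exists u.
have [i0 ui0] : exists i0, u 0 i0 != 0.
  apply: contrapT => nu; case/eqP: u0; apply/rowP => i; rewrite mxE.
  by apply/eqP/negPn/negP => ui; apply: nu; exists i.
pose w i := u 0 i / u 0 i0.
have wz (s : Gal) : \sum_i w i * s (nth 0 z i) = 0.
  have [t tT st] := reps_agree s rT.
  have [j Dj] : exists j : 'I_n, nth gid T j = t.
    have [k [kn Dk]] := List.In_nth T t gid tT.
    move/ssrnat.ltP: kn => kn; exists (Ordinal kn) => /=; rewrite -[RHS]Dk.
    by elim: (T) (k) => [|? ? IH] [|?] //=.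
  have := congr1 (fun B : 'rV_n => B 0 j / u 0 i0) uA; rewrite !mxE mul0r mulr_suml => E.
  rewrite -[RHS]E.
  apply: eq_bigr => i _; rewrite mxE Dj /w mulrAC (fixK_agree st) //.
  by apply: Kz; apply: mem_nth.
have sw (s : Gal) : \sum_i s (w i) * nth 0 z i = 0.
  have := congr1 s (wz (ginv s)); rewrite rmorph0 rmorph_sum => E.
  rewrite -[RHS]E.
  by apply: eq_bigr => i _; rewrite [RHS]rmorphM; congr (_ * _); exact/esym/ginvKV.
pose U := [seq w i | i <- enum 'I_m]; have [T' rT'] := reps_exist U.
have lU i : level U (fun s : Gal => s (w i)).
  by move=> s t /agreeP; apply; apply: map_f; rewrite mem_enum.
pose tr i := \sum_(t <- T') t (w i).
have tr_rat i : tr i \in Crat.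
  apply: gal_fixed_Crat => s; rewrite /tr rmorph_sum.
  exact: (reps_sum_left rT' (F := fun t : Gal => t (w i))).
have trz : \sum_i tr i * nth 0 z i = 0.
  under eq_bigr => i _ do rewrite mulr_suml.
  by rewrite exchange_big big1.
pose q := [seq getCrat (tr i) | i <- enum 'I_m].
have szq : size q = m by rewrite size_map -cardE card_ord.
have nq (i : 'I_m) : ratr (nth 0 q i) = tr i.
  rewrite (nth_map i) -?cardE ?card_ord // nth_ord_enum.
  exact: getCratK.
have : nth 0 q i0 = 0.
  apply: frz => //; rewrite /rat_comb -[RHS]trz.
  by apply: eq_bigr => i _; rewrite nq.
move/(congr1 (@ratr algC)); rewrite nq rmorph0 /tr /w mulfV //.
under eq_bigr do rewrite rmorph1.
rewrite big_const_seq count_predT iter_addr_0 => /eqP.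
by rewrite pnatr_eq0 -leqn0 leqNgt (reps_size_gt0 rT').
Qed.

Lemma fixK_number_field X : number_field (fixK X).
Proof.
split; first exact: fixK_subfield.
have [T rT] := reps_exist X.
pose P n := `[< exists s, [/\ all (fixK X) s, qfree s & size s = n] >].
have Pex : exists n, P n by exists 0%N; apply/asboolP; exists [::].
have Pub n : P n -> (n <= size T)%N.
  by move=> /asboolP[s [Ks frs <-]]; apply: fixK_dependent Ks frs.
case: (ex_maxnP Pex Pub) => n /asboolP[s [Ks frs sz]] max.
exists s; split=> // x Kx; apply: qfree_span frs _ => frx.
have := max n.+1; rewrite ltnn => H; suff: false by [].
apply: H; apply/asboolP; exists (x :: s); split=> //=; last by rewrite sz.
by rewrite Kx.
Qed.

Lemma eq_big_In (V : nmodType) (I : Type) (l : list I) (F G : I -> V) :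
  (forall i, List.In i l -> F i = G i) -> \sum_(i <- l) F i = \sum_(i <- l) G i.
Proof.
elim: l => [|i l IH] H; first by rewrite !big_nil.
rewrite !big_cons H; last by left.
by rewrite IH // => j jl; apply: H; right.
Qed.

Lemma sum_indicator (R : pzRingType) (I : Type) (l : list I) x : List.NoDup l ->
  \sum_(y <- l) (`[< x = y >])%:R = (`[< List.In x l >])%:R :> R.
Proof.
elim: l => [|a l IH] nd; first by rewrite big_nil; case: asboolP.
rewrite big_cons IH; last by inversion nd.
have nal : ~ List.In a l by inversion nd.
case: (asboolP (x = a)) => [->|xa].
  case: asboolP => // _; case: asboolP => [_|]; first by rewrite addr0.
  by case; left.
rewrite add0r; congr (_%:R); congr nat_of_bool; apply/asboolP/asboolP => [xl|[]//].
  by right.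
by move=> ax; case: xa.
Qed.

(** * The functionals [PhiA] *)

Definition atom p (X w : seq algC) (x : algC) : rat :=
  mean (fun t => (map t X == w)%:R * ordp p (t x)).

(** The sign is that of log ||y||_v = - ord(y) log p; the factor makes the map vanish, as [atom]
    does, when p is not prime. *)
Definition atomc p (X w : seq algC) (K : pred algC) (v : algC -> RR) : rat :=
  (prime p)%:R * - mean (fun t => (map t X == w)%:R * (`[< place p t K = v >])%:R).

Lemma flevel_atom p (X w : seq algC) x :
  flevel (fun t : Gal => (map t X == w)%:R * ordp p (t x)).
Proof.
apply: (flevel_app2 *%R); last exact: flevel_ordp.
exact: (flevel_app (fun u => (u == w)%:R) (flevel_map X)).
Qed.

Lemma flevel_atomc p (X w : seq algC) K (v : algC -> RR) : number_field K ->
  flevel (fun t : Gal => (map t X == w)%:R * (`[< place p t K = v >])%:R : rat).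
Proof.
move=> nfK; apply: (flevel_app2 *%R).
  exact: (flevel_app (fun u => (u == w)%:R) (flevel_map X)).
exact: (flevel_app (fun u => (`[< u = v >])%:R) (flevel_place p nfK)).
Qed.

(** * Homomorphisms to Q and their common kernels *)

Definition ghom (f : algC -> rat) := forall x y, x != 0 -> y != 0 -> f (x * y) = f x + f y.

Lemma ghom1 f : ghom f -> f 1 = 0.
Proof.
by move=> hf; apply: (addrI (f 1)); rewrite addr0 -hf ?oner_eq0 // mulr1.
Qed.

Lemma ghomV f x : ghom f -> x != 0 -> f x^-1 = - f x.
Proof.
move=> hf x0; apply: (addrI (f x)); rewrite -hf ?invr_eq0 // mulfV // subrr.
exact: ghom1.
Qed.

Lemma ghomX f x n : ghom f -> x != 0 -> f (x ^+ n) = n%:R * f x.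
Proof.
move=> hf x0; elim: n => [|n IH]; first by rewrite mul0r ghom1.
by rewrite exprS hf ?expf_neq0 // IH -[n.+1]add1n natrD mulrDl mul1r.
Qed.

Lemma ghomXz f x (m : int) : ghom f -> x != 0 -> f (x ^ m) = m%:~R * f x.
Proof.
move=> hf x0; case: m => n; first exact: ghomX.
by rewrite NegzE -exprnN ghomV ?expf_neq0 // ghomX // mulrNz mulNr.
Qed.

Lemma ghom_prod f (I : Type) (r : seq I) (P : pred I) (F : I -> algC) : ghom f ->
  (forall i, P i -> F i != 0) -> f (\prod_(i <- r | P i) F i) = \sum_(i <- r | P i) f (F i).
Proof.
move=> hf F0; suff: \prod_(i <- r | P i) F i != 0 /\
    f (\prod_(i <- r | P i) F i) = \sum_(i <- r | P i) f (F i) by case.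
apply: (big_rec2 (fun x s => x != 0 /\ f x = s)); first by rewrite oner_eq0 ghom1.
by move=> i x s /F0 Fi [x0 <-]; rewrite mulf_neq0 // hf.
Qed.

Lemma ghom_sum (I : Type) (l : seq (I * rat)) (f : I -> algC -> rat) :
  (forall i, ghom (f i)) -> ghom (fun z => \sum_(i <- l) i.2 * f i.1 z).
Proof.
move=> hf x y x0 y0; rewrite -big_split; apply: eq_bigr => i _.
by rewrite hf // mulrDr.
Qed.

Lemma ghomB f g : ghom f -> ghom g -> ghom (fun z => f z - g z).
Proof. by move=> hf hg x y x0 y0; rewrite hf // hg // opprD addrACA. Qed.

(** Multiplicative form of the fact that a linear form vanishing on the kernel of finitely many
    others is a combination of them. The induction removes one form by passing to its kernel, so the
    statement is about a subgroup [S]. *)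
Lemma ghom_comb (I : Type) (f : I -> algC -> rat) (l : list I) (S : algC -> Prop) Phi :
  (forall x, S x -> x != 0) -> (forall x y, S x -> S y -> S (x * y)) ->
  (forall x, S x -> S x^-1) -> (forall i, ghom (f i)) -> ghom Phi ->
  (forall z, S z -> (forall i, List.In i l -> f i z = 0) -> Phi z = 0) ->
  exists A : seq (I * rat), forall z, S z -> Phi z = \sum_(i <- A) i.2 * f i.1 z.
Proof.
move=> + + + hf hP; elim: l S => [|i l IH] S S0 SM SV ker.
  by exists [::] => z Sz; rewrite big_nil ker.
pose S' x := S x /\ f i x = 0.
have [||||A HA] := IH S'.
- by move=> x [/S0].
- by move=> x y [Sx fx] [Sy fy]; split; [apply: SM|rewrite hf ?fx ?fy ?addr0 ?S0].
- by move=> x [Sx fx]; split; [apply: SV|rewrite ghomV ?fx ?oppr0 ?S0].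
- by move=> z [Sz fz] H; apply: ker => // j [<-|/H].
case: (pselect (exists2 z0, S z0 & f i z0 != 0)) => [[z0 Sz0 fz0]|nz]; last first.
  exists A => z Sz; apply: HA; split=> //.
  by apply/eqP/negPn/negP => fz; apply: nz; exists z.
pose Psi z := Phi z - \sum_(i <- A) i.2 * f i.1 z.
have hPsi : ghom Psi by apply: ghomB => //; apply: ghom_sum.
have Psi0 z : S' z -> Psi z = 0 by move=> /HA E; rewrite /Psi E subrr.
exists ((i, Psi z0 / f i z0) :: A) => z Sz; rewrite big_cons /=.
apply/eqP; rewrite -subr_eq; apply/eqP; rewrite -/(Psi z).
pose r := f i z / f i z0.
have SXz x (m : int) : S x -> S (x ^ m).
  have S1 : S 1 by rewrite -(mulfV (S0 _ Sz)); apply: SM => //; apply: SV.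
  have SX n : S x -> S (x ^+ n) by move=> Sx; elim: n => // n IHn; rewrite exprS; apply: SM.
  by case: m => n Sx; [apply: SX|rewrite NegzE -exprnN; apply/SV/SX].
have z0n := S0 _ Sz0; have zn := S0 _ Sz.
(* For r = f_i(z) / f_i(z0) the element z / z0^r would be in the kernel of f_i; raising it to the
   denominator of r keeps the exponents integral. *)
have : Psi (z ^ denq r * z0 ^ (- numq r)) = 0.
  apply: Psi0; split; first by apply: SM; apply: SXz.
  rewrite hf ?expfz_neq0 // !ghomXz // mulrNz numqE.
  by set d := (denq r)%:~R; rewrite /r; field.
rewrite hPsi ?expfz_neq0 // !ghomXz // mulrNz numqE mulNr => /eqP.
rewrite subr_eq0 => /eqP E; apply: (mulfI (_ : (denq r)%:~R != 0 :> rat)).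
  by rewrite intr_eq0 denq_neq0.
by rewrite E; set d := (denq r)%:~R; rewrite /r; field.
Qed.

Lemma atom0 p X w : atom p X w 0 = 0.
Proof.
rewrite /atom -[RHS](mean_cst 0); apply: eq_mean => t.
by rewrite rmorph0 ordp0 mulr0.
Qed.

Lemma atom_hom p X w : ghom (atom p X w).
Proof.
move=> x y x0 y0; rewrite /atom -meanD; try exact: flevel_atom.
by apply: eq_mean => t; rewrite rmorphM ordpM ?fmorph_eq0 // mulrDr.
Qed.

Lemma atom_Aunit p X w u : Aunit u -> atom p X w u = 0.
Proof.
move=> uu; rewrite /atom -[RHS](mean_cst 0); apply: eq_mean => t.
by rewrite ordp_Aunit // mulr0.
Qed.

Lemma atom_stab p X w (s : Gal) x : agree X s gid -> atom p X w (s x) = atom p X w x.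
Proof.
move=> /agreeP sX; rewrite /atom -[RHS](mean_right s); last exact: flevel_atom.
apply: eq_mean => t; rewrite gcompE; congr ((_ == _)%:R * _).
by apply/eq_in_map => y Xy; rewrite gcompE sX.
Qed.

Lemma atom_nprime p X w x : ~~ prime p -> atom p X w x = 0.
Proof.
move=> np; rewrite /atom -[RHS](mean_cst 0); apply: eq_mean => t.
by rewrite ordp_nprime // mulr0.
Qed.

(** For each t exactly one place of L is induced by t, and it lies above v precisely when t induces
    v on K. *)
Lemma atomc_consistent p X w (K L : pred algC) v ws :
  number_field K -> number_field L -> {subset K <= L} -> is_place K v ->
  List.NoDup ws -> (forall u, List.In u ws <-> is_place L u /\ place_above K v u) ->
  atomc p X w K v = \sum_(u <- ws) atomc p X w L u.
Proof.
move=> nfK nfL KL [p0 pv] nd Hws; rewrite /atomc -mulr_sumr sumrN.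
case: (boolP (prime p)) => [p_pr|]; last by rewrite !mul0r.
congr (_ * - _); rewrite -mean_sum; last by move=> u; apply: flevel_atomc.
apply: eq_mean => t; rewrite -mulr_sumr sum_indicator //; congr (_ * _%:R).
congr nat_of_bool; apply/asboolP/asboolP => [Dv|/Hws[_ above]].
  apply/Hws; split; first by exists p; apply: place_is_place => //; case: nfL.
  by move=> x Kx; rewrite -Dv !placeE //; apply: KL.
apply/funext => x; case: (boolP (K x)) => [Kx|nKx].
  by rewrite -above // !placeE //; apply: KL.
by rewrite /place (negbTE nKx); case: pv => _ ->.
Qed.

(** When t induces v on K, the valuation of [t y] is determined by v, so the mean splits into one
    term per place. If t induces a place outside [vs], the valuation of [t y] is 0; the power n
    contributes the factor 1/n. *)
Lemma atom_Phi_c p X w x K n y vs : x != 0 -> number_field K -> in_SK K x n y ->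
  covers_support K y vs ->
  (ratr (atom p X w x) : RR) =
   \sum_(v <- vs) ratr (atomc p X w K v) / rlog (prime_below K v)%:R * log_vnorm v n y.
Proof.
move=> x0 nfK [n0 Ky y0 [u [uu E]]] [nd vsP cov]; have [sfK _] := nfK.
case: (boolP (prime p)) => [p_pr|np]; last first.
  rewrite atom_nprime // rmorph0 big1 // => v _.
  by rewrite /atomc (negbTE np) mul0r rmorph0 !mul0r.
have nR0 : n%:R != 0 :> rat by rewrite pnatr_eq0 -lt0n.
have lP0 : rlog p%:R != 0 by rewrite gt_eqF ?rlog_prime_gt0.
pose G (v : algC -> RR) (t : Gal) : rat := (map t X == w)%:R * (`[< place p t K = v >])%:R * ordp p (t y).
have lG v : flevel (G v).
  apply: (flevel_app2 *%R); last exact: flevel_ordp.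
  exact: flevel_atomc.
have term v : List.In v vs ->
    ratr (atomc p X w K v) / rlog (prime_below K v)%:R * log_vnorm v n y =
    ratr (n%:R^-1 * mean (G v)).
  move=> vvs; case: (pselect (exists t, place p t K = v)) => [[t0 Dv]|nt]; last first.
    have -> : atomc p X w K v = 0.
      rewrite /atomc -[X in - X](_ : 0 = _) ?oppr0 ?mulr0 //.
      rewrite -(mean_cst 0); apply: eq_mean => t; case: asboolP => [e|_].
        by case: nt; exists t.
      by rewrite mulr0.
    have -> : mean (G v) = 0.
      rewrite -(mean_cst 0); apply: eq_mean => t; rewrite /G; case: asboolP => [e|_].
        by case: nt; exists t.
      by rewrite mulr0 mul0r.
    by rewrite mulr0 rmorph0 !mul0r.
  have pbv : prime_below K v = p.
    by apply: prime_belowE => //; rewrite -Dv; apply: place_is_place.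
  have lv : rlog (v y) = - (ratr (ordp p (t0 y)) * rlog p%:R).
    by rewrite -Dv placeE // wabsE ?fmorph_eq0 // log_pexp.
  have -> : mean (G v) = ordp p (t0 y) *
      mean (fun t => (map t X == w)%:R * (`[< place p t K = v >])%:R).
    rewrite -meanZ; last exact: flevel_atomc.
    apply: eq_mean => t; rewrite /G mulrC; case: asboolP => [e|_]; last by rewrite !mulr0.
    congr (_ * _); apply: (pexp_inj p_pr); move/(congr1 (fun v => v y)): (etrans e (esym Dv)).
    by rewrite !placeE // !wabsE ?fmorph_eq0.
  rewrite pbv /log_vnorm lv /atomc p_pr mul1r !rmorphM rmorphN /= fmorphV /= ratr_nat.
  by field; rewrite lP0 pnatr_eq0 -lt0n n0.
rewrite (eq_big_In term) -rmorph_sum -mulr_sumr -mean_sum //=; congr ratr.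
apply: (mulfI nR0); rewrite mulVKf // /atom -meanZ; last exact: flevel_atom.
apply: eq_mean => t; rewrite /G -mulr_suml -mulr_sumr sum_indicator // mulrCA -mulrA; congr (_ * _).
have oE : n%:R * ordp p (t x) = ordp p (t y).
  have [_ [_ u0]] := uu; rewrite -ordpX -rmorphXn /= E rmorphM ordpM ?fmorph_eq0 //.
  by rewrite (ordp_Aunit _ _ uu) addr0.
rewrite oE; case: asboolP => [_|nin]; first by rewrite mul1r.
rewrite mul0r; apply: (pexp_inj p_pr); rewrite pexp0 -wabsE ?fmorph_eq0 // -(placeE _ _ Ky).
apply/eqP/negPn/negP => ne; apply: nin; apply: cov => //.
by exists p; apply: place_is_place.
Qed.

(** * Rational combinations of the mean functionals *)

Definition code := (nat * seq algC * seq algC)%type.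
Definition atom_of (a : code) := atom a.1.1 a.1.2 a.2.

Definition PhiA (A : seq (code * rat)) (x : algC) : rat :=
  \sum_(a <- A) a.2 * atom_of a.1 x.

Definition cA (A : seq (code * rat)) K v : rat :=
  \sum_(a <- A) a.2 * atomc a.1.1.1 a.1.1.2 a.1.2 K v.

Lemma PhiA_Sdual A : Sdual (PhiA A).
Proof.
split.
- by rewrite /PhiA big1 // => a _; rewrite /atom_of atom0 mulr0.
- by apply: ghom_sum => a; apply: atom_hom.
- by move=> u uu; rewrite /PhiA big1 // => a _; rewrite /atom_of atom_Aunit // mulr0.
Qed.

Lemma PhiA_fin A : finite_index_stab (PhiA A).
Proof.
pose X := nclos (flatten [seq a.1.1.2 | a <- A]); have [T rT] := reps_exist X.
exists T => s; have [t tT /agreeP st] := reps_agree s rT; exists t; split=> //.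
have sX := @nclos_stable (flatten [seq a.1.1.2 | a <- A]).
(* This fixes [X] pointwise, since s and t agree on [X] and t permutes it. *)
exists (gcomp s (ginv t)); split; last by move=> x; rewrite gcompE ginvK.
move=> x; rewrite /PhiA; apply: eq_big_seq => a aA; congr (_ * _).
apply: atom_stab; apply/agreeP => y ya; rewrite gcompE gidE st ?ginvKV //.
apply: sX; apply: nclos_sub; apply/flatten_mapP; exists a => //.
Qed.

Lemma PhiA_com A : compactly_supported (PhiA A).
Proof.
exists (cA A); split.
- move=> K L v nfK nfL KL pv; have [p0 pv0] := pv.
  have [vs Hvs] := places_over_list p0 nfL.
  have [|ws [nd Hws]] := @nodup_comprehension _ (fun u => is_place L u /\ place_above K v u) vs.
    move=> u [pu vu]; apply: Hvs; have [sfK _] := nfK.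
    exact: place_above_over sfK KL pv0 pu vu.
  exists ws; split=> //; rewrite /cA exchange_big; apply: eq_bigr => a _ /=.
  by rewrite -mulr_sumr (atomc_consistent _ _ _ nfK nfL KL pv nd Hws).
- move=> x K n y vs x0 nfK SK cov; rewrite /PhiA rmorph_sum.
  under [RHS]eq_bigr => v _ do rewrite /cA rmorph_sum !mulr_suml.
  rewrite exchange_big; apply: eq_bigr => a _ /=; rewrite rmorphM /= /atom_of.
  rewrite (atom_Phi_c _ _ _ x0 nfK SK cov).
  by rewrite mulr_sumr; apply: eq_bigr => v _; rewrite [in RHS](rmorphM ratr a.2) -!mulrA.
- exists [seq a.1.1.1 | a <- A] => K v nfK pv npA; rewrite /cA big_seq big1 // => a aA.
  rewrite /atomc; case: (boolP (prime _)) => [p_pr|]; last by rewrite mul0r mulr0.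
  rewrite -[X in - X](_ : 0 = _) ?oppr0 ?mulr0 //.
  rewrite -(mean_cst 0); apply: eq_mean => t; case: asboolP => [e|_]; last by rewrite mulr0.
  case/negP: npA; apply/mapP; exists a => //; have [sfK _] := nfK.
  by apply: prime_belowE => //; rewrite -e; apply: place_is_place.
Qed.

Lemma PhiA_Cstar A : Cstar (PhiA A).
Proof.
split; split; try exact: PhiA_Sdual; [exact: PhiA_fin|exact: PhiA_com].
Qed.

(** * Spanning and approximation by the mean functionals *)

Lemma compactly_supported_eq0 c Phi P y : is_Phi_c c Phi -> supported_on c P ->
  y != 0 -> (forall p (s : Gal), prime p -> p \in P -> ordp p (s y) = 0) -> Phi y = 0.
Proof.
(* Evaluated in Q(y), the places over [P] contribute log 1, and at the others c vanishes. *)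
move=> HPhi supp y0 Hy; pose K := fixK [:: y].
have nfK := fixK_number_field [:: y]; have [sfK _] := nfK.
have Ky : K y by apply: fixK_mem; rewrite inE.
have [vs cov] := covers_exist nfK Ky y0.
have SK : in_SK K y 1 y.
  split=> //; exists 1; rewrite expr1 mulr1; split=> //; split; first exact: Aint1.
  by rewrite invr1 oner_eq0; split=> //; exact: Aint1.
have := HPhi _ _ _ _ _ y0 nfK SK cov; rewrite (eq_big_In (G := fun=> 0)); last first.
  have [_ vsP _] := cov.
  move=> v /vsP[p pv]; have p_pr : prime p by case: pv.
  have pb : prime_below K v = p by apply: prime_belowE.
  case: (boolP (p \in P)) => pP; last first.
    by rewrite (supp K v) ?pb //; [rewrite rmorph0 !mul0r|exists p].
  have [s Dv] := place_transitive nfK pv.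
  rewrite /log_vnorm Dv placeE // wabsE ?fmorph_eq0 // Hy // pexp0 rlog1.
  by rewrite mul0r mulr0.
by rewrite big1 // => /eqP; rewrite fmorph_eq0 => /eqP.
Qed.

(** A subgroup of finite index in the absolute Galois group need not be open, but the stabilizer of
    a function is. For each representative outside the stabilizer, [F] contains a point at which it
    changes [Phi]. If s fixes [F], its representative, which moves [Phi] as s does, leaves [Phi]
    unchanged on [F] and so lies in the stabilizer. *)
Lemma finite_index_open Phi : finite_index_stab Phi ->
  exists F : seq algC, forall s : Gal, agree F s gid -> in_Stab Phi s.
Proof.
move=> [taus Ht].
have [F HF] : exists F : seq algC, forall tau, List.In tau taus ->
    (forall x, x \in F -> Phi (tau x) = Phi x) -> in_Stab Phi tau.
  elim: (taus) => [|a l [F HF]]; first by exists [::].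
  case: (pselect (in_Stab Phi a)) => [Sa|nSa].
    by exists F => tau [<-|/HF].
  have [x Hx] : exists x, Phi (a x) <> Phi x.
    by apply: contrapT => nx; apply: nSa => x; apply: contrapT => ne; apply: nx; exists x.
  exists (x :: F) => tau [<-|tl] H; first by case: Hx; apply: H; rewrite inE eqxx.
  by apply: HF => // y yF; apply: H; rewrite inE yF orbT.
exists F => s /agreeP sF; have [tau [tt [h [Sh Ds]]]] := Ht s.
have E x : Phi (s x) = Phi (tau x) by rewrite Ds Sh.
suff St : in_Stab Phi tau by move=> x; rewrite E St.
by apply: HF => // x xF; rewrite -E sF.
Qed.

(** For z in Q(X) the valuation of [t z] depends only on t restricted to [X], so the atom at that
    restriction is this valuation divided by the size of [T]. *)
Lemma atom_eq0_ord p X T z : reps X T -> fixK X z ->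
  (forall t, List.In t T -> atom p X (map t X) z = 0) -> forall s : Gal, ordp p (s z) = 0.
Proof.
move=> rT Kz H s; have [t tT st] := reps_agree s rT.
rewrite (fixK_agree st Kz); have := H t tT; rewrite /atom (meanE rT).
  rewrite /avg => /eqP; rewrite mulf_eq0 invr_eq0 pnatr_eq0 -leqn0 leqNgt (reps_size_gt0 rT) orbF.
  move=> /eqP E; rewrite -[LHS](reps_sum_agree rT _ t) -[RHS]E [RHS]big_mkcond /=.
  rewrite big_mkcond; apply: eq_bigr => t' _; rewrite /agree eq_sym.
  case: eqP => [e|_]; last by rewrite mul0r.
  by rewrite mul1r (@fixK_agree X t t') // /agree e.
move=> s1 s2 e; rewrite (fixK_agree e Kz); congr ((_ == _)%:R * _).
exact/eqP.
Qed.

(** The product is the norm of z from Q(Y) to Q(X). Left translation by s turns the classes fixing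
    [X] into those that agree with s on [X]. *)
Lemma norm_ord_atom p X Y T z (s : Gal) : {subset X <= Y} -> z \in Y -> z != 0 -> reps Y T ->
  ordp p (s (\prod_(h <- T | agree X h gid) h z)) =
    (size T)%:R * atom p X (map s X) z.
Proof.
move=> XY Yz z0 rT; have lY : level Y (fun t : Gal => (map t X == map s X)%:R * ordp p (t z)).
  move=> t u tu; rewrite (eqP (agreeS XY tu)); congr (_ * ordp p _).
  by move/agreeP: tu => ->.
rewrite /atom (meanE rT lY) /avg mulrC mulfVK; last first.
  by rewrite pnatr_eq0 -lt0n (reps_size_gt0 rT).
rewrite rmorph_prod ordp_prod; last by move=> h _; rewrite !fmorph_eq0.
rewrite -(reps_sum_left rT s lY) big_mkcond; apply: eq_bigr => h _.
have -> : agree X h gid = (map (gcomp s h) X == map s X).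
  apply/eqP/eqP => /eq_in_map E; apply/eq_in_map => x Xx.
    by rewrite gcompE E.
  by apply: (fmorph_inj s); rewrite -gcompE E.
by case: ifP; rewrite ?mul1r ?mul0r.
Qed.

Lemma Cstar_PhiA Phi : Cstar Phi -> exists A, Phi = PhiA A.
Proof.
move=> [[dP /finite_index_open[F HF]] [_ [c [_ HPhi [P supp]]]]].
have [P0 hP Pu] := dP.
pose X := nclos F; have [T rT] := reps_exist X.
have HX (s : Gal) : agree X s gid -> in_Stab Phi s.
  by move=> sX; apply: HF; apply: agreeS sX; apply: nclos_sub.
pose l : list code := List.flat_map (fun p => List.map (fun t : Gal => (p, X, map t X)) T) P.
have [||||| |A HA] := @ghom_comb _ atom_of l (fun x => x != 0) Phi.
- by [].
- by move=> x y; apply: mulf_neq0.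
- by move=> x; rewrite invr_eq0.
- by move=> a; apply: atom_hom.
- by [].
- move=> z z0 Hz; pose Y := nclos (z :: X); have [U rU] := reps_exist Y.
  pose N := \prod_(h <- U | agree X h gid) h z.
  have N0 : N != 0.
    by rewrite /N; elim/big_rec: _ => [|h u _ u0]; rewrite ?oner_eq0 ?mulf_neq0 ?fmorph_eq0.
  have XY : {subset X <= Y} by move=> x Xx; apply: nclos_sub; rewrite inE Xx orbT.
  have Yz : z \in Y by apply: nclos_sub; rewrite inE eqxx.
  have : Phi N = 0.
    apply: (compactly_supported_eq0 HPhi supp N0) => p s p_pr pP.
    rewrite (norm_ord_atom _ _ XY Yz z0 rU); have [t tT /eqP ->] := reps_agree s rT.
    rewrite [atom _ _ _ _](Hz (p, X, map t X)) ?mulr0 //.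
    apply/List.in_flat_map; exists p; split; last by apply/List.in_map_iff; exists t.
    by elim: (P) pP => //= a Q IH; rewrite inE => /orP[/eqP->|/IH]; [left|right].
  rewrite /N (ghom_prod _ hP); last by move=> h _; rewrite fmorph_eq0.
  (* By invariance [Phi] takes the value [Phi z] at every factor of the norm, so [Phi N] is a
     positive multiple of it. *)
  rewrite (eq_bigr (fun=> Phi z)); last by move=> h hX; apply: HX.
  rewrite big_const_seq iter_addr_0 -[_ *+ _]mulr_natr => /eqP.
  rewrite mulf_eq0 pnatr_eq0 => /orP[/eqP//|]; rewrite -leqn0 leqNgt => /negP[].
  rewrite -has_count; have [t tU tX] := reps_agree gid rU.
  have : agree X t gid by rewrite agree_sym; apply: agreeS tX.
  by elim: (U) tU => //= a V IH [->->//|/IH H /H ->]; rewrite orbT.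
exists A; apply/funext => x; have [->|x0] := eqVneq x 0; last by rewrite HA.
by rewrite P0; case: (PhiA_Sdual A).
Qed.

Lemma approximation Phi (xs : seq algC) : Sdual Phi -> all (fun x => x != 0) xs ->
  exists A, forall x, x \in xs -> Phi x = PhiA A x.
Proof.
move=> [P0 hP Pu] /allP xs0.
have [N HN] : exists N, forall x, x \in xs -> forall p (s : Gal), prime p -> (N < p)%N ->
    ordp p (s x) = 0.
  elim: (xs) => [|a l [N HN]]; first by exists 0%N.
  have [M HM] := ord_support a; exists (maxn N M) => x.
  rewrite inE => /orP[/eqP->|/HN Hx] p s p_pr; rewrite gtn_max => /andP[lN lM].
    exact: HM.
  exact: Hx.
pose X := nclos xs; have [T rT] := reps_exist X.
(* Bounding the primes within [S] lets finitely many atoms detect the units in it. *)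
pose S z := [/\ z != 0, fixK X z & forall p (s : Gal), prime p -> (N < p)%N -> ordp p (s z) = 0].
have sfK := fixK_subfield X.
pose l : list code :=
  List.flat_map (fun p => List.map (fun t : Gal => (p, X, map t X)) T) (iota 0 N.+1).
have [||||| |A HA] := @ghom_comb _ atom_of l S Phi.
- by move=> x [].
- move=> x y [x0 Kx Hx] [y0 Ky Hy]; split; rewrite ?mulf_neq0 ?subMK // => p s p_pr ltN.
  by rewrite rmorphM ordpM ?fmorph_eq0 // Hx ?Hy.
- move=> x [x0 Kx Hx]; split; rewrite ?invr_eq0 ?subVK // => p s p_pr ltN.
  by rewrite fmorphV ordpV Hx ?oppr0.
- by move=> a; apply: atom_hom.
- by [].
- move=> z [z0 Kz Hz] Hl; apply: Pu; apply: Aunit_of_ord => // p s p_pr.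
  case: (ltnP N p) => [|leN]; first exact: Hz.
  apply: (atom_eq0_ord rT Kz) => t tT; apply: (Hl (p, X, map t X)).
  apply/List.in_flat_map; exists p; split; last by apply/List.in_map_iff; exists t.
  have : p \in iota 0 N.+1 by rewrite mem_iota ltnS.
  by elim: (iota 0 N.+1) => //= a Q IH; rewrite inE => /orP[/eqP->|/IH]; [left|right].
exists A => x xxs; apply: HA; split; [exact: xs0| |exact: HN].
by apply: fixK_mem; apply: nclos_sub.
Qed.

(** * Ramification index and residue degree *)

Lemma placeP (K : pred algC) p v : is_place_over K p v ->
  [/\ prime p, forall x, 0 <= v x, forall x, K x -> x != 0 -> 0 < v x,
    forall x y, K x -> K y -> v (x * y) = v x * v y &
    forall x y, K x -> K y -> v (x + y) <= Num.max (v x) (v y)].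
Proof.
move=> [p_pr vo vge v0 [vM vD vp]]; split=> // x Kx x0.
rewrite lt_neqAle vge andbT eq_sym; apply/eqP => e; case/eqP: x0.
by apply/(v0 x Kx).
Qed.

Section Residue.
Variables (K : pred algC) (p : nat) (v : algC -> RR).
Hypotheses (sfK : is_subfield K) (pv : is_place_over K p v).
Variable bound : nat.
Hypothesis dimK : forall z, all K z -> qfree z -> (size z <= bound)%N.

Let p_pr : prime p. Proof. by case: pv. Qed.
Let v_ge0 x : 0 <= v x. Proof. by case: (placeP pv). Qed.
Let v_gt0 x : K x -> x != 0 -> 0 < v x. Proof. by case: (placeP pv) => _ _ H _ _; apply: H. Qed.
Let vM x y : K x -> K y -> v (x * y) = v x * v y.
Proof. by case: (placeP pv) => _ _ _ H _; apply: H. Qed.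
Let vD x y : K x -> K y -> v (x + y) <= Num.max (v x) (v y).
Proof. by case: (placeP pv) => _ _ _ _; apply. Qed.
Let vN x : v (- x) = v x. Proof. exact: (absvN sfK pv). Qed.
Let vp : v p%:R < 1.
Proof. by case: pv => _ _ _ _ [_ _ ->]; rewrite invf_lt1 ?ltr0n ?ltr1n ?prime_gt1 ?prime_gt0. Qed.

Lemma absv_addl_lt x y B : K x -> K y -> v x < B -> v y < B -> v (x + y) < B.
Proof. by move=> Kx Ky vx vy; rewrite (le_lt_trans (vD Kx Ky)) // gt_max vx. Qed.

Lemma absv_subl_lt x y B : K x -> K y -> v x < B -> v y < B -> v (x - y) < B.
Proof. by move=> Kx Ky vx vy; apply: absv_addl_lt; rewrite ?vN // subNK. Qed.

Lemma absv_add_le x y B : K x -> K y -> v x <= B -> v y <= B -> v (x + y) <= B.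
Proof. by move=> Kx Ky vx vy; rewrite (le_trans (vD Kx Ky)) // ge_max vx. Qed.

Lemma absv_int (z : int) : v z%:~R <= 1.
Proof.
case: z => n; first exact: (absv_nat sfK pv).
by rewrite NegzE mulrNz vN (absv_nat sfK pv).
Qed.

Lemma absv_int_dvd (z : int) : (p %| z)%Z -> v z%:~R < 1.
Proof.
move=> /dvdzP[k ->]; rewrite intrM vM ?subintK // (le_lt_trans _ vp) //.
by rewrite ler_piMl // absv_int.
Qed.

Definition icomb f (a : nat -> int) (t : nat -> algC) : algC :=
  \sum_(i < f) (a i)%:~R * t i.

(** Linear independence over F_p of the residues of t, stated with integer coefficients. *)
Definition modfree f (t : nat -> algC) := forall a : nat -> int,
  v (icomb f a t) < 1 -> forall i, (i < f)%N -> (p %| a i)%Z.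

Definition integral f (t : nat -> algC) := forall i, (i < f)%N -> K (t i) /\ v (t i) <= 1.

Lemma icombK f a t : integral f t -> K (icomb f a t).
Proof.
by move=> It; apply: subsumK => // i _; apply: subMK; rewrite ?subintK //; case: (It i).
Qed.

Lemma icomb_le1 f a t : integral f t -> v (icomb f a t) <= 1.
Proof.
move=> It; suff: K (icomb f a t) /\ v (icomb f a t) <= 1 by case.
have v0 : v 0 = 0 by case: pv => _ _ _ H _; apply/(H 0 (sub0K sfK)).
apply: (big_rec (fun x => K x /\ v x <= 1)) => [|i x _ [Kx vx]].
  by rewrite sub0K // v0.
have [Ki vi] := It i (ltn_ord i); have Kai : K ((a i)%:~R * t i) by rewrite subMK ?subintK.
split; first exact: subDK.
by apply: absv_add_le => //; rewrite vM ?subintK // mulr_ile1 // absv_int.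
Qed.

(** Descent: all coefficients of an integral relation are divisible by p, and dividing them by p
    decreases the sum of absolute values unless all are zero. *)
Lemma modfree_int0 f t : modfree f t -> forall N (a : nat -> int),
  (\sum_(i < f) `|a i| <= N)%N -> icomb f a t = 0 -> forall i, (i < f)%N -> a i = 0.
Proof.
move=> fr; have v0 : v 0 = 0 by case: pv => _ _ _ H _; apply/(H 0 (sub0K sfK)).
elim=> [|N IH] a le E i lti.
  move: le; rewrite leqn0 sum_nat_eq0 => /forallP/(_ (Ordinal lti)) /=.
  by rewrite absz_eq0 => /eqP.
have dv j : (j < f)%N -> (p %| a j)%Z by move=> ltj; apply: fr ltj; rewrite E v0.
pose b j := (a j %/ p)%Z.
have Db j : (j < f)%N -> a j = b j * p by move=> /dv/divzK.
have Eb : icomb f b t = 0.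
  apply/eqP; rewrite -(mulrI_eq0 _ (lregP (_ : p%:R != 0))); last first.
    by rewrite pnatr_eq0 -lt0n prime_gt0.
  rewrite -[X in _ == X]E /icomb mulr_sumr; apply/eqP; apply: eq_bigr => j _.
  by rewrite (Db j) // intrM mulrA [_ * (b j)%:~R]mulrC.
case: (pselect (forall j, (j < f)%N -> a j = 0)) => [|nz]; first by apply.
suff H : b i = 0 by rewrite Db // H mul0r.
apply: (IH b) => //; rewrite -ltnS (leq_trans _ le) //.
have [j ltj aj] : exists2 j, (j < f)%N & a j != 0.
  apply: contrapT => H; apply: nz => j ltj; apply/eqP/negPn/negP => aj.
  by apply: H; exists j.
have lej k : (k < f)%N -> (`|b k| <= `|a k|)%N.
  by move=> ltk; rewrite (Db k) // abszM leq_pmulr // prime_gt0.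
rewrite (bigD1 (Ordinal ltj)) //= [X in (_ < X)%N](bigD1 (Ordinal ltj)) //= -addSn leq_add //.
  rewrite (Db j) // abszM ltn_Pmulr ?prime_gt1 // lt0n absz_eq0.
  by apply: contraNneq aj => bj; rewrite Db // bj mul0r.
by apply: leq_sum => k _; apply: lej.
Qed.

(** Clearing denominators reduces to integer relations. This bounds the residue degree by the
    dimension of K. *)
Lemma modfree_qfree f t : modfree f t -> qfree (mkseq t f).
Proof.
move=> fr q; rewrite size_mkseq => sz E i lti.
pose d := \prod_(j < f) denq (nth 0 q j).
have d0 : d != 0 by apply/prodf_neq0 => j _; apply: denq_neq0.
pose a (j : nat) : int := numq (d%:~R * nth 0 q j).
have Da j : (j < f)%N -> (a j)%:~R = d%:~R * nth 0 q j.
  move=> ltj; rewrite /a; have -> : d%:~R * nth 0 q j =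
      (numq (nth 0 q j) * \prod_(k < f | k != Ordinal ltj) denq (nth 0 q k))%:~R.
    rewrite /d (bigD1 (Ordinal ltj)) //= !intrM mulrAC [_ * nth 0 q j]mulrC.
    by rewrite -numqE.
  by rewrite numq_int.
have : a i = 0.
  apply: (modfree_int0 fr (leqnn _)) lti; rewrite /icomb.
  have := congr1 (fun x => d%:~R * x) E; rewrite /= mulr0 /rat_comb size_mkseq => E'.
  rewrite -[RHS]E' mulr_sumr; apply: eq_bigr => j _.
  rewrite nth_mkseq // mulrA; congr (_ * _).
  by rewrite -[LHS]ratr_int Da // rmorphM /= ratr_int.
move/(congr1 (fun z : int => z%:~R : rat)); rewrite Da // => /eqP.
by rewrite mulf_eq0 intr_eq0 (negbTE d0) => /eqP.
Qed.

(** Take a longest family with independent residues; its combinations with coefficients in 0, ..., p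
    - 1 represent the residue field once each, by independence and maximality. *)
Lemma res_degree_exists : exists f, is_res_degree K v f.
Proof.
pose P f := `[< exists2 t, integral f t & modfree f t >].
have Pex : exists f, P f by exists 0%N; apply/asboolP; exists (fun=> 0).
have Pub f : P f -> (f <= bound)%N.
  move=> /asboolP[t It fr]; rewrite -(size_mkseq t f); apply: dimK.
    by apply/allP => x /mapP[i]; rewrite mem_iota add0n => /andP[_ lti] ->; case: (It i).
  exact: modfree_qfree.
case: (ex_maxnP Pex Pub) => f /asboolP[t It fr] max; exists f.
have v0 : v 0 = 0 by case: pv => _ _ _ H _; apply/(H 0 (sub0K sfK)).
pose F (a : {ffun 'I_f -> 'I_p}) : algC := \sum_(i < f) (a i)%:R * t i.
have FE a : F a = icomb f (fun i => if insub i is Some j then (a j : int) else 0) t.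
  by apply: eq_bigr => i _; rewrite valK.
pose s := [seq F a | a <- enum {ffun 'I_f -> 'I_p}].
have szs : size s = (p ^ f)%N by rewrite size_map -cardE card_ffun !card_ord.
have pbE := prime_belowE sfK pv.
exists s; split; rewrite ?pbE //.
- by apply/allP => x /mapP[a _ ->]; rewrite FE; apply: icombK.
- by apply/allP => x /mapP[a _ ->]; rewrite FE; apply: icomb_le1.
- move=> i j; rewrite szs => lti ltj ij; pose a0 : {ffun 'I_f -> 'I_p} := [ffun _ => Ordinal (prime_gt0 p_pr)].
  have sz : #|{: {ffun 'I_f -> 'I_p}}| = (p ^ f)%N by rewrite card_ffun !card_ord.
  pose E := enum {ffun 'I_f -> 'I_p}.
  have szE : size E = (p ^ f)%N by rewrite -cardE.
  have nthE k : (k < p ^ f)%N -> nth 0 s k = F (nth a0 E k).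
    by move=> ltk; rewrite /s (nth_map a0) // szE.
  rewrite !nthE //; set a := nth _ _ i; set b := nth _ _ j.
  have ab : a != b by rewrite nth_uniq ?enum_uniq ?szE.
  have -> : F a - F b = icomb f (fun i => if insub i is Some j then (a j : int) - (b j : int) else 0) t.
    by rewrite /F -sumrB; apply: eq_bigr => k _; rewrite valK intrB mulrBl.
  apply/eqP; rewrite eq_le icomb_le1 //= leNgt; apply/negP => lt; case/negP: ab.
  apply/eqP/ffunP => k; have := fr _ lt k (ltn_ord k); rewrite valK => dv.
  apply: val_inj => /=; move: dv; rewrite -eqz_mod_dvd => /eqP.
  by rewrite !modz_nat => -[]; rewrite !modn_small.
move=> x Kx vx; pose t' i := if i is j.+1 then t j else x.
have It' : integral f.+1 t' by case=> //= i; apply: It.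
have nfr : ~ modfree f.+1 t'.
  move=> fr'; have := max f.+1; rewrite ltnn => H; suff: false by [].
  by apply: H; apply/asboolP; exists t'.
have [a [va [i lti ai]]] : exists a, v (icomb f.+1 a t') < 1 /\
    exists2 i, (i < f.+1)%N & ~~ (p %| a i)%Z.
  apply: contrapT => H; apply: nfr => a va i lti; apply/negPn/negP => ai.
  by apply: H; exists a; split=> //; exists i.
have Ea : icomb f.+1 a t' = (a 0%N)%:~R * x + icomb f (fun i => a i.+1) t.
  by rewrite /icomb big_ord_recl.
have Kc (c : nat -> int) : K (icomb f c t) by apply: icombK.
(* If p divided the coefficient of x, the relation would restrict to one among the t, with all
   coefficients divisible by p. *)
have na0 : ~~ (p %| a 0%N)%Z.
  apply/negP => dv0; have va0 : v ((a 0%N)%:~R * x) < 1.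
    by rewrite vM ?subintK // (le_lt_trans _ (absv_int_dvd dv0)) // ler_piMr.
  have : v (icomb f (fun i => a i.+1) t) < 1.
    have -> : icomb f (fun i => a i.+1) t = icomb f.+1 a t' - (a 0%N)%:~R * x.
      by rewrite Ea addrC addKr.
    by apply: absv_subl_lt; rewrite ?subMK ?subintK // Ea subDK ?subMK ?subintK.
  move/fr => H; case: i lti ai => [|i] lti; first by rewrite dv0.
  by rewrite (H i).
have cop : coprimez (a 0%N) p by rewrite coprimez_sym /coprimez /gcdz /= eqz_nat -/(coprime _ _) prime_coprime.
have [u [w E1]] := Bezoutz (a 0%N) p; rewrite (eqP cop) in E1.
(* [u] inverts the coefficient of x modulo p, so these are the digits of x in the residue field. *)
pose r (i : nat) : int := ((- (u * a i.+1)) %% p)%Z.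
have r_ge0 j : 0 <= r j by rewrite modz_ge0 // eqz_nat -lt0n prime_gt0.
have r_lt j : (`|r j| < p)%N.
  by rewrite -ltz_nat gez0_abs // ltz_pmod // ltz_nat prime_gt0.
pose c : {ffun 'I_f -> 'I_p} := [ffun i : 'I_f => Ordinal (r_lt i)].
have Fc : F c = icomb f r t.
  apply: eq_bigr => j _; rewrite ffunE /=; congr (_ * _).
  by rewrite -[LHS]/((`|r j|%N : int)%:~R) gez0_abs.
exists (index (F c) s).
  by rewrite index_mem; apply: map_f; rewrite mem_enum.
rewrite nth_index; last by apply: map_f; rewrite mem_enum.
rewrite Fc.
have -> : x - icomb f r t = u%:~R * icomb f.+1 a t' + (w%:~R * p%:R) * x
    + icomb f (fun i => ((- (u * a i.+1)) %/ p)%Z * p) t.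
  rewrite Ea; have -> : icomb f (fun i => ((- (u * a i.+1)) %/ p)%Z * p) t =
      - (u%:~R * icomb f (fun i => a i.+1) t) - icomb f r t.
    rewrite /icomb mulr_sumr -sumrN -sumrB; apply: eq_bigr => j _.
    have -> : ((- (u * a j.+1)) %/ p)%Z * p = - (u * a j.+1) - r j.
      by rewrite {2}(divz_eq (- (u * a j.+1)) p) addrK.
    by rewrite intrB mulrNz intrM; ring.
  set z := icomb f r t; set y := icomb f _ t; set k := u%:~R; set l := w%:~R.
  have e1 : (k * (a 0%N)%:~R + l * p%:R) = 1.
    have -> : p%:R = (p : int)%:~R :> algC by [].
    by rewrite -!intrM -intrD E1.
  have -> : x - z = (k * (a 0%N)%:~R + l * p%:R) * x - z by rewrite e1 mul1r.
  by ring.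
have KF : K (icomb f.+1 a t') by apply: icombK.
have Kw : K (w%:~R * p%:R) by rewrite subMK ?subintK ?subnatK.
apply: absv_addl_lt; rewrite ?Kc //.
- by rewrite subDK // subMK ?subintK.
- have Ku : K (u%:~R * icomb f.+1 a t') by rewrite subMK ?subintK.
  have Kwx : K (w%:~R * p%:R * x) by rewrite subMK.
  apply: absv_addl_lt => //.
    by rewrite vM ?subintK // (le_lt_trans _ va) // ler_piMl // absv_int.
  rewrite !vM ?subintK ?subnatK // (le_lt_trans _ vp) //.
  by rewrite (le_trans (ler_piMr _ vx)) ?mulr_ge0 // ler_piMl // absv_int.
apply: (absv_sum_lt sfK pv) => // j _; have [Kj vj] := It j (ltn_ord j).
rewrite subMK ?subintK //; split=> //; rewrite vM ?subintK //.
rewrite (le_lt_trans (ler_piMr _ vj)) // absv_int_dvd //.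
by apply/dvdzP; exists ((- (u * a j.+1)) %/ p)%Z.
Qed.
End Residue.

(** With n the number of embeddings, 1, x, ..., x^n are dependent, so x has a denominator at most n
    by the bound in terms of the degree, and this divides n!. *)
Lemma ord_denominator Y : exists2 D, (0 < D)%N & forall p (s : Gal) x, prime p ->
  fixK Y x -> x != 0 -> exists z : int, D%:R * ordp p (s x) = z%:~R.
Proof.
have [T rT] := reps_exist Y; set n := size T.
exists n`!; first exact: fact_gt0.
move=> p s x p_pr Kx x0; have sfK := fixK_subfield Y.
pose pw := mkseq (fun i => x ^+ i) n.+1.
have Kpw : all (fixK Y) pw.
  by apply/allP => y /mapP[i _ ->]; apply: subXK.
have [q [szq E [i lti qi]]] : exists q : seq rat, [/\ size q = n.+1, rat_comb q pw = 0 &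
    exists2 i, (i < n.+1)%N & nth 0 q i != 0].
  apply: contrapT => H; have : qfree pw.
    move=> q; rewrite size_mkseq => szq E i lti; apply/eqP/negPn/negP => qi.
    by apply: H; exists q; split=> //; exists i.
  by move/(fixK_dependent rT Kpw); rewrite size_mkseq ltnn.
pose P := Poly q; have P0 : P != 0.
  by apply: contraNneq qi => P0; rewrite -coef_Poly -/P P0 coef0.
have szP : (size P <= n.+1)%N by rewrite -szq size_Poly.
have rP : root (map_poly ratr P) (s x).
  have : root (map_poly ratr P) x.
    apply/rootP; rewrite (@horner_coef_wide _ n.+1) ?size_map_poly // -[RHS]E /rat_comb.
    rewrite size_mkseq; apply: eq_bigr => j _.
    by rewrite coef_map coef_Poly nth_mkseq.
  move/(rmorph_root s); rewrite -map_poly_comp.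
  by rewrite (eq_map_poly (g := ratr)) // => a; rewrite /= fmorph_rat.
have [_ _ _ _ H] := ordpP p_pr.
have sx0 : s x != 0 by rewrite fmorph_eq0.
have [k [m [/andP[k0 ltk] Ek]]] := H _ _ sx0 P0 rP.
have /dvdnP[d Dd] : (k %| n`!)%N.
  by rewrite dvdn_fact // k0 -ltnS (leq_trans ltk).
exists (d%:Z * m); rewrite Dd natrM -mulrA Ek intrM //.
Qed.

Lemma choose_natP (P : nat -> Prop) : (exists n, P n) -> P (choose_nat P).
Proof. exact: ClassicalEpsilon.epsilon_spec. Qed.

(** Values on K have the common denominator D, so there is a least positive one. Euclidean division
    shows that it generates all values, and e is read off from ord p = 1. *)
Lemma ram_index_exists Y p (s : Gal) : prime p ->
  exists e, is_ram_index (fixK Y) (place p s (fixK Y)) e.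
Proof.
move=> p_pr; set K := fixK Y; set v := place p s K.
have sfK : is_subfield K := fixK_subfield Y.
have pv : is_place_over K p v by apply: place_is_place.
have [D D0 HD] := ord_denominator Y.
have DR0 : 0 < D%:R :> rat by rewrite ltr0n.
pose P m := (0 < m)%N && `[< exists x, [/\ K x, x != 0 & D%:R * ordp p (s x) = m%:R] >].
have pC0 : p%:R != 0 :> algC by rewrite pnatr_eq0 -lt0n prime_gt0.
have Pex : exists m, P m.
  exists D; rewrite /P D0; apply/asboolP; exists p%:R.
  by rewrite subnatK // rmorph_nat ordp_p // mulr1.
case: (ex_minnP Pex) => m /andP[m0 /asboolP[pi [Kpi pi0 Epi]]] min.
have op : 0 < ordp p (s pi) by rewrite -(pmulr_rgt0 _ DR0) Epi ltr0n.
have mult x : K x -> x != 0 -> exists a : int, ordp p (s x) = a%:~R * ordp p (s pi).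
  move=> Kx x0; have [z Ez] := HD p s x p_pr Kx x0.
  exists (z %/ m)%Z; pose a := (z %/ m)%Z.
  have Kpa : K (pi ^ (- a)).
    by case: (- a) => k; [apply: subXK|rewrite NegzE -exprnN; apply/subVK/subXK].
  have spi0 : s pi != 0 by rewrite fmorph_eq0.
  have oXz (b : int) : ordp p (s pi ^ b) = b%:~R * ordp p (s pi).
    case: b => k; first by rewrite -exprnP ordpX.
    by rewrite NegzE -exprnN ordpV ordpX mulrNz mulNr.
  have Er : D%:R * ordp p (s (x * pi ^ (- a))) = (z %% m)%Z%:~R.
    rewrite rmorphM rmorphXz ?unitfE // ordpM ?fmorph_eq0 ?expfz_neq0 // oXz mulrDr Ez.
    rewrite mulrCA Epi /modz intrB intrM mulrNz mulNr //.
  have r_ge0 : 0 <= (z %% m)%Z by rewrite modz_ge0 // eqz_nat -lt0n.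
  have r_lt : (`|(z %% m)%Z| < m)%N by rewrite -ltz_nat gez0_abs // ltz_pmod // ltz_nat.
  have r0 : (z %% m)%Z = 0.
    apply/eqP; rewrite -absz_eq0 -leqn0 leqNgt; apply/negP => r_gt0.
    have := min `|(z %% m)%Z|%N; rewrite leqNgt r_lt => H; suff: false by [].
    apply: H; rewrite /P r_gt0; apply/asboolP; exists (x * pi ^ (- a)); split.
    - exact: subMK.
    - by rewrite mulf_neq0 ?expfz_neq0.
    by rewrite Er -{1}(gez0_abs r_ge0).
  move: Er; rewrite r0 => /eqP; rewrite mulf_eq0 gt_eqF //= rmorphM rmorphXz ?unitfE //.
  rewrite ordpM ?fmorph_eq0 ?expfz_neq0 // oXz mulrNz mulNr subr_eq0 => /eqP.
  by [].
have [a Ea] := mult _ (subnatK sfK p) pC0; rewrite rmorph_nat ordp_p // in Ea.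
have a0 : 0 < a by rewrite -(ltr0z rat) -(pmulr_lgt0 _ op) -Ea.
case: a a0 Ea => // e e0 Ee; exists e; split=> //; exists pi; split=> //.
  rewrite (prime_belowE sfK pv) /v placeE // wabsE ?fmorph_eq0 // -pexp_nat -pexp1 //.
  by congr pexp; rewrite [RHS]Ee.
move=> x Kx x0; have [k Ek] := mult x Kx x0; exists k.
rewrite /v !placeE // !wabsE ?fmorph_eq0 // Ek; case: k {Ek} => k; first by rewrite pexp_nat.
by rewrite NegzE mulrNz mulNr pexpN pexp_nat exprnN.
Qed.

(** * The inequality [n <= e f g] *)

Section Digits.
Variables (K : pred algC) (p : nat) (v : algC -> RR).
Hypotheses (sfK : is_subfield K) (pv : is_place_over K p v).
Variables (pi : algC) (S : seq algC).
Hypotheses (Kpi : K pi) (pi0 : pi != 0) (vpi : forall x, K x -> v x < 1 -> v x <= v pi).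
Hypotheses (KS : all K S)
  (covS : forall x, K x -> v x <= 1 -> exists2 i, (i < size S)%N & v (x - nth 0 S i) < 1).

Let vM x y : K x -> K y -> v (x * y) = v x * v y.
Proof. by case: (placeP pv) => _ _ _ H _; apply: H. Qed.
Let vpi0 : 0 < v pi. Proof. by case: (placeP pv) => _ _ H _ _; apply: H. Qed.

(** Expansion in powers of pi: the first digit is a residue representative, and the others are those
    of the remainder divided by pi. *)
Lemma digits N : exists (D : finType) (phi : algC -> D), #|D| = (size S ^ N)%N /\
  forall x y, K x -> K y -> v x <= 1 -> v y <= 1 -> phi x = phi y -> v (x - y) <= v pi ^+ N.
Proof.
elim: N => [|N [D [phi [cD Hphi]]]].
  exists unit, (fun=> tt); split=> [|x y Kx Ky vx vy _]; first by rewrite card_unit.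
  by rewrite expr0; apply: (absv_add_le pv); rewrite ?(absvN sfK pv) ?subNK.
have v0 : v 0 <= 1 by case: pv => _ _ _ H _; rewrite (_ : v 0 = 0) //; apply/(H 0 (sub0K sfK)).
have [i0 lt0 _] := covS (sub0K sfK) v0.
pose r x : 'I_(size S) :=
  if pselect (exists i : 'I_(size S), v (x - nth 0 S i) < 1) is left e
  then projT1 (cid e) else Ordinal lt0.
have rP x : K x -> v x <= 1 -> v (x - nth 0 S (r x)) < 1.
  move=> Kx vx; rewrite /r; case: pselect => [e|ne]; first by case: (cid e).
  by have [i lti H] := covS Kx vx; case: ne; exists (Ordinal lti).
exists ('I_(size S) * D)%type, (fun x => (r x, phi ((x - nth 0 S (r x)) / pi))).
split; first by rewrite card_prod card_ord cD expnS.
move=> x y Kx Ky vx vy [/(congr1 val) /= Er Ephi].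
have Kn i : (i < size S)%N -> K (nth 0 S i) by move=> lti; apply: (allP KS); apply: mem_nth.
have aux z : K z -> v z <= 1 -> K ((z - nth 0 S (r z)) / pi) /\ v ((z - nth 0 S (r z)) / pi) <= 1.
  move=> Kz vz; have Kd : K (z - nth 0 S (r z)) by apply: subBK => //; apply: Kn.
  split; first by apply: subMK => //; apply: subVK.
  rewrite vM ?subVK // (absvV sfK pv) // ler_pdivrMr // mul1r.
  by apply: vpi => //; apply: rP.
have [Kx' vx'] := aux x Kx vx; have [Ky' vy'] := aux y Ky vy.
have := Hphi _ _ Kx' Ky' vx' vy' Ephi.
have -> : (x - nth 0 S (r x)) / pi - (y - nth 0 S (r y)) / pi = (x - y) / pi.
  by rewrite Er; ring.
rewrite vM ?subVK ?subBK // (absvV sfK pv) // ler_pdivrMr //.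
by rewrite exprSr.
Qed.
End Digits.

Lemma ord_lower_bound p (l : seq algC) : exists k : nat, forall x, x \in l -> ord_ge p (- k%:R) x.
Proof.
elim: l => [|x l [k Hk]]; first by exists 0%N.
pose m := Num.bound `|ordp p x|; exists (maxn k m) => y.
rewrite inE => /orP[/eqP->|/Hk]; last first.
  by apply: ord_geW; rewrite lerN2 ler_nat leq_maxl.
apply: (@ord_geW _ (ordp p x)); last exact: ord_ge_ord.
rewrite lerNl (le_trans (ler_norm _)) // normrN.
rewrite (le_trans (ltW (archi_boundP (normr_ge0 _)))) //.
by rewrite ler_nat leq_maxr.
Qed.

Lemma rat_comb_mulr q b z :
  rat_comb q b * z = \sum_(i < size b) ratr (nth 0 q i) * (nth 0 b i * z).
Proof. by rewrite /rat_comb mulr_suml; apply: eq_bigr => i _; rewrite mulrA. Qed.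

(* The trace form identifies coordinates with traces, which are bounded by all
   the conjugates. *)
Lemma coords_bounded Y b p : prime p -> is_Qbasis (fixK Y) b -> exists C : nat,
  forall q (m : rat), size q = size b ->
    (forall t : Gal, ord_ge p m (t (rat_comb q b))) ->
    forall i, (i < size b)%N -> ord_ge p (m - C%:R) (ratr (nth 0 q i)).
Proof.
move=> p_pr [Kb spanb freeb]; set K := fixK Y; have sfK : is_subfield K := fixK_subfield Y.
have [T rT] := reps_exist Y; set n := size b.
pose tr x : algC := \sum_(t <- T) t x.
have trQ x : K x -> tr x \in Crat.
  move=> Kx; apply: gal_fixed_Crat => s; rewrite /tr rmorph_sum.
  apply: (reps_sum_left rT (F := fun t : Gal => t x)) => t u tu.
  exact: fixK_agree tu Kx.
have Kbi i : (i < n)%N -> K (nth 0 b i) by move=> lti; apply: (allP Kb); apply: mem_nth.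
have trE q z : tr (rat_comb q b * z) = \sum_(i < n) ratr (nth 0 q i) * tr (nth 0 b i * z).
  rewrite rat_comb_mulr /tr.
  under eq_bigr => t _ do rewrite rmorph_sum.
  rewrite exchange_big; apply: eq_bigr => i _; rewrite mulr_sumr.
  by apply: eq_bigr => t _; rewrite rmorphM /= fmorph_rat.
pose Q : 'M[rat]_n := \matrix_(i, j) getCrat (tr (nth 0 b i * nth 0 b j)).
have QE (i j : 'I_n) : ratr (Q i j) = tr (nth 0 b i * nth 0 b j).
  by rewrite mxE; apply: getCratK; apply: trQ; apply: subMK => //; apply: Kbi.
have rowE q (j : 'I_n) : size q = n ->
    ratr (((\row_(i < n) nth 0 q i) *m Q) 0 j) = tr (rat_comb q b * nth 0 b j).
  move=> szq; rewrite trE mxE rmorph_sum; apply: eq_bigr => i _.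
  by rewrite rmorphM /= QE mxE.
(* A y in the radical of the trace form would, if nonzero, give tr(y / y) = 0, while the trace of 1
   is the size of [T]. *)
have Qu : Q \in unitmx.
  rewrite -row_free_unit -kermx_eq0; apply/rowV0P => u /sub_kermxP uQ.
  pose q := [seq u 0 i | i <- enum 'I_n].
  have szq : size q = n by rewrite size_map -cardE card_ord.
  have uE : u = \row_(i < n) nth 0 q i.
    by apply/rowP => i; rewrite mxE (nth_map i) -?cardE ?card_ord // nth_ord_enum.
  pose y := rat_comb q b.
  have Ky : K y by apply: subsumK => // i _; apply: subMK; rewrite ?subratK ?Kbi.
  have try z : K z -> tr (y * z) = 0.
    move=> /spanb[q' ->]; rewrite mulrC trE big1 // => j _.
    by rewrite mulrC [_ * y]mulrC -(rowE q j szq) -uE uQ mxE rmorph0 mul0r.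
  have y0 : y = 0.
    apply/eqP/negPn/negP => y0; have := try _ (subVK sfK Ky); rewrite mulfV // /tr.
    under eq_bigr do rewrite rmorph1.
    rewrite big_const_seq count_predT iter_addr_0 => /eqP.
    by rewrite pnatr_eq0 -leqn0 leqNgt (reps_size_gt0 rT).
  by rewrite uE; apply/rowP => i; rewrite !mxE; apply: freeb y0 _ _.
(* [k1] bounds the poles of the conjugates of the basis, [k2] those of the inverse Gram matrix;
   together they give C. *)
have [k1 Hk1] := ord_lower_bound p (nclos b).
have [k2 Hk2] := ord_lower_bound p [seq ratr (invmx Q ij.1 ij.2) | ij <- enum {: 'I_n * 'I_n}].
exists (k1 + k2)%N => q m szq Hm i lti.
have -> : nth 0 q i = ((\row_(i < n) nth 0 q i) *m Q *m invmx Q) 0 (Ordinal lti).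
  by rewrite mulmxK // mxE.
rewrite mxE rmorph_sum; apply: ord_ge_sum => // j _; rewrite rmorphM /= rowE //.
rewrite natrD opprD addrA; apply: ord_geM; last first.
  by apply: Hk2; apply/mapP; exists (j, Ordinal lti); rewrite ?mem_enum.
apply: ord_ge_sum => // t _; rewrite rmorphM; apply: ord_geM; first exact: Hm.
by apply: Hk1; apply: nclos_stable; apply: nclos_sub; apply: mem_nth.
Qed.

(** Pigeonhole on the numbers p^k (sum of a_i b_i) with 0 <= a_i < p^M, of which there are p^(M n)
    choices. As v(pi)^e = 1/p, [e * m] digits of the image under each element of [gs] fix it up to
    valuation m, and there are p^(f e m g) digit systems. Equal digits give a difference of
    valuation at least m at all conjugates, so its coordinates have valuation at least M + k and the
    a_i agree. *)
Lemma degree_le_efg Y p (s0 : Gal) e f (gs : seq Gal) b : gstable Y -> prime p ->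
  let K := fixK Y in let v := place p s0 K in
  is_ram_index K v e -> is_res_degree K v f ->
  (forall t : Gal, exists2 s, List.In s gs & place p t K = place p (gcomp s0 s) K) ->
  is_Qbasis K b -> (size b <= e * f * size gs)%N.
Proof.
move=> sY p_pr K v [e0 [pi [Kpi pi0 pie pik]]] [S [szS KS _ _ covS]] Hgs bb.
have sfK : is_subfield K := fixK_subfield Y.
have pv : is_place_over K p v by apply: place_is_place.
rewrite (prime_belowE sfK pv) in pie szS.
set g := size gs; set n := size b.
have [_ v_ge0 v_gt0 vM vD] := placeP pv.
have vpi_gt0 : 0 < v pi by apply: v_gt0.
have vpi1 : v pi < 1.
  rewrite ltNge; apply/negP => ge1; have : 1 <= v pi ^+ e by apply: exprn_ege1.
  by rewrite pie invf_ge1 ?ltr0n ?prime_gt0 // lern1 leqNgt prime_gt1.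
have vpi x : K x -> v x < 1 -> v x <= v pi.
  move=> Kx; have [->|x0] := eqVneq x 0.
    by rewrite (_ : v 0 = 0) ?v_ge0 //; case: pv => _ _ _ H _; apply/(H 0 (sub0K sfK)).
  have [[[|k]|k] ->] := pik x Kx x0; rewrite ?expr0z ?ltxx //.
    move=> _; rewrite -exprnP exprS ler_piMr ?v_ge0 // exprn_ile1 ?v_ge0 //.
    exact: ltW.
  rewrite NegzE -exprnN ltNge => /negP[]; rewrite invf_ge1 ?exprn_gt0 //.
  by apply: exprn_ile1; rewrite ?v_ge0 ?ltW.
have [C HC] := coords_bounded p_pr bb.
have [k Hk] := ord_lower_bound p (nclos b).
have [Kb _ freeb] := bb.
(* [C] is the loss in passing from conjugates to coordinates, and p^k makes the conjugates of the
   basis integral. *)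
pose C' := (C + k)%N.
have main M : (M * n <= e * f * g * (M + C'))%N.
  pose m := (M + C')%N.
  have [D [phi [cD Hphi]]] := digits sfK pv Kpi pi0 vpi KS covS (e * m)%N.
  pose q (a : {ffun 'I_n -> 'I_(p ^ M)}) : seq rat :=
    [seq (nat_of_ord (a i))%:R * p%:R ^+ k | i <- enum 'I_n].
  have szq a : size (q a) = n by rewrite size_map -cardE card_ord.
  have qE a (i : 'I_n) : nth 0 (q a) i = (a i)%:R * p%:R ^+ k.
    by rewrite (nth_map i) -?cardE ?card_ord // nth_ord_enum.
  pose x a := rat_comb (q a) b.
  have Kx a : K (x a).
    apply: subsumK => // i _; apply: subMK; rewrite ?subratK //.
    by apply: (allP Kb); apply: mem_nth.
  have Ox a (t : Gal) : ord_ge p 0 (t (x a)).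
    rewrite /x gal_rat_comb; apply: ord_ge_sum => // i _; rewrite size_map in i *.
    rewrite qE (nth_map 0) // rmorphM rmorphXn /= !ratr_nat -mulrA -[0]addr0.
    apply: ord_geM; first exact: ord_ge_nat.
    rewrite -[0](subrr k%:R); apply: ord_geM.
      have -> : k%:R = ordp p (p%:R ^+ k) by rewrite ordpX ordp_p // mulr1.
      exact: ord_ge_ord.
    by apply: Hk; apply: nclos_stable; apply: nclos_sub; apply: mem_nth.
  have vx a (t : Gal) : v (t (x a)) <= 1.
    rewrite /v placeE; last exact: fixK_stable.
    by rewrite -(pexp0 p) wabs_le // -gcompE Ox.
  pose Psi a : {ffun 'I_g -> D} := [ffun j : 'I_g => phi ((nth gid gs j) (x a))].
  suff inj : injective Psi.
    have := leq_card Psi inj; rewrite !card_ffun !card_ord cD szS -!expnM.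
    rewrite leq_exp2l ?prime_gt1 // => le; rewrite (leq_trans le) //.
    by rewrite /m; apply: eq_leq; ring.
  move=> a a' E.
  have Hd (t : Gal) : ord_ge p m%:R (t (x a - x a')).
    have [s sgs Es] := Hgs t; have Kd : K (x a - x a') by apply: subBK.
    have [j Dj] : exists j : 'I_g, nth gid gs j = s.
      have [j [jn Dj]] := List.In_nth gs s gid sgs.
      move/ssrnat.ltP: jn => jn; exists (Ordinal jn) => /=; rewrite -[RHS]Dj.
      by elim: (gs) (j) => [|? ? IH] [|?] //=.
    have /ffunP/(_ j) := E; rewrite !ffunE Dj => Ej.
    have := Hphi _ _ (fixK_stable s sY (Kx a)) (fixK_stable s sY (Kx a')) (vx a s) (vx a' s) Ej.
    rewrite exprM pie -pexp1 // -pexp_nat mulr1 -rmorphB.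
    have := congr1 (fun w => w (x a - x a')) Es; rewrite !placeE // gcompE => Ew.
    rewrite /v placeE; last exact: fixK_stable.
    by rewrite -Ew wabs_le.
  pose qd := [seq nth 0 (q a) i - nth 0 (q a') i | i : 'I_n <- enum 'I_n].
  have szd : size qd = n by rewrite size_map -cardE card_ord.
  have qdE (i : 'I_n) : nth 0 qd i = ((a i)%:R - (a' i)%:R) * p%:R ^+ k.
    by rewrite (nth_map i) -?cardE ?card_ord // nth_ord_enum !qE mulrBl.
  have xd : x a - x a' = rat_comb qd b.
    rewrite /x /rat_comb -sumrB; apply: eq_bigr => i _.
    by rewrite qdE !qE -mulrBl -rmorphB -mulrBl.
  apply/ffunP => i; have := HC qd m%:R szd; rewrite -xd => /(_ Hd i (ltn_ord i)).
  rewrite qdE rmorphM rmorphXn rmorphB /= !ratr_nat => Hi; apply: val_inj => /=.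
  apply/eqP/negPn/negP => ne.
  have z0 : (a i : int) - (a' i : int) != 0 by rewrite subr_eq0.
  move: Hi; have -> : (a i)%:R - (a' i)%:R = ((a i : int) - (a' i : int))%:~R :> algC.
    by rewrite intrB.
  have pC0 : p%:R != 0 :> algC by rewrite pnatr_eq0 -lt0n prime_gt0.
  rewrite ord_geE ?mulf_neq0 ?expf_neq0 ?intr_eq0 // ordpM ?expf_neq0 ?intr_eq0 //.
  rewrite ordpX ordp_p // mulr1 ordp_int // /m /C' !natrD.
  have -> : M%:R + (C%:R + k%:R) - C%:R = M%:R + k%:R :> rat by ring.
  rewrite lerD2r ler_nat => leM.
  have : (p ^ M %| `|(a i : int) - (a' i : int)|)%N.
    by apply: dvdn_trans (pfactor_dvdnn p _); apply: dvdn_exp2l.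
  move/dvdn_leq; rewrite absz_gt0 z0 => /(_ isT); apply/negP; rewrite -ltnNge.
  have := ltn_ord (a i); have := ltn_ord (a' i); move: (a i : nat) (a' i : nat) => u w.
  case: (leqP u w) => [le|/ltnW le] lw lu.
    by rewrite -opprB abszN subzn // absz_nat (leq_ltn_trans (leq_subr _ _)).
  by rewrite subzn // absz_nat (leq_ltn_trans (leq_subr _ _)).
(* For G = e f g and M = G C' + 1, one has G (M + C') < (G + 1) M, which excludes n > G. *)
rewrite leqNgt; apply/negP => lt.
have := main (e * f * g * C').+1; set G := (e * f * g)%N in lt *.
apply/negP; rewrite -ltnNge.
have : ((G * C').+1 * G.+1 <= (G * C').+1 * n)%N by rewrite leq_mul2l lt orbT.
by apply: leq_trans; set A := (G * C').+1; rewrite mulnDr -addnS -/A [(A * _)%N]mulnS mulnC addnC.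
Qed.

(** K is normal, so right translation carries any place over p to any other: the g places have equal
    means 1/g, and n <= e f g becomes n / g <= e f. *)
Lemma mean_place_bound Y p (s0 : Gal) : gstable Y -> prime p ->
  mean (fun t => (`[< place p t (fixK Y) = place p s0 (fixK Y) >])%:R) * (degQ (fixK Y))%:R
    <= (local_degree (fixK Y) (place p s0 (fixK Y)))%:R.
Proof.
set K := fixK Y; set v := place p s0 K => sY p_pr; have nfK : number_field K := fixK_number_field Y; have [sfK _] := nfK.
have pv : is_place_over K p v by apply: place_is_place.
have ram : is_ram_index K v (choose_nat (is_ram_index K v)).
  by apply: choose_natP; apply: ram_index_exists.
have [T rT] := reps_exist Y.
have res : is_res_degree K v (choose_nat (is_res_degree K v)).
  apply: choose_natP; apply: (res_degree_exists sfK pv (bound := size T)) => z.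
  exact: fixK_dependent.
have [b [bb szb]] : exists b, is_Qbasis K b /\ size b = degQ K.
  apply: (choose_natP (P := fun n => exists s, is_Qbasis K s /\ size s = n)).
  by case: nfK => _ [b bb]; exists (size b), b.
have [l Hl] := places_over_list p nfK.
have [vs [nd Hvs]] := nodup_comprehension Hl.
(* Composed with [s0], the automorphism [f v'] induces the place v'. *)
pose f (v' : algC -> RR) : Gal := if pselect (exists t, place p t K = v') is left ex
  then gcomp (ginv s0) (projT1 (cid ex)) else gid.
have lt (v' : algC -> RR) : flevel (fun t => (`[< place p t K = v' >])%:R : rat).
  exact: (flevel_app (fun w => (`[< w = v' >])%:R) (flevel_place p nfK)).
have pl_right (a c u : Gal) :
    place p a K = place p c K -> place p (gcomp a u) K = place p (gcomp c u) K.
  move=> E; apply/funext => x; rewrite /place; case: ifP => // Kx; rewrite !gcompE.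
  have Kux : K (u x) by apply: fixK_stable.
  by move/(congr1 (fun w => w (u x))): E; rewrite !placeE.
have plE (a c : Gal) : a =1 c -> place p a K = place p c K.
  by move=> ac; apply/funext => x; rewrite /place ac.
have Hf (t : Gal) : exists2 s, List.In s (map f vs) & place p t K = place p (gcomp s0 s) K.
  exists (f (place p t K)).
    by apply: List.in_map; apply/Hvs; apply: place_is_place.
  rewrite /f; case: pselect => [ex|nex]; last by case: nex; exists t.
  by case: (cid ex) => t' /= <-; apply: plE => x; rewrite !gcompE ginvKV.
have le := degree_le_efg sY p_pr ram res Hf bb.
rewrite size_map szb in le.
pose q (v' : algC -> RR) := mean (fun t => (`[< place p t K = v' >])%:R).
have qE v' : List.In v' vs -> q v' = q v.
  move=> /Hvs/(place_transitive nfK)[t' Dv'].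
  rewrite /q -(mean_right (gcomp (ginv s0) t')) //; apply: eq_mean => t.
  congr (_%:R); congr nat_of_bool; rewrite Dv'; apply/asboolP/asboolP => E.
    have := pl_right _ _ (gcomp (ginv t') s0) E.
    rewrite (plE _ t) => [|x]; last by rewrite !gcompE ginvKV ginvK.
    by move=> ->; apply: plE => x; rewrite !gcompE ginvKV.
  rewrite (pl_right _ _ _ E); apply: plE => x.
  by rewrite !gcompE ginvKV.
have qg : q v * (size vs)%:R = 1.
  have : \sum_(v' <- vs) q v' = 1.
    rewrite /q -mean_sum // -[RHS](mean_cst 1); apply: eq_mean => t.
    rewrite sum_indicator //; case: asboolP => // nin; case: nin.
    by apply/Hvs; apply: place_is_place.
  rewrite (eq_big_In qE) big_const_seq count_predT iter_addr_0.
  by rewrite -[_ *+ size vs]mulr_natr.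
have q0 : 0 <= q v.
  by rewrite -(mean_cst 0); apply: le_mean => //; apply: flevel_cst.
have -> : (local_degree K v)%:R = q v * ((size vs)%:R * (local_degree K v)%:R).
  by rewrite mulrA qg mul1r.
rewrite ler_wpM2l // -natrM ler_nat.
by rewrite mulnC.
Qed.

(** * Continuity *)

(** Computed in the normal closure of Q(z), the norm has at a place over p the term |ord z| log p
    weighted by local degree over degree; by [mean_place_bound] this weight is at least the mean of
    the event that t induces the place. *)
Lemma normS_mean z r p : z != 0 -> prime p -> normS z r ->
  ratr (mean (fun t => `|ordp p (t z)|)) * rlog p%:R <= r.
Proof.
move=> z0 p_pr Hr; pose Y := nclos [:: z]; have sY : gstable Y := @nclos_stable _.
pose K := fixK Y; have nfK : number_field K := fixK_number_field Y; have [sfK _] := nfK.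
have Kz : K z by apply: fixK_mem; apply: nclos_sub; rewrite inE.
have [vs cov] := covers_exist nfK Kz z0.
have SK : in_SK K z 1 z.
  split=> //; exists 1; rewrite expr1 mulr1; split=> //; split; first exact: Aint1.
  by rewrite invr1 oner_eq0; split=> //; exact: Aint1.
rewrite (Hr K 1%N z vs nfK SK cov); have [nd vsP cv] := cov.
pose G (v : algC -> RR) (t : Gal) : rat := (`[< place p t K = v >])%:R * `|ordp p (t z)|.
have lpl v : flevel (fun t => (`[< place p t K = v >])%:R : rat).
  exact: (flevel_app (fun w => (`[< w = v >])%:R) (flevel_place p nfK)).
have lG v : flevel (G v).
  apply: (flevel_app2 *%R) => //.
  exact: flevel_app (flevel_ordp p z).
have -> : mean (fun t => `|ordp p (t z)|) = \sum_(v <- vs) mean (G v).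
  rewrite -mean_sum //; apply: eq_mean => t; rewrite /G -mulr_suml sum_indicator //.
  case: asboolP => [_|nin]; rewrite ?mul1r // mul0r.
  suff -> : ordp p (t z) = 0 by rewrite normr0.
  apply: (pexp_inj p_pr); rewrite pexp0 -wabsE ?fmorph_eq0 // -(placeE _ _ Kz).
  apply/eqP/negPn/negP => ne; apply: nin; apply: cv => //.
  by exists p; apply: place_is_place.
rewrite rmorph_sum mulr_suml.
have degK : (0 < degQ K)%N.
  have [b [[_ spanb _] <-]] : exists b, is_Qbasis K b /\ size b = degQ K.
    apply: (choose_natP (P := fun n => exists s, is_Qbasis K s /\ size s = n)).
    by case: nfK => _ [b bb]; exists (size b), b.
  rewrite lt0n; apply/eqP => sz; have [q E] := spanb 1 (sub1K sfK).
  have /eqP := E; rewrite /rat_comb big1 ?oner_eq0 // => -[i] /=.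
  by rewrite sz.
have lp0 := rlog_prime_gt0 p_pr.
apply: ler_sum => v _.
case: (pselect (exists t, place p t K = v)) => [[s0 <-]|nt]; last first.
  have -> : mean (G v) = 0.
    rewrite -(mean_cst 0); apply: eq_mean => t; rewrite /G; case: asboolP => [e|_].
      by case: nt; exists t.
    by rewrite mul0r.
  by rewrite rmorph0 mul0r normr_ge0.
set v0 := place p s0 K.
have -> : mean (G v0) = `|ordp p (s0 z)| * mean (fun t => (`[< place p t K = v0 >])%:R).
  rewrite -meanZ //; apply: eq_mean => t; rewrite /G mulrC.
  case: asboolP => [e|_]; last by rewrite !mulr0.
  congr (`|_| * _); apply: (pexp_inj p_pr); move/(congr1 (fun w => w z)): e.
  by rewrite /v0 !placeE // !wabsE ?fmorph_eq0.
have := mean_place_bound s0 sY p_pr; rewrite -/K -/v0; set mu := mean _ => le.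
rewrite /log_vnorm /v0 placeE // wabsE ?fmorph_eq0 // log_pexp divr1 -/v0.
set L := (local_degree K v0)%:R / _; have L0 : 0 <= L by rewrite divr_ge0 ?ler0n.
rewrite [X in _ <= X]normrM (ger0_norm L0) normrN [X in _ <= _ * X]normrM (gtr0_norm lp0).
rewrite [X in _ <= X]mulrA; apply: ler_wpM2r; first exact: ltW.
rewrite rmorphM /= ratr_norm mulrC; apply: ler_wpM2r; first exact: normr_ge0.
rewrite /L ler_pdivlMr ?ltr0n //.
by rewrite -[X in _ * X](ratr_nat _ (degQ K)) -rmorphM -(ratr_nat _ (local_degree _ _)) ler_rat.
Qed.

(** Each atom is dominated by the mean of |ord|, and [rlog 2] bounds all [rlog p] from below, so one
    constant serves all primes. *)
Lemma PhiA_bound A z r : z != 0 -> normS z r ->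
  ratr `|PhiA A z| * rlog 2 <= ratr (\sum_(a <- A) `|a.2|) * r.
Proof.
move=> z0 Hr; have l2 := rlog2_gt0.
have r0 : 0 <= r.
  have := normS_mean z0 (isT : prime 2) Hr; apply: le_trans; rewrite mulr_ge0 ?(ltW l2) //.
  rewrite ler0q -(mean_cst 0); apply: le_mean => [||t]; rewrite ?normr_ge0 //.
    exact: flevel_cst.
  exact: flevel_app (flevel_ordp 2 z).
rewrite rmorph_sum mulr_suml.
have : `|PhiA A z| <= \sum_(a <- A) `|a.2| * `|atom_of a.1 z|.
  by rewrite (le_trans (ler_norm_sum _ _ _)) // ler_sum // => a _; rewrite normrM.
rewrite -(ler_rat RR) -(ler_pM2r l2) => /le_trans; apply.
rewrite rmorph_sum mulr_suml; apply: ler_sum => a _.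
rewrite rmorphM -mulrA ler_wpM2l ?ler0q ?normr_ge0 //; set p := a.1.1.1.
case: (boolP (prime p)) => [p_pr|np]; last first.
  by rewrite /atom_of atom_nprime // normr0 rmorph0 mul0r.
apply: le_trans (normS_mean z0 p_pr Hr).
have lo : flevel (fun t : Gal => `|ordp p (t z)|) := flevel_app _ (flevel_ordp p z).
have le : `|atom_of a.1 z| <= mean (fun t => `|ordp p (t z)|).
  rewrite (le_trans (mean_norm (flevel_atom _ _ _ _))) //.
  apply: le_mean => // [|t]; first exact: flevel_app (flevel_atom _ _ _ _).
  by case: eqP => _; rewrite ?mul1r // mul0r normr0.
apply: (@le_trans _ _ (ratr (mean (fun t => `|ordp p (t z)|)) * rlog 2)).
  by rewrite ler_wpM2r ?(ltW l2) // ler_rat.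
rewrite ler_wpM2l ?rlog_prime_ge // ler0q.
by rewrite (le_trans _ le) // normr_ge0.
Qed.

Lemma PhiA_Sprime A : Sprime (PhiA A).
Proof.
split; first exact: PhiA_Sdual.
have [_ hP _] := PhiA_Sdual A.
move=> x0 x00 eps eps0; have l2 := rlog2_gt0.
pose C : RR := ratr (\sum_(a <- A) `|a.2|).
have C0 : 0 <= C by rewrite ler0q sumr_ge0 // => a _; apply: normr_ge0.
have C1 : 0 < C + 1 by rewrite ltr_wpDl.
(* The summand 1 keeps the denominator positive when all coefficients are zero. *)
exists (eps * rlog 2 / (C + 1)); first by rewrite divr_gt0 // mulr_gt0.
move=> x r xn Hr ltr; have z0 : x / x0 != 0 by rewrite mulf_neq0 ?invr_eq0.
have := PhiA_bound A z0 Hr; rewrite hP ?invr_eq0 // (ghomV hP) //.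
rewrite -rmorphB -ratr_norm /= -/C => le.
rewrite -(ltr_pM2r l2) (le_lt_trans le) //.
apply: (@le_lt_trans _ _ (C * (eps * rlog 2 / (C + 1)))); first by rewrite ler_wpM2l // ltW.
rewrite mulrA ltr_pdivrMr // mulrC ltr_pM2l ?mulr_gt0 // ltrDl ltr01 //.
Qed.

Theorem theorem2p3 :
  [/\ countable Cstar,
      (forall Phi, Cstar Phi -> Sprime Phi),
      Cstar (fun _ => 0),
      (forall Phi Psi, Cstar Phi -> Cstar Psi -> Cstar (fun x => Phi x + Psi x)) &
      (forall (q : rat) Phi, Cstar Phi -> Cstar (fun x => q * Phi x))] /\
      (forall Phi, Sdual Phi -> exists Phin : nat -> algC -> rat,
         (forall n, Cstar (Phin n)) /\
         forall x, x != 0 -> exists N, forall n, (N <= n)%N -> Phin n x = Phi x).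
Proof.
split; first split.
- have sub : (Cstar `<=` range PhiA)%classic.
    by move=> Phi /Cstar_PhiA[A ->]; exists A.
  apply: sub_countable (subset_card_le sub) _.
  (* The index type is built from [algC], [nat] and [rat], hence countable. *)
  by apply: sub_countable (card_image_le _ _) _; apply: countableP.
- by move=> Phi /Cstar_PhiA[A ->]; apply: PhiA_Sprime.
- have -> : (fun _ : algC => 0 : rat) = PhiA [::].
    by apply/funext => x; rewrite /PhiA big_nil.
  exact: PhiA_Cstar.
- move=> _ _ /Cstar_PhiA[A ->] /Cstar_PhiA[B ->].
  have -> : (fun x => PhiA A x + PhiA B x) = PhiA (A ++ B).
    by apply/funext => x; rewrite /PhiA big_cat.
  exact: PhiA_Cstar.
- move=> q _ /Cstar_PhiA[A ->].
  have -> : (fun x => q * PhiA A x) = PhiA [seq (a.1, q * a.2) | a <- A].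
    apply/funext => x; rewrite /PhiA big_map mulr_sumr.
    by apply: eq_bigr => a _; rewrite mulrA.
  exact: PhiA_Cstar.
move=> Phi dP.
(* The nonzero numbers with code at most n; each nonzero number belongs to all but finitely many of
   these lists. *)
pose xs n := [seq x <- pmap (fun i => unpickle i : option algC) (iota 0 n.+1) | x != 0].
have HA n : exists A, forall x, x \in xs n -> Phi x = PhiA A x.
  by apply: approximation => //; apply: filter_all.
exists (fun n => PhiA (projT1 (cid (HA n)))); split; first by move=> n; apply: PhiA_Cstar.
move=> x x0; exists (pickle x) => n le; case: (cid (HA n)) => A /= <- //.
rewrite mem_filter x0 mem_pmap; apply/mapP; exists (pickle x); last by rewrite pickleK.
by rewrite mem_iota /= add0n ltnS.
Qed.
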